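(* Let $G$ be a 4-dimensional simply connected unimodular Lie group with 4-dimensional isometry group, i.e. one of $\mathrm{Nil}^4$, $\mathrm{Sol}_1^4$, $\mathrm{Sol}_{m,n}^4$, with Lie algebra $\mathfrak g$, endowed with a left-invariant metric given by an orthonormal basis $\{E_1,E_2,E_3,E_4\}$ of $\mathfrak g$ with metric coefficients $d_i$ (as specified in the context). Let $\mathfrak h$ be one of the 3-dimensional subalgebras of $\mathfrak g$ listed below, $H\subset G$ the connected Lie subgroup with Lie algebra $\mathfrak h$, and $\gamma$ a unit-speed geodesic, with parameter $t\in\mathbb R$, that meets $H$ orthogonally at $\gamma(0)=e$. Then the homogeneous hypersurface $H\cdot\gamma(t)$ and its shape operator $S^t$ (written as a matrix in an orthonormal basis of $T_{\gamma(t)}(H\cdot\gamma(t))$) satisfy the following. (1) $G=\mathrm{Nil}^4$, with $d_1,d_3>0$, $d_2\ge 0$, and $\mathfrak h=\mathrm{span}\{E_1,E_2,aE_3+bE_4\}$ with $a,b\in\mathbb R$ not both zero: $$S^t=\frac{1}{2d_3d_1}\begin{bmatrix}0&\omega&d_1\\ \omega&0&-d_2\\ d_1&-d_2&0\end{bmatrix},\qquad \omega=\frac{a\,d_3^2}{\sqrt{a^2+b^2}}.$$ All orbits are minimal but none is totally geodesic. (2) $G=\mathrm{Sol}_1^4$, with $d_1,d_5>0$, $d_2,d_4\ge 0$, $d_3\in\mathbb R$: (a) $\mathfrak h=\mathrm{span}\{E_1,E_2,E_3\}$: $$S^t=d_5\begin{bmatrix}0&\omega&\theta\\ \omega&-1&-d_4\\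 \theta&-d_4&1\end{bmatrix},\qquad \omega=\frac{d_2}{2d_1},\quad \theta=\frac{2d_4d_2-d_3}{2d_1}.$$ All orbits are minimal but none is totally geodesic. (b) $\mathfrak h=\mathrm{span}\{E_1,E_2,E_4\}$: $$S^t=d_5\begin{bmatrix}0&\omega(t)&\theta\\ \omega(t)&\tanh(-d_5t)&-d_4\\ \theta&-d_4&-\tanh(-d_5t)\end{bmatrix},\qquad \omega(t)=\frac{1-d_2d_5\sinh(-d_5t)}{2d_1d_5\cosh(-d_5t)},\quad \theta=\frac{2d_4d_2-d_3}{2d_1}.$$ All orbits are minimal but none is totally geodesic. (c) $\mathfrak h=\mathrm{span}\big\{E_1,E_4,\tfrac{1}{\sqrt{d_4^2+1}}(d_4E_2-E_3)\big\}$: $$S^t=d_5\begin{bmatrix}0&\omega(t)&\theta\\ \omega(t)&\tanh(-d_5t)&-d_4\\ \theta&-d_4&-\tanh(-d_5t)\end{bmatrix},$$ $$\omega(t)=\frac{\sqrt{1+d_4^2}+d_5(d_3-d_2d_4)\sinh(-d_5t)}{2d_1d_5\cosh(-d_5t)},\qquad \theta=\frac{d_2(1+2d_4^2)-d_3d_4}{2d_1\sqrt{1+d_4^2}}.$$ All orbits are minimal but none is totally geodesic. (3) $G=\mathrm{Sol}_{m,n}^4$, with $d_4>0$, $d_1,d_3\ge 0$, $d_2\in\mathbb R$ and $\lambda>1$: (a) $\mathfrak h=\mathrm{span}\{E_1,E_2,E_3\}$: $$S^t=-\frac{d_4}{2}\begin{bmatrix}-2\lambda&-d_1(\lambda-1)&\omega\\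 -d_1(\lambda-1)&-2&-d_3(\lambda+2)\\ \omega&-d_3(\lambda+2)&2(\lambda+1)\end{bmatrix},\qquad \omega=d_1d_3(\lambda+2)-d_2(2\lambda+1).$$ All orbits are minimal but none is totally geodesic. (b) $\mathfrak h=\mathrm{span}\{E_1,E_2,E_4\}$: $$S^t=-\frac{d_4}{2}\begin{bmatrix}2\lambda\tanh(ut)&d_1(\lambda-1)\tanh(ut)&\omega\\ d_1(\lambda-1)\tanh(ut)&2\tanh(ut)&-d_3(\lambda+2)\\ \omega&-d_3(\lambda+2)&-2(\lambda+1)\tanh(ut)\end{bmatrix},$$ $$\omega=d_1d_3(\lambda+2)-d_2(2\lambda+1),\qquad u=d_4(\lambda+1).$$ All orbits are minimal. An orbit $H\cdot\gamma(t)$ is totally geodesic if and only if $t=d_2=d_3=0$. (c) $\mathfrak h=\mathrm{span}\{E_1,\ d_3E_2-E_3,\ E_4\}$: $$S^t=\frac{d_4}{2}\begin{bmatrix}2\lambda\tanh(d_4t)&\omega(t)&\theta\\ \omega(t)&-2(\lambda+1)\tanh(d_4t)&d_3(\lambda+2)\\ \theta&d_3(\lambda+2)&2\tanh(d_4t)\end{bmatrix},$$ $$\omega(t)=\frac{(1+2\lambda)(d_2-d_3d_1)\tanh(d_4t)}{\sqrt{1+d_3^2}},\qquad \theta=\frac{d_1(1-\lambda)+d_1d_3^2(2+\lambda)-d_2d_3(1+2\lambda)}{\sqrt{1+d_3^2}}.$$ All orbits are minimal. An orbit $H\cdot\gamma(t)$ is totally geodesic if and only if $t=d_1=d_3=0$.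 (d) $\mathfrak h=\mathrm{span}\{d_1E_1-E_2,\ d_2E_1-E_3,\ E_4\}$: with $P=-\dfrac{1}{\lambda d_4}$, $$S^t=d_4\begin{bmatrix}\tanh(Pt)&\omega(t)&\theta\\ \omega(t)&-(\lambda+1)\tanh(Pt)&\rho\\ \theta&\rho&\lambda\tanh(Pt)\end{bmatrix},$$ $$\omega(t)=\frac12\left[\frac{(1+d_1^2+d_2^2)\big(d_3(2+\lambda)(1+d_1^2)-d_1d_2(1+2\lambda)\big)}{\sqrt{(1+d_1^2)(1+d_1^2+d_2^2)\big(d_2^2+(1+d_1^2)\tanh^2(Pt)\big)}}-\frac{(1+d_1^2)\big(d_3(1+d_1^2)-d_1d_2\big)(2+\lambda)\,\mathrm{sech}^2(Pt)}{\sqrt{(1+d_1^2)(1+d_1^2+d_2^2)\big(d_2^2+(1+d_1^2)\tanh^2(Pt)\big)}}\right],$$ $$\theta=\frac{d_1(\lambda-1)\sqrt{1+d_1^2+d_2^2}\,\tanh(Pt)}{2\sqrt{d_2^2+(1+d_1^2)\tanh^2(Pt)}},\qquad \rho=-\frac{d_2(1+2\lambda)}{2\sqrt{1+d_1^2}}.$$ All orbits are minimal. An orbit $H\cdot\gamma(t)$ is totally geodesic if and only if $t=d_2=0$.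
   Context: $e$ denotes the identity of $G$. $H$ acts on $G$ by left translations and $H\cdot\gamma(t)=\{h\gamma(t):h\in H\}$ is the orbit through $\gamma(t)$; these orbits are the parallel (equidistant) hypersurfaces of $H$, and $\gamma'(t)$ is normal to $H\cdot\gamma(t)$. The shape operator with respect to a unit normal field $\nu$ (here the left-invariant field equal to $\pm\gamma'(t)$ at $\gamma(t)$) is $SX=-\nabla_X\nu$, where $\nabla$ is the Levi-Civita connection of $G$. A hypersurface is minimal if its shape operator has zero trace, and totally geodesic if its shape operator vanishes. The Lie algebras are given by a basis $\{e_1,e_2,e_3,e_4\}$ with the following brackets (all other brackets of basis vectors $e_i,e_j$, $i<j$, vanish), and the orthonormal basis $\{E_i\}$ defining the left-invariant metric is as follows. - $\mathrm{Nil}^4$ (also written $\mathrm{Nil}_4$): $[e_2,e_4]=e_1$, $[e_3,e_4]=e_2$. Orthonormal basis: $E_1=d_1e_1$, $E_2=d_2e_1+d_3e_2$, $E_3=e_3$, $E_4=e_4$, where $d_1,d_3>0$, $d_2\ge 0$. - $\mathrm{Sol}_1^4$: $[e_2,e_3]=e_1$, $[e_2,e_4]=-e_2$, $[e_3,e_4]=e_3$. Orthonormal basis: $E_1=d_1e_1$, $E_2=d_2e_1+e_2$, $E_3=d_3e_1+d_4e_2+e_3$, $E_4=d_5e_4$, where $d_1,d_5>0$, $d_2,d_4\ge 0$, $d_3\in\mathbb R$. - $\mathrm{Sol}_{m,n}^4$ (also written $\mathrm{Sol}_\lambda^4$): $[e_1,e_4]=-\lambda e_1$, $[e_2,e_4]=-e_2$,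 $[e_3,e_4]=(\lambda+1)e_3$, where $\lambda>1$ is the real parameter attached to integers $m,n$ such that $x^3-mx^2+nx-1=0$ has three distinct positive real roots $\alpha_1>\alpha_2>\alpha_3$, $\lambda=\ln\alpha_1/\ln\alpha_2$. Orthonormal basis: $E_1=e_1$, $E_2=d_1e_1+e_2$, $E_3=d_2e_1+d_3e_2+e_3$, $E_4=d_4e_4$, where $d_4>0$, $d_1,d_3\ge 0$, $d_2\in\mathbb R$. By a known result, every left-invariant metric on these groups is isometric to one of those above.
   Formalization: Corrected: in 2(c) the denominator of ω(t) gains a factor √(1+d4²); in 3(d) P = −λd4, totally geodesic iff t=d1=d2=0, and the matrix is not claimed at t=d2=0 (0/0). The direction of γ and sign of ν are fixed per case; for the reversed geodesic t becomes −t. *)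

(* Defs.v *)
From HB Require Import structures.
From mathcomp Require Import all_boot all_order all_algebra.
From mathcomp Require Import all_classical all_reals all_analysis.
From mathcomp Require Import ring lra.
Set Implicit Arguments.
Unset Strict Implicit.
Unset Printing Implicit Defensive.
Import Order.TTheory GRing.Theory Num.Theory.
Import numFieldNormedType.Exports.
Local Open Scope classical_set_scope.
Local Open Scope ring_scope.

Definition cosh (R : realType) (x : R) : R := (expR x + expR (- x)) / 2.
Definition sinh (R : realType) (x : R) : R := (expR x - expR (- x)) / 2.
Definition tanh (R : realType) (x : R) : R := sinh x / cosh x.
Definition sech (R : realType) (x : R) : R := (cosh x)^-1.

Definition vec4 (R : realType) (a b c d : R) : 'rV[R]_4 :=
  \row_(j < 4) nth 0 [:: a; b; c; d] j.

Definition mx3 (R : realType) (rows : seq (seq R)) : 'M[R]_3 :=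
  \matrix_(i < 3, j < 3) nth 0 (nth [::] rows i) j.

Definition x1 (R : realType) (p : 'rV[R]_4) : R := p 0 (@Ordinal 4 0 isT).
Definition x2 (R : realType) (p : 'rV[R]_4) : R := p 0 (@Ordinal 4 1 isT).
Definition x3 (R : realType) (p : 'rV[R]_4) : R := p 0 (@Ordinal 4 2 isT).
Definition x4 (R : realType) (p : 'rV[R]_4) : R := p 0 (@Ordinal 4 3 isT).

(* Riemannian geometry on the manifold R^4 = 'rV[R]_4.  Every tangent space is
   identified with 'rV[R]_4; g p u v is the metric at p on the vectors u, v. *)
Section Riemannian.
Variable R : realType.
Local Notation V := 'rV[R]_4.
Implicit Types (g : V -> V -> V -> R) (S : set V) (X Y nu : V -> V).

Definition field_bracket X Y (p : V) : V := 'D_(X p) Y p - 'D_(Y p) X p.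

Definition gcoef g (i j : 'I_4) (p : V) : R :=
  g p (delta_mx 0 i) (delta_mx 0 j).

Definition gram g (p : V) : 'M[R]_4 := \matrix_(i, j) gcoef g i j p.

Definition christoffel g (p : V) (k i j : 'I_4) : R :=
  2^-1 * \sum_(l < 4) invmx (gram g p) k l *
    ('D_(delta_mx 0 i) (gcoef g j l) p + 'D_(delta_mx 0 j) (gcoef g i l) p
     - 'D_(delta_mx 0 l) (gcoef g i j) p).

Definition Gamma g (p u v : V) : V :=
  \row_k \sum_(i < 4) \sum_(j < 4) christoffel g p k i j * u 0 i * v 0 j.

(* Levi-Civita derivative at p of the vector field Y in the direction u. *)
Definition nabla g (u : V) Y (p : V) : V := 'D_u Y p + Gamma g p u (Y p).

Definition geodesic g (c : R -> V) : Prop :=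
  [/\ forall t, derivable c t 1,
      forall t, derivable (derive1 c) t 1 &
      forall t, derive1 (derive1 c) t + Gamma g (c t) (derive1 c t) (derive1 c t) = 0].

Definition unit_speed g (c : R -> V) : Prop :=
  forall t, g (c t) (derive1 c t) (derive1 c t) = 1.

(* Velocities at p of differentiable curves contained in S. *)
Definition tangent S (p : V) : set V :=
  [set v | exists c : R -> V, [/\ forall s, derivable c s 1,
             forall s, S (c s), c 0 = p & derive1 c 0 = v]].

Definition unit_normal_field g S nu : Prop :=
  forall p, S p ->
    g p (nu p) (nu p) = 1 /\ (forall v, tangent S p v -> g p (nu p) v = 0).

Definition shape_operator g nu (p v : V) : V := - nabla g v nu p.

Definition orthonormal_basis g (p : V) (T : set V) (B : 'I_3 -> V) : Prop :=
  [/\ forall i, T (B i),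
      forall i j, g p (B i) (B j) = (i == j)%:R &
      forall v, T v -> exists a : 'I_3 -> R, v = \sum_i a i *: B i].

Definition shape_matrix g S nu (p : V) (M : 'M[R]_3) : Prop :=
  exists B : 'I_3 -> V, orthonormal_basis g p (tangent S p) B /\
    forall j, shape_operator g nu p (B j) = \sum_i M i j *: B i.

Definition minimal g S nu : Prop :=
  forall p B, S p -> orthonormal_basis g p (tangent S p) B ->
    \sum_i g p (shape_operator g nu p (B i)) (B i) = 0.

Definition totally_geodesic g S nu : Prop :=
  forall p v, S p -> tangent S p v -> shape_operator g nu p v = 0.

End Riemannian.

(* A group law on R^4 with identity 0; the laws used below are analytic, so
   that each is a simply connected Lie group with Lie algebra T_0 R^4. *)
Record group4 (R : realType) := Group4 {
  gmul : 'rV[R]_4 -> 'rV[R]_4 -> 'rV[R]_4;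
  ginv : 'rV[R]_4 -> 'rV[R]_4;
  gmulA : associative gmul;
  gmul0 : left_id 0 gmul;
  gmulV : left_inverse 0 ginv gmul }.

Section LeftInvariant.
Variables (R : realType) (G : group4 R).
Local Notation V := 'rV[R]_4.

(* The left-invariant field with value X at the identity: d(L_p)_0 X. *)
Definition left_field (X p : V) : V := 'D_X (gmul G p) 0.

(* Maurer-Cartan form: the left translate of v in T_p back to the identity. *)
Definition maurer_cartan (p v : V) : V := 'D_v (gmul G (ginv G p)) p.

(* Left-invariant metric for which the basis E of the Lie algebra is
   orthonormal: X *m invmx F is the row of coordinates of X in E. *)
Definition left_metric (E : 4.-tuple V) (p u v : V) : R :=
  let F : 'M[R]_4 := \matrix_(i < 4) tnth E i in
  \sum_(i < 4) (maurer_cartan p u *m invmx F) 0 i *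
               (maurer_cartan p v *m invmx F) 0 i.

Definition one_parameter_subgroup (f : R -> V) : Prop :=
  (forall s, derivable f s 1) /\ (forall s t, f (s + t) = gmul G (f s) (f t)).

(* The subgroup generated by exp h. *)
Inductive lie_subgroup (h : {vspace V}) : V -> Prop :=
| lie_subgroup_id : lie_subgroup h 0
| lie_subgroup_exp f s q :
    one_parameter_subgroup f -> derive1 f 0 \in h -> lie_subgroup h q ->
    lie_subgroup h (gmul G (f s) q).

Definition orbit (h : {vspace V}) (p : V) : set V :=
  [set gmul G q p | q in lie_subgroup h].

(* sigma = 1 or -1 selects one of the two unit normals of the orbit. *)
Definition normal_field (c : R -> V) (t sigma : R) : V -> V :=
  left_field (sigma *: maurer_cartan (c t) (derive1 c t)).

Definition normal_geodesic (g : V -> V -> V -> R) (h : {vspace V})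
    (c : R -> V) : Prop :=
  [/\ geodesic g c, unit_speed g c, c 0 = 0 &
      forall v, tangent (lie_subgroup h) 0 v -> g 0 (derive1 c 0) v = 0].

(* There are two unit-speed geodesics through the identity normal to the
   subgroup, t |-> c t and t |-> c (- t); s = 1 or -1 tells which one c is,
   by comparing its initial velocity with xi. *)
Definition orientation (c : R -> V) (xi : V) (s : R) : Prop :=
  (s = 1 \/ s = -1) /\ derive1 c 0 = s *: xi.

Definition orbit_shape_matrix (g : V -> V -> V -> R) (h : {vspace V})
    (c : R -> V) (t sigma : R) (M : 'M[R]_3) : Prop :=
  shape_matrix g (orbit h (c t)) (normal_field c t sigma) (c t) M.

Definition orbit_minimal (g : V -> V -> V -> R) (h : {vspace V})
    (c : R -> V) (t : R) : Prop :=
  unit_normal_field g (orbit h (c t)) (normal_field c t 1) /\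
  minimal g (orbit h (c t)) (normal_field c t 1).

Definition orbit_totally_geodesic (g : V -> V -> V -> R) (h : {vspace V})
    (c : R -> V) (t : R) : Prop :=
  totally_geodesic g (orbit h (c t)) (normal_field c t 1).

End LeftInvariant.

Section Groups.
Variable R : realType.
Local Notation V := 'rV[R]_4.

Definition e1 : V := vec4 1 0 0 0.
Definition e2 : V := vec4 0 1 0 0.
Definition e3 : V := vec4 0 0 1 0.
Definition e4 : V := vec4 0 0 0 1.

Lemma vec4P (p q : V) :
  x1 p = x1 q -> x2 p = x2 q -> x3 p = x3 q -> x4 p = x4 q -> p = q.
Proof.
move=> h1 h2 h3 h4; apply/rowP => -[[|[|[|[|//]]]] hi].
- by move: h1; rewrite /x1 (bool_irrelevance hi isT).
- by move: h2; rewrite /x2 (bool_irrelevance hi isT).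
- by move: h3; rewrite /x3 (bool_irrelevance hi isT).
- by move: h4; rewrite /x4 (bool_irrelevance hi isT).
Qed.

Lemma x1_vec4 (a b c d : R) : x1 (vec4 a b c d) = a. Proof. by rewrite /x1 mxE. Qed.
Lemma x2_vec4 (a b c d : R) : x2 (vec4 a b c d) = b. Proof. by rewrite /x2 mxE. Qed.
Lemma x3_vec4 (a b c d : R) : x3 (vec4 a b c d) = c. Proof. by rewrite /x3 mxE. Qed.
Lemma x4_vec4 (a b c d : R) : x4 (vec4 a b c d) = d. Proof. by rewrite /x4 mxE. Qed.
Lemma x1_0 : x1 (0 : V) = 0. Proof. by rewrite /x1 mxE. Qed.
Lemma x2_0 : x2 (0 : V) = 0. Proof. by rewrite /x2 mxE. Qed.
Lemma x3_0 : x3 (0 : V) = 0. Proof. by rewrite /x3 mxE. Qed.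
Lemma x4_0 : x4 (0 : V) = 0. Proof. by rewrite /x4 mxE. Qed.
Definition xE := (x1_vec4, x2_vec4, x3_vec4, x4_vec4, x1_0, x2_0, x3_0, x4_0).

(* All three groups are semidirect products N ><| R with x4 the coordinate of
   the factor R, which acts on N by s |-> exp (- s ad e4).  For Nil^4 and
   Sol_{m,n}^4, N = R^3; for Sol_1^4, N is the Heisenberg group with the law
   (x, y, z) (x', y', z') = (x + x' + y z', y + y', z + z'). *)
Definition nil4_mul (p q : V) : V :=
  vec4 (x1 p + x1 q - x4 p * x2 q + x4 p ^+ 2 / 2 * x3 q)
       (x2 p + x2 q - x4 p * x3 q)
       (x3 p + x3 q)
       (x4 p + x4 q).

Definition nil4_inv (p : V) : V :=
  vec4 (- (x1 p + x4 p * x2 p + x4 p ^+ 2 / 2 * x3 p))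
       (- (x2 p + x4 p * x3 p))
       (- x3 p)
       (- x4 p).

Lemma nil4_mulA : associative nil4_mul.
Proof. by move=> p q r; apply: vec4P; rewrite /nil4_mul !xE; field. Qed.

Lemma nil4_mul0 : left_id 0 nil4_mul.
Proof. by move=> p; apply: vec4P; rewrite /nil4_mul !xE; field. Qed.

Lemma nil4_mulV : left_inverse 0 nil4_inv nil4_mul.
Proof. by move=> p; apply: vec4P; rewrite /nil4_mul /nil4_inv !xE; field. Qed.

Definition Nil4 : group4 R := Group4 nil4_mulA nil4_mul0 nil4_mulV.

Definition sol1_mul (p q : V) : V :=
  vec4 (x1 p + x1 q + x2 p * (expR (- x4 p) * x3 q))
       (x2 p + expR (x4 p) * x2 q)
       (x3 p + expR (- x4 p) * x3 q)
       (x4 p + x4 q).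

Definition sol1_inv (p : V) : V :=
  vec4 (x2 p * x3 p - x1 p)
       (- (expR (- x4 p) * x2 p))
       (- (expR (x4 p) * x3 p))
       (- x4 p).

Lemma sol1_mulA : associative sol1_mul.
Proof.
move=> p q r; apply: vec4P; rewrite /sol1_mul !xE ?opprD ?expRD; try by ring.
have h : expR (x4 p) * expR (- x4 p) = 1 by rewrite -expRD subrr expR0.
by rewrite -[x2 q in LHS]mul1r -h; ring.
Qed.

Lemma sol1_mul0 : left_id 0 sol1_mul.
Proof.
by move=> p; apply: vec4P; rewrite /sol1_mul !xE ?oppr0 ?expR0; ring.
Qed.

Lemma sol1_mulV : left_inverse 0 sol1_inv sol1_mul.
Proof.
move=> p; have h : expR (x4 p) * expR (- x4 p) = 1.
  by rewrite -expRD subrr expR0.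
apply: vec4P; rewrite /sol1_mul /sol1_inv !xE ?opprK; try by ring.
by rewrite -[x2 p * x3 p in LHS]mul1r -h; ring.
Qed.

Definition Sol1 : group4 R := Group4 sol1_mulA sol1_mul0 sol1_mulV.

Definition sol_mul (l : R) (p q : V) : V :=
  vec4 (x1 p + expR (l * x4 p) * x1 q)
       (x2 p + expR (x4 p) * x2 q)
       (x3 p + expR (- (l + 1) * x4 p) * x3 q)
       (x4 p + x4 q).

Definition sol_inv (l : R) (p : V) : V :=
  vec4 (- (expR (- (l * x4 p)) * x1 p))
       (- (expR (- x4 p) * x2 p))
       (- (expR ((l + 1) * x4 p) * x3 p))
       (- x4 p).

Lemma sol_mulA l : associative (sol_mul l).
Proof.
by move=> p q r; apply: vec4P; rewrite /sol_mul !xE ?mulrDr ?expRD; ring.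
Qed.

Lemma sol_mul0 l : left_id 0 (sol_mul l).
Proof.
by move=> p; apply: vec4P; rewrite /sol_mul !xE ?mulr0 ?expR0; ring.
Qed.

Lemma sol_mulV l : left_inverse 0 (sol_inv l) (sol_mul l).
Proof.
move=> p; apply: vec4P; rewrite /sol_mul /sol_inv !xE ?mulrNN ?mulrN; ring.
Qed.

Definition Sol (l : R) : group4 R :=
  Group4 (@sol_mulA l) (@sol_mul0 l) (@sol_mulV l).

(* l is the parameter of Sol_{m,n}^4. *)
Definition sol_parameter (m n : int) (l : R) : Prop :=
  exists a1 a2 a3 : R,
    [/\ 0 < a3, a3 < a2, a2 < a1,
        (forall a, a \in [:: a1; a2; a3] ->
           a ^+ 3 - m%:~R * a ^+ 2 + n%:~R * a - 1 = 0) &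
        l = ln a1 / ln a2].

End Groups.

(* The Lie algebras of the three groups, computed from left-invariant fields. *)
Section LieAlgebras.
Variable R : realType.
Local Notation V := 'rV[R]_4.

Lemma x1L (a : R) (u v : V) : x1 (a *: u + v) = a * x1 u + x1 v.
Proof. by rewrite /x1 !mxE. Qed.
Lemma x2L (a : R) (u v : V) : x2 (a *: u + v) = a * x2 u + x2 v.
Proof. by rewrite /x2 !mxE. Qed.
Lemma x3L (a : R) (u v : V) : x3 (a *: u + v) = a * x3 u + x3 v.
Proof. by rewrite /x3 !mxE. Qed.
Lemma x4L (a : R) (u v : V) : x4 (a *: u + v) = a * x4 u + x4 v.
Proof. by rewrite /x4 !mxE. Qed.
Lemma x1B (u v : V) : x1 (u - v) = x1 u - x1 v.
Proof. by rewrite /x1 !mxE. Qed.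
Lemma x2B (u v : V) : x2 (u - v) = x2 u - x2 v.
Proof. by rewrite /x2 !mxE. Qed.
Lemma x3B (u v : V) : x3 (u - v) = x3 u - x3 v.
Proof. by rewrite /x3 !mxE. Qed.
Lemma x4B (u v : V) : x4 (u - v) = x4 u - x4 v.
Proof. by rewrite /x4 !mxE. Qed.
Definition xBE := (x1B, x2B, x3B, x4B).
Lemma x1Z (a : R) (u : V) : x1 (a *: u) = a * x1 u.
Proof. by rewrite /x1 !mxE. Qed.
Lemma x2Z (a : R) (u : V) : x2 (a *: u) = a * x2 u.
Proof. by rewrite /x2 !mxE. Qed.
Lemma x3Z (a : R) (u : V) : x3 (a *: u) = a * x3 u.
Proof. by rewrite /x3 !mxE. Qed.
Lemma x4Z (a : R) (u : V) : x4 (a *: u) = a * x4 u.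
Proof. by rewrite /x4 !mxE. Qed.
Definition xZE := (x1Z, x2Z, x3Z, x4Z).
Definition xLE := (x1L, x2L, x3L, x4L, xE).

(* Not a class, so that proof search does not try to solve it. *)
Definition deriv0 (f : R -> R) (df : R) : Prop := is_derive (0 : R) (1 : R) f df.

Lemma derive_vec4 (f : V -> V) (v p : V) (a b c d : R -> R) (a' b' c' d' : R) :
  (forall h, f (h *: v + p) = vec4 (a h) (b h) (c h) (d h)) ->
  deriv0 a a' -> deriv0 b b' ->
  deriv0 c c' -> deriv0 d d' ->
  'D_v f p = vec4 a' b' c' d'.
Proof.
move=> fE [ha <-] [hb <-] [hc <-] [hd <-].
pose F (h : R) := vec4 (a h) (b h) (c h) (d h).
have -> : 'D_v f p = 'D_1 F 0.
  rewrite /derive.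
  suff -> : (fun h : R => h^-1 *: ((f \o shift p) (h *: v) - f p)) =
    (fun h : R => h^-1 *: ((F \o shift 0) (h *: (1 : R)) - F 0)) by [].
  apply: funext => h /=.
  rewrite fE -[in f p](add0r p) -[X in f (X + p)](scale0r v) fE /F.
  by rewrite [h *: 1]mulr1 addr0.
have FE i j : (fun h => F h i j) = (fun h => nth 0 [:: a h; b h; c h; d h] j).
  by apply/funext => h; rewrite mxE.
have dF : derivable F 0 1.
  apply: (proj2 (@derivable_mxP _ _ _ _ F 0 1)) => i j; rewrite FE.
  case: j => -[|[|[|[|k]]]] hj; last by exfalso; exact: (notF hj).
  - exact: ha.
  - exact: hb.
  - exact: hc.
  - exact: hd.
rewrite (derive_mx dF); apply/matrixP => i j; rewrite mxE FE mxE.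
case: j => -[|[|[|[|k]]]] hj; last by exfalso; exact: (notF hj).
- exact: erefl.
- exact: erefl.
- exact: erefl.
- exact: erefl.
Qed.

Lemma deriv0_affine (f : R -> R) (k m : R) :
  (forall h, f h = k * h + m) -> deriv0 f k.
Proof.
move=> fE; have -> : f = (fun h => k * h + m) by apply/funext.
by rewrite /deriv0; apply: is_derive_eq; rewrite /= addr0 [_ *: _]mulr1.
Qed.

Lemma nil4_fieldE (X p : V) : left_field (Nil4 R) X p =
  vec4 (x1 X - x4 p * x2 X + x4 p ^+ 2 / 2 * x3 X) (x2 X - x4 p * x3 X)
       (x3 X) (x4 X).
Proof.
apply: derive_vec4 => [h||||]; first exact: erefl.
- by apply: (@deriv0_affine _ _ (x1 p)) => h; rewrite !xLE; ring.
- by apply: (@deriv0_affine _ _ (x2 p)) => h; rewrite !xLE; ring.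
- by apply: (@deriv0_affine _ _ (x3 p)) => h; rewrite !xLE; ring.
- by apply: (@deriv0_affine _ _ (x4 p)) => h; rewrite !xLE; ring.
Qed.

Lemma sol1_fieldE (X p : V) : left_field (Sol1 R) X p =
  vec4 (x1 X + x2 p * expR (- x4 p) * x3 X) (expR (x4 p) * x2 X)
       (expR (- x4 p) * x3 X) (x4 X).
Proof.
apply: derive_vec4 => [h||||]; first exact: erefl.
- by apply: (@deriv0_affine _ _ (x1 p)) => h; rewrite !xLE; ring.
- by apply: (@deriv0_affine _ _ (x2 p)) => h; rewrite !xLE; ring.
- by apply: (@deriv0_affine _ _ (x3 p)) => h; rewrite !xLE; ring.
- by apply: (@deriv0_affine _ _ (x4 p)) => h; rewrite !xLE; ring.
Qed.

Lemma sol_fieldE l (X p : V) : left_field (Sol l) X p =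
  vec4 (expR (l * x4 p) * x1 X) (expR (x4 p) * x2 X)
       (expR (- (l + 1) * x4 p) * x3 X) (x4 X).
Proof.
apply: derive_vec4 => [h||||]; first exact: erefl.
- by apply: (@deriv0_affine _ _ (x1 p)) => h; rewrite !xLE; ring.
- by apply: (@deriv0_affine _ _ (x2 p)) => h; rewrite !xLE; ring.
- by apply: (@deriv0_affine _ _ (x3 p)) => h; rewrite !xLE; ring.
- by apply: (@deriv0_affine _ _ (x4 p)) => h; rewrite !xLE; ring.
Qed.

Lemma deriv0_mul (f g h : R -> R) (df dg c : R) :
  deriv0 f df -> deriv0 g dg ->
  (forall x, h x = f x * g x) -> f 0 * dg + g 0 * df = c ->
  deriv0 h c.
Proof.
move=> hf hg hE <-; have -> : h = f * g by apply/funext.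
exact: (is_deriveM hf hg).
Qed.

Lemma deriv0_quadratic (f : R -> R) (q k m : R) :
  (forall h, f h = q * h ^+ 2 + k * h + m) -> deriv0 f k.
Proof.
move=> fE; have -> : f = (fun h => h * (q * h + k)) + cst m.
  by apply/funext => h; rewrite fE; change (q * h ^+ 2 + k * h + m = h * (q * h + k) + m); ring.
rewrite /deriv0 -[X in is_derive _ _ _ X]addr0; apply: is_deriveD.
apply: (@deriv0_mul id (fun h => q * h + k) _ 1 q) => //.
- exact: is_derive_id.
- exact: deriv0_affine.
by rewrite mul0r add0r mulr0 add0r mulr1.
Qed.

Lemma deriv0_exp (f : R -> R) (a b k m n : R) :
  (forall h, f h = (a * h + b) * expR (k * h + m) + n) ->
  deriv0 f ((a + b * k) * expR m).
Proof.
move=> fE; have -> : f = (fun h => (a * h + b) * expR (k * h + m)) + cst n.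
  by apply/funext => h; rewrite fE.
have dk : deriv0 (fun h => k * h + m) k.
  exact: deriv0_affine.
have da : deriv0 (fun h => a * h + b) a.
  exact: deriv0_affine.
rewrite /deriv0 -[X in is_derive _ _ _ X]addr0; apply: is_deriveD.
apply: (deriv0_mul da (is_derive1_comp (is_derive_expR _) dk)) => //.
by rewrite /= !mulr0 !add0r; ring.
Qed.

Lemma nil4_bracket (X Y p : V) :
  field_bracket (left_field (Nil4 R) X) (left_field (Nil4 R) Y) p =
  left_field (Nil4 R) ((x2 X * x4 Y - x4 X * x2 Y) *: e1 R
                     + (x3 X * x4 Y - x4 X * x3 Y) *: e2 R) p.
Proof.
have D (U W : V) : 'D_W (left_field (Nil4 R) U) p =
  vec4 (- x4 W * x2 U + x4 p * x4 W * x3 U) (- x4 W * x3 U) 0 0.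
  apply: (@derive_vec4 _ _ _ _ _ _ _ _ _ _ _ (fun h => nil4_fieldE _ _)).
  - apply: (@deriv0_quadratic _ (x4 W ^+ 2 / 2 * x3 U) _
       (x1 U - x4 p * x2 U + x4 p ^+ 2 / 2 * x3 U)) => h.
    by rewrite !xLE; field.
  - by apply: (@deriv0_affine _ _ (x2 U - x4 p * x3 U)) => h; rewrite !xLE; ring.
  - exact: is_derive_cst.
  - exact: is_derive_cst.
rewrite /field_bracket !D !nil4_fieldE.
by apply: vec4P; rewrite /e1 /e2 !(xBE, xLE, xZE); ring.
Qed.

Lemma sol1_bracket (X Y p : V) :
  field_bracket (left_field (Sol1 R) X) (left_field (Sol1 R) Y) p =
  left_field (Sol1 R) ((x2 X * x3 Y - x3 X * x2 Y) *: e1 R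
                     + (- (x2 X * x4 Y - x4 X * x2 Y) *: e2 R
                     + (x3 X * x4 Y - x4 X * x3 Y) *: e3 R)) p.
Proof.
have D (U W : V) : 'D_W (left_field (Sol1 R) U) p =
  vec4 ((x2 W * x3 U + x2 p * x3 U * - x4 W) * expR (- x4 p))
       ((0 + x2 U * x4 W) * expR (x4 p))
       ((0 + x3 U * - x4 W) * expR (- x4 p)) 0.
  apply: (@derive_vec4 _ _ _ _ _ _ _ _ _ _ _ (fun h => sol1_fieldE _ _)).
  - apply: (@deriv0_exp _ _ _ _ _ (x1 U)) => h; rewrite !xLE opprD mulNr.
    by rewrite [x4 W * h]mulrC; ring.
  - apply: (@deriv0_exp _ _ _ _ _ 0) => h.
    by rewrite !xLE [x4 W * h]mulrC; ring.
  - apply: (@deriv0_exp _ _ _ _ _ 0) => h; rewrite !xLE opprD mulNr.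
    by rewrite [x4 W * h]mulrC; ring.
  - exact: is_derive_cst.
have ee : expR (x4 p) * expR (- x4 p) = 1 by rewrite -expRD subrr expR0.
rewrite /field_bracket !D !sol1_fieldE.
apply: vec4P; rewrite /e1 /e2 /e3 !(xBE, xLE, xZE); try by ring.
by transitivity ((expR (x4 p) * expR (- x4 p)) * (x2 X * x3 Y - x3 X * x2 Y) +
  (x2 p * expR (- x4 p) * (x3 X * x4 Y - x4 X * x3 Y))); [ring | rewrite ee; ring].
Qed.

Lemma sol_bracket l (X Y p : V) :
  field_bracket (left_field (Sol l) X) (left_field (Sol l) Y) p =
  left_field (Sol l) (- l * (x1 X * x4 Y - x4 X * x1 Y) *: e1 R
                    + (- (x2 X * x4 Y - x4 X * x2 Y) *: e2 R
                    + (l + 1) * (x3 X * x4 Y - x4 X * x3 Y) *: e3 R)) p.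
Proof.
have D (U W : V) : 'D_W (left_field (Sol l) U) p =
  vec4 ((0 + x1 U * (l * x4 W)) * expR (l * x4 p))
       ((0 + x2 U * x4 W) * expR (x4 p))
       ((0 + x3 U * (- (l + 1) * x4 W)) * expR (- (l + 1) * x4 p)) 0.
  apply: (@derive_vec4 _ _ _ _ _ _ _ _ _ _ _ (fun h => sol_fieldE _ _ _)).
  - apply: (@deriv0_exp _ _ _ _ _ 0) => h; rewrite !xLE.
    have -> : l * (h * x4 W + x4 p) = l * x4 W * h + l * x4 p by ring.
    by ring.
  - apply: (@deriv0_exp _ _ _ _ _ 0) => h; rewrite !xLE.
    by rewrite [h * x4 W]mulrC; ring.
  - apply: (@deriv0_exp _ _ _ _ _ 0) => h; rewrite !xLE.
    have -> : - (l + 1) * (h * x4 W + x4 p) =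
      - (l + 1) * x4 W * h + - (l + 1) * x4 p by ring.
    by ring.
  - exact: is_derive_cst.
rewrite /field_bracket !D !sol_fieldE.
by apply: vec4P; rewrite /e1 /e2 /e3 !(xBE, xLE, xZE); ring.
Qed.

End LieAlgebras.

(* Main.v *)
(* A hypersurface subgroup of one of these groups is the zero set of a linear form
   ell such that ell (p q) = ell p + exp (w x4 p) ell q, so its orbits are the level
   sets of Phi = exp (- w x4) ell, and the left translate to the Lie algebra of a
   tangent space to the orbit through p is the kernel of ell - w Phi(p) x4.
   By Koszul's formula the body velocity u of a geodesic satisfies the Euler-Arnold
   equation <u', Y> = <u, [u, Y]>.  Along the geodesic the covector
   exp (w x4) (ell - w Phi x4) satisfies the same linear equation, hence is
   proportional to <u, .>: this gives both the normality of u to all the orbits and a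
   first-order system with solution u = +- sech (k t) xi + tanh (k t) eta, where xi
   is dual to ell and eta to x4 (u is constant when w = 0).  On vectors tangent to an
   orbit the shape operator is the symmetric part of ad u, because these vectors form a
   subalgebra; it is traceless because the group is unimodular.  The stated matrices are
   then read off in suitable orthonormal bases of the orthogonal complement of u. *)
Require Import Defs.
From HB Require Import structures.
From mathcomp Require Import all_boot all_order all_algebra.
From mathcomp Require Import all_classical all_reals all_analysis.
From mathcomp Require Import ring lra.
Set Implicit Arguments.
Unset Strict Implicit.
Unset Printing Implicit Defensive.
Import Order.TTheory GRing.Theory Num.Theory.
Import numFieldNormedType.Exports.
Local Open Scope classical_set_scope.
Local Open Scope ring_scope.

(** * Directional derivatives and linear differential equations *)

(** The geodesic [c] is given, not constructed, and its coordinates are never solved for: everything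
    is read off the body velocity u, whose equation involves only the bracket and the inner product
    of the Lie algebra. That equation is quadratic in u, but with u frozen inside the bracket it is
    linear in the covector <u, .>. Unit speed bounds its coefficients, so a Gronwall estimate on all
    of R replaces a uniqueness theorem for nonlinear equations. The remaining scalar Riccati
    equation is solved by a first integral. The definitions speak of Christoffel symbols, of curves
    contained in a set and of a subgroup generated by exponentials, and each must be tied to the
    algebra: the coordinate-dependent terms of the connection pair up into brackets, tangent vectors
    to an orbit are realised by explicit curves in a level set, and every zero of ell is written as
    a product of elements of one-parameter subgroups. Since [c] may leave the identity on either
    side of H, signs need care: with u = s U and the normal eps s u, the sign s drops out of the
    matrices. *)

Section DirectionalCalculus.
Variables (R : realType) (V : normedModType R) (p v : V).
Implicit Types (f g : V -> R).

Lemma is_deriveD_fun f g (a b : R) : is_derive p v f a -> is_derive p v g b ->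
  is_derive p v (fun q => f q + g q) (a + b).
Proof. by move=> df dg; exact: is_deriveD. Qed.

Lemma is_deriveN_fun f (a : R) : is_derive p v f a ->
  is_derive p v (fun q => - f q) (- a).
Proof. by move=> df; exact: is_deriveN. Qed.

Lemma is_deriveM_fun f g (a b : R) : is_derive p v f a -> is_derive p v g b ->
  is_derive p v (fun q => f q * g q) (a * g p + f p * b).
Proof.
by move=> df dg; apply: is_derive_eq (is_deriveM df dg) _; rewrite addrC mulrC.
Qed.

Lemma is_deriveMl_fun (k : R) f (a : R) : is_derive p v f a ->
  is_derive p v (fun q => k * f q) (k * a).
Proof. by move=> df; exact: is_deriveZ. Qed.

Lemma is_deriveMr_fun (k : R) f (a : R) : is_derive p v f a ->
  is_derive p v (fun q => f q * k) (a * k).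
Proof.
move=> df; rewrite mulrC; have -> : (fun q => f q * k) = (fun q => k * f q).
  by apply/funext => q; rewrite mulrC.
exact: is_deriveMl_fun.
Qed.

Lemma is_derive_sum_fun n (f : 'I_n -> V -> R) (a : 'I_n -> R) :
  (forall i, is_derive p v (f i) (a i)) ->
  is_derive p v (fun q => \sum_i f i q) (\sum_i a i).
Proof.
move=> df; have -> : (fun q => \sum_i f i q) = \sum_i f i.
  by apply/funext => q; rewrite fct_sumE.
exact: is_derive_sum.
Qed.

End DirectionalCalculus.

Section OneVariable.
Variable R : realType.
Implicit Types (f : R -> R) (t : R).

Lemma is_derive_expR_comp f (a t : R) : is_derive t 1 f a ->
  is_derive t 1 (fun s => expR (f s)) (a * expR (f t)).
Proof.
by move=> df; rewrite mulrC; exact: (is_derive1_comp (is_derive_expR _) df).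
Qed.

Lemma nonincreasing_of_derive f (f' : R -> R) :
  (forall t, is_derive t 1 f (f' t)) -> (forall t, f' t <= 0) ->
  forall x y, x <= y -> f y <= f x.
Proof.
move=> df f'0 x y xy.
have dz z : derivable f z 1 by have [] := df z.
apply: (@ler0_derive1_nincry _ f x) => //.
- by move=> z _; rewrite derive1E; have [_ ->] := df z.
- by apply: derivable_within_continuous => z _.
Qed.

(** [f t * expR (- C * t)] is nonincreasing and [f t * expR (C * t)] nondecreasing: the zero at 0
    propagates forward by the first and backward by the second. *)
Lemma gronwall_zero f (f' : R -> R) (C : R) :
  (forall t, is_derive t 1 f (f' t)) -> (forall t, 0 <= f t) ->
  (forall t, `|f' t| <= C * f t) -> f 0 = 0 -> forall t, f t = 0.
Proof.
move=> df f0 f'C f00 t; apply/eqP; rewrite eq_le f0 andbT.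
have De (k x : R) : is_derive x (1 : R) (fun s => expR (k * s)) (k * expR (k * x)).
  by apply: is_derive_expR_comp; rewrite -[X in is_derive _ _ _ X]mulr1;
    apply: is_deriveMl_fun; exact: is_derive_id.
have [t0|t0] := leP 0 t.
  have : f t * expR (- C * t) <= f 0 * expR (- C * 0).
    apply: (@nonincreasing_of_derive (fun s => f s * expR (- C * s)) _
      (fun x => is_deriveM_fun (df x) (De _ x))) => // x.
    have -> : f' x * expR (- C * x) + f x * (- C * expR (- C * x)) =
      (f' x - C * f x) * expR (- C * x) by ring.
    rewrite pmulr_lle0 ?expR_gt0// subr_le0.
    exact: le_trans (ler_norm _) (f'C x).
  by rewrite f00 mul0r pmulr_lle0 ?expR_gt0.
have : - (f t * expR (C * t)) >= - (f 0 * expR (C * 0)).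
  apply: (@nonincreasing_of_derive (fun s => - (f s * expR (C * s))) _
    (fun x => is_deriveN (is_deriveM_fun (df x) (De _ x)))) => //; last exact: ltW.
  move=> x; have -> : f' x * expR (C * x) + f x * (C * expR (C * x)) =
    (f' x + C * f x) * expR (C * x) by ring.
  rewrite oppr_le0 pmulr_lge0 ?expR_gt0//.
  have := f'C x; rewrite ler_norml => /andP[h _]; lra.
by rewrite f00 mul0r oppr0 oppr_ge0 pmulr_lle0 ?expR_gt0.
Qed.

(** The squared norm of the solution satisfies a Gronwall inequality. The coefficients are only
    asked to be bounded, because in the application they contain the unknown velocity. *)
Lemma linear_ode_zero n (f : 'I_n -> R -> R) (m : 'I_n -> 'I_n -> R -> R) (C : R) :
  (forall i t, is_derive t 1 (f i) (\sum_k m i k t * f k t)) ->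
  (forall i k t, `|m i k t| <= C) -> (forall i, f i 0 = 0) ->
  forall i t, f i t = 0.
Proof.
move=> df mC f0 i t.
pose N s := \sum_j f j s * f j s.
have N0 s : 0 <= N s by apply: sumr_ge0 => j _; rewrite -expr2 sqr_ge0.
have fN j s : `|f j s| ^+ 2 <= N s.
  rewrite /N (bigD1 j)//= real_normK ?num_real// -expr2 lerDl.
  by apply: sumr_ge0 => k _; rewrite -expr2 sqr_ge0.
have ffN j k s : `|f j s * f k s| <= N s.
  rewrite normrM; have := fN j s; have := fN k s.
  set x := `|f j s|; set y := `|f k s|; have := sqr_ge0 (x - y); nra.
have NE : forall s, N s = 0.
  (* The constant 2 n^2 C is kept as a double sum, to be compared with the derivative of [N] term by
     term. *)
  apply: (@gronwall_zero _ (fun s => \sum_j ((\sum_k m j k s * f k s) * f j s +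
      f j s * \sum_k m j k s * f k s)) (\sum_(j < n) \sum_(k < n) 2 * C)) => //.
  - by move=> s; apply: is_derive_sum_fun => j; exact: is_deriveM_fun.
  - move=> s; rewrite mulr_suml; apply: le_trans (ler_norm_sum _ _ _) _.
    apply: ler_sum => j _.
    have -> : (\sum_k m j k s * f k s) * f j s + f j s * (\sum_k m j k s * f k s)
      = \sum_k 2 * (m j k s * (f k s * f j s)).
      rewrite mulr_suml mulr_sumr -big_split/=; apply: eq_bigr => k _; ring.
    rewrite mulr_suml; apply: le_trans (ler_norm_sum _ _ _) _.
    apply: ler_sum => k _; rewrite 2!normrM ger0_norm// -mulrA.
    by rewrite ler_pM2l// ler_pM.
  - by rewrite /N big1// => j _; rewrite f0 mul0r.
have := fN i t; rewrite NE => h; apply/eqP; rewrite -normr_eq0 -sqrf_eq0.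
by rewrite eq_le h sqr_ge0.
Qed.

End OneVariable.

(** * Left-invariant inner products *)

Lemma linear_expand (R : realType) (f : 'rV[R]_4 -> R) (u : 'rV[R]_4) :
  (forall a x y, f (a *: x + y) = a * f x + f y) ->
  f u = \sum_i u 0 i * f (delta_mx 0 i).
Proof.
move=> fL.
have f0 : f 0 = 0 by have := fL (-1) 0 0; rewrite scaler0 addr0 mulN1r addNr.
have fS (r : seq 'I_4) : f (\sum_(i <- r) u 0 i *: delta_mx 0 i) =
    \sum_(i <- r) u 0 i * f (delta_mx 0 i).
  elim: r => [|i r IH]; first by rewrite !big_nil.
  by rewrite !big_cons fL IH.
by rewrite -fS -row_sum_delta.
Qed.

Section VectorDerivative.
Variables (R : realType) (W : normedModType R).
Local Notation V := 'rV[R]_4.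

(** Taken entry by entry, so that the scalar sum and product rules apply; [derive_row] and
    [is_vderiveP] translate to and from [derivable]. *)
Definition is_vderive (p v : W) (X : W -> V) (X' : V) : Prop :=
  forall j, is_derive p v (fun q => X q 0 j) (X' 0 j).

Lemma is_vderive_cst p v (X : V) : is_vderive p v (fun=> X) 0.
Proof. by move=> j; rewrite mxE; exact: is_derive_cst. Qed.

Lemma is_vderiveM p v (X : W -> V) (X' : V) (A : W -> 'M[R]_4) (A' : 'M[R]_4) :
  is_vderive p v X X' ->
  (forall i j, is_derive p v (fun q => A q i j) (A' i j)) ->
  is_vderive p v (fun q => X q *m A q) (X' *m A p + X p *m A').
Proof.
move=> dX dA j.
have -> : (fun q => (X q *m A q) 0 j) = (fun q => \sum_k X q 0 k * A q k j).
  by apply/funext => q; rewrite mxE.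
rewrite !mxE -big_split/=.
by apply: is_derive_sum_fun => k; exact: is_deriveM_fun.
Qed.

Lemma is_vderiveMr p v (X : W -> V) (X' : V) (A : 'M[R]_4) :
  is_vderive p v X X' -> is_vderive p v (fun q => X q *m A) (X' *m A).
Proof.
move=> dX; rewrite -[X in is_vderive _ _ _ X]addr0 -(mulmx0 _ (X p)).
by apply: is_vderiveM => // i j; rewrite mxE; exact: is_derive_cst.
Qed.

Lemma derive_row p v (X : W -> V) (X' : V) : is_vderive p v X X' ->
  derivable X p v /\ 'D_v X p = X'.
Proof.
move=> dX; have dX0 : derivable X p v.
  by apply/derivable_mxP => i j; rewrite (ord1 i); have [] := dX j.
split=> //; rewrite derive_mx//; apply/matrixP => i j.
by rewrite (ord1 i) mxE; have [_ ->] := dX j.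
Qed.

Lemma is_vderiveP p v (X : W -> V) : derivable X p v -> is_vderive p v X ('D_v X p).
Proof.
move=> dX j; have := dX => /derivable_mxP/(_ 0 j) dj.
by rewrite derive_mx// mxE; exact: DeriveDef.
Qed.

Lemma is_vderive_unique p v (X : W -> V) (X' X'' : V) :
  is_vderive p v X X' -> is_vderive p v X X'' -> X' = X''.
Proof. by move=> /derive_row[_ <-] /derive_row[_ <-]. Qed.

End VectorDerivative.

Definition frame_mx (R : realType) (E : 4.-tuple 'rV[R]_4) : 'M[R]_4 :=
  \matrix_(i < 4) tnth E i.

(** The left-invariant metric at the identity. Locked so that conversion does not unfold the
    sums. *)
HB.lock Definition ip (R : realType) (E : 4.-tuple 'rV[R]_4) (X Y : 'rV[R]_4) : R :=
  \sum_(i < 4) (X *m invmx (frame_mx E)) 0 i * (Y *m invmx (frame_mx E)) 0 i.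

(** Gram matrix of [ip] in the standard basis. *)
HB.lock Definition ip_mx (R : realType) (E : 4.-tuple 'rV[R]_4) : 'M[R]_4 :=
  invmx (frame_mx E) *m (invmx (frame_mx E))^T.

Section InnerProduct.
Variables (R : realType) (E : 4.-tuple 'rV[R]_4).
Local Notation V := 'rV[R]_4.
Local Notation ip := (ip E).
Local Notation frame_mx := (frame_mx E).
Local Notation ip_mx := (ip_mx E).

Lemma ip_coord X Y : ip X Y =
  \sum_(i < 4) (X *m invmx frame_mx) 0 i * (Y *m invmx frame_mx) 0 i.
Proof. by rewrite ip.unlock. Qed.

Lemma ipC X Y : ip X Y = ip Y X.
Proof. by rewrite !ip_coord; apply: eq_bigr => i _; rewrite mulrC. Qed.

Lemma ip_linl a X Y Z : ip (a *: X + Y) Z = a * ip X Z + ip Y Z.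
Proof.
rewrite !ip_coord mulr_sumr -big_split/=; apply: eq_bigr => i _.
by rewrite mulmxDl -scalemxAl !mxE; ring.
Qed.

Lemma ip_linr a X Y Z : ip Z (a *: X + Y) = a * ip Z X + ip Z Y.
Proof. by rewrite ipC ip_linl !(ipC Z). Qed.

Lemma ip0l Z : ip 0 Z = 0.
Proof. by rewrite ip_coord big1// => i _; rewrite mul0mx mxE mul0r. Qed.

Lemma ip0r Z : ip Z 0 = 0.
Proof. by rewrite ipC ip0l. Qed.

Lemma ipDl X Y Z : ip (X + Y) Z = ip X Z + ip Y Z.
Proof. by rewrite -[X in LHS]scale1r ip_linl mul1r. Qed.

Lemma ipZl a X Z : ip (a *: X) Z = a * ip X Z.
Proof. by rewrite -[a *: X]addr0 ip_linl ip0l addr0. Qed.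

Lemma ipDr X Y Z : ip Z (X + Y) = ip Z X + ip Z Y.
Proof. by rewrite ipC ipDl !(ipC Z). Qed.

Lemma ipZr a X Z : ip Z (a *: X) = a * ip Z X.
Proof. by rewrite ipC ipZl ipC. Qed.

Lemma ipNl X Z : ip (- X) Z = - ip X Z.
Proof. by rewrite -scaleN1r ipZl mulN1r. Qed.

Lemma ipNr X Z : ip Z (- X) = - ip Z X.
Proof. by rewrite ipC ipNl ipC. Qed.

Lemma ipBl X Y Z : ip (X - Y) Z = ip X Z - ip Y Z.
Proof. by rewrite ipDl ipNl. Qed.

Lemma ipBr X Y Z : ip Z (X - Y) = ip Z X - ip Z Y.
Proof. by rewrite ipDr ipNr. Qed.

Lemma ip_suml n (X : 'I_n -> V) Z : ip (\sum_i X i) Z = \sum_i ip (X i) Z.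
Proof.
elim/big_rec2: _ => [|i x y _ <-]; first exact: ip0l.
exact: ipDl.
Qed.

Lemma ip_sumr n (X : 'I_n -> V) Z : ip Z (\sum_i X i) = \sum_i ip Z (X i).
Proof. by rewrite ipC ip_suml; apply: eq_bigr => i _; rewrite ipC. Qed.

Lemma is_derive_ip (W : normedModType R) (p v : W) (X Y : W -> V) (X' Y' : V) :
  is_vderive p v X X' -> is_vderive p v Y Y' ->
  is_derive p v (fun q => ip (X q) (Y q)) (ip X' (Y p) + ip (X p) Y').
Proof.
move=> dX dY; have -> : (fun q => ip (X q) (Y q)) = (fun q => \sum_(i < 4)
    (X q *m invmx frame_mx) 0 i * (Y q *m invmx frame_mx) 0 i).
  by apply/funext => q; rewrite ip_coord.
rewrite !ip_coord -big_split/=.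
by apply: is_derive_sum_fun => i; apply: is_deriveM_fun; exact: is_vderiveMr.
Qed.

Lemma ipE X Y : ip X Y = (X *m ip_mx *m Y^T) 0 0.
Proof.
rewrite ip_coord ip_mx.unlock mulmxA -mulmxA -trmx_mul mxE.
by apply: eq_bigr => i _; congr (_ * _); rewrite [RHS]mxE.
Qed.

Hypothesis E_unit : frame_mx \in unitmx.

Lemma ip_mx_unit : ip_mx \in unitmx.
Proof. by rewrite ip_mx.unlock unitmx_mul unitmx_tr unitmx_inv E_unit. Qed.

Lemma ip_eq0 X : ip X X = 0 -> X = 0.
Proof.
move=> X0; have : X *m invmx frame_mx = 0.
  apply/rowP => i; rewrite [RHS]mxE; apply/eqP; rewrite -sqrf_eq0 expr2.
  have := X0; rewrite ip_coord => /psumr_eq0P ->// j _.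
  by rewrite -expr2 sqr_ge0.
by move=> /(congr1 (mulmx^~ frame_mx)); rewrite mulmxKV// mul0mx.
Qed.

Lemma ip_ext X Y : (forall Z, ip X Z = ip Y Z) -> X = Y.
Proof.
move=> XY; apply/eqP; rewrite -subr_eq0; apply/eqP/ip_eq0.
by rewrite ipBl XY subrr.
Qed.

Lemma ip_frame i j : ip (tnth E i) (tnth E j) = (i == j)%:R.
Proof.
have rE k : tnth E k *m invmx frame_mx = delta_mx 0 k.
  rewrite -[tnth E k](rowK (fun i => tnth E i)) -row_mul.
  by rewrite -/frame_mx mulmxV// row1.
rewrite ip_coord !rE (bigD1 i)//= !mxE !eqxx mul1r big1 ?addr0// => k /negPf ki.
by rewrite !mxE ki mul0r.
Qed.

Lemma frame_expand X : X = \sum_i ip X (tnth E i) *: tnth E i.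
Proof.
have -> : X = \sum_i (X *m invmx frame_mx) 0 i *: tnth E i.
  rewrite -[LHS](mulmxKV E_unit) mulmx_sum_row.
  by apply: eq_bigr => i _; rewrite rowK.
apply: eq_bigr => i _; congr (_ *: _).
rewrite ip_suml (bigD1 i)//= ipZl ip_frame eqxx mulr1 big1 ?addr0// => k /negPf ki.
by rewrite ipZl ip_frame ki mulr0.
Qed.

End InnerProduct.

(** * The Levi-Civita connection of a left-invariant metric *)

(** The sums are nested as in [Gamma], with the argument [w] outermost because it pairs with the
    index that the inverse Gram matrix raises. *)
Lemma trilinear_koszul_expand (R : realType) (T : 'rV[R]_4 -> 'rV[R]_4 -> 'rV[R]_4 -> R)
    (K := fun u v w => 2^-1 * (T u v w + T v u w - T w u v)) (u v w : 'rV[R]_4) :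
  (forall a x y v w, T (a *: x + y) v w = a * T x v w + T y v w) ->
  (forall a x y v w, T v (a *: x + y) w = a * T v x w + T v y w) ->
  (forall a x y v w, T v w (a *: x + y) = a * T v w x + T v w y) ->
  K u v w = \sum_k w 0 k *
    \sum_i \sum_j K (delta_mx 0 i) (delta_mx 0 j) (delta_mx 0 k) * u 0 i * v 0 j.
Proof.
move=> T1 T2 T3.
rewrite (@linear_expand _ (K u v)); last first.
  by move=> a x y; rewrite /K T1 (T3 _ _ _ u) (T3 _ _ _ v); ring.
apply: eq_bigr => k _; congr (_ * _).
rewrite (@linear_expand _ (fun u => K u v _)); last first.
  by move=> a x y; rewrite /K T1 (T2 _ _ _ v) (T2 _ _ _ (delta_mx 0 k)); ring.
apply: eq_bigr => i _.
rewrite (@linear_expand _ (fun v => K _ v _)); last first.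
  by move=> a x y; rewrite /K T1 (T2 _ _ _ (delta_mx 0 i)) (T3 _ _ _ (delta_mx 0 k)); ring.
by rewrite mulr_sumr; apply: eq_bigr => j _; ring.
Qed.

(** The interface between the general theory and the three groups. [L p] is the matrix of the
    differential at the identity of the left translation by [p], [M p] that of the Maurer-Cartan
    form, and the last field says that every ad X is traceless, i.e. that the group is
    unimodular. *)
Record left_frame (R : realType) (G : group4 R)
    (br : 'rV[R]_4 -> 'rV[R]_4 -> 'rV[R]_4) (L M : 'rV[R]_4 -> 'M[R]_4) : Prop :=
  LeftFrame {
  left_field_mx : forall X p, left_field G X p = X *m L p;
  maurer_cartan_mx : forall v p, maurer_cartan G p v = v *m M p;
  left_frameK : forall p, L p *m M p = 1%:M;
  left_frame_diff : forall i j p, differentiable (fun q => L q i j) p;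
  coframe_diff : forall i j p, differentiable (fun q => M q i j) p;
  bracket_left_field : forall X Y p,
    field_bracket (left_field G X) (left_field G Y) p = left_field G (br X Y) p;
  bracket_lin : forall X a Y Z, br X (a *: Y + Z) = a *: br X Y + br X Z;
  bracket_anti : forall X Y, br X Y = - br Y X;
  bracket_unimodular : forall X, \sum_i br X (delta_mx 0 i) 0 i = 0 }.

Definition coframe_derive (R : realType) (M : 'rV[R]_4 -> 'M[R]_4) (p v : 'rV[R]_4) :
    'M[R]_4 := \matrix_(i, j) 'D_v (fun q => M q i j) p.

(** Derivative at [p] in the direction [d] of the metric evaluated on the constant fields [v] and
    [w], by the product rule. *)
HB.lock Definition metric_derive (R : realType) (E : 4.-tuple 'rV[R]_4)
    (M : 'rV[R]_4 -> 'M[R]_4) (p d v w : 'rV[R]_4) : R :=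
  ip E (v *m coframe_derive M p d) (w *m M p) +
  ip E (v *m M p) (w *m coframe_derive M p d).

(** It depends on the coordinates; only its antisymmetrization in [X] and [Y] is intrinsic, and
    equals the bracket by the Maurer-Cartan equation ([bracket_coframe]). *)
HB.lock Definition coframe_form (R : realType) (G : group4 R) (E : 4.-tuple 'rV[R]_4)
    (M : 'rV[R]_4 -> 'M[R]_4) (p X Y Z : 'rV[R]_4) : R :=
  ip E (left_field G X p *m coframe_derive M p (left_field G Y p)) Z.

Section LeviCivita.
Variables (R : realType) (G : group4 R) (br : 'rV[R]_4 -> 'rV[R]_4 -> 'rV[R]_4).
Variables (L M : 'rV[R]_4 -> 'M[R]_4) (E : 4.-tuple 'rV[R]_4).
Local Notation V := 'rV[R]_4.
Hypotheses (LF : left_frame G br L M) (E_unit : frame_mx E \in unitmx).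
Local Notation g := (left_metric G E).
Local Notation ip := (ip E).
Local Notation dM := (coframe_derive M).
Local Notation metric_derive := (metric_derive E M).
Local Notation om := (coframe_form G E M).

Lemma left_metricE p u v : g p u v = ip (u *m M p) (v *m M p).
Proof. by rewrite ip_coord -!(maurer_cartan_mx LF). Qed.

Lemma coframeK p : M p *m L p = 1%:M.
Proof. exact: (mulmx1C (left_frameK LF p)). Qed.

Lemma maurer_cartanK p v : left_field G (maurer_cartan G p v) p = v.
Proof.
by rewrite (left_field_mx LF) (maurer_cartan_mx LF) -mulmxA coframeK mulmx1.
Qed.

Lemma left_fieldK p X : maurer_cartan G p (left_field G X p) = X.
Proof.
by rewrite (left_field_mx LF) (maurer_cartan_mx LF) -mulmxA (left_frameK LF) mulmx1.
Qed.

Lemma left_metric_maurer_cartan p u v :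
  g p u v = ip (maurer_cartan G p u) (maurer_cartan G p v).
Proof. by rewrite ip_coord. Qed.

Lemma is_derive_coframe p v i j :
  is_derive p v (fun q => M q i j) (dM p v i j).
Proof.
rewrite mxE; apply: DeriveDef => //.
by apply: diff_derivable; exact: (coframe_diff LF).
Qed.

Lemma coframe_derive_lin p a u v : dM p (a *: u + v) = a *: dM p u + dM p v.
Proof.
apply/matrixP => i j; rewrite !mxE.
have d := coframe_diff LF i j p.
by rewrite !deriveE// linearD linearZ.
Qed.

Lemma metric_deriveE p d v w : metric_derive p d v w =
  ip (v *m dM p d) (w *m M p) + ip (v *m M p) (w *m dM p d).
Proof. by rewrite metric_derive.unlock. Qed.

Lemma is_derive_gcoef p d i j : is_derive p d (gcoef g i j)
  (metric_derive p d (delta_mx 0 i) (delta_mx 0 j)).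
Proof.
have -> : gcoef g i j =
    (fun q => ip (delta_mx 0 i *m M q) (delta_mx 0 j *m M q)).
  by apply/funext => q; rewrite /gcoef left_metricE.
have H k : is_vderive p d (fun q => delta_mx 0 k *m M q) (delta_mx 0 k *m dM p d).
  rewrite -[X in is_vderive _ _ _ X]add0r -(mul0mx _ (M p)).
  apply: is_vderiveM; first exact: is_vderive_cst.
  by move=> a b; exact: is_derive_coframe.
rewrite metric_deriveE; exact: is_derive_ip.
Qed.

Definition koszul (p u v w : V) : R :=
  2^-1 * (metric_derive p u v w + metric_derive p v u w - metric_derive p w u v).

Lemma metric_derive_lin1 p a x y v w : metric_derive p (a *: x + y) v w =
  a * metric_derive p x v w + metric_derive p y v w.
Proof.
rewrite !metric_deriveE coframe_derive_lin !mulmxDr -!scalemxAr.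
by rewrite ip_linl ip_linr mulrDr addrACA.
Qed.

Lemma metric_derive_lin2 p a x y v w : metric_derive p v (a *: x + y) w =
  a * metric_derive p v x w + metric_derive p v y w.
Proof.
by rewrite !metric_deriveE !mulmxDl -!scalemxAl !ip_linl mulrDr addrACA.
Qed.

Lemma metric_derive_lin3 p a x y v w : metric_derive p v w (a *: x + y) =
  a * metric_derive p v w x + metric_derive p v w y.
Proof.
by rewrite !metric_deriveE !mulmxDl -!scalemxAl !ip_linr mulrDr addrACA.
Qed.

Lemma koszul_expand p u v w : koszul p u v w =
  \sum_k w 0 k * \sum_i \sum_j koszul p (delta_mx 0 i) (delta_mx 0 j) (delta_mx 0 k)
     * u 0 i * v 0 j.
Proof.
have := @trilinear_koszul_expand R (metric_derive p) u v w (metric_derive_lin1 p)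
  (metric_derive_lin2 p) (metric_derive_lin3 p).
by [].
Qed.

Lemma gramE p : gram g p = M p *m ip_mx E *m (M p)^T.
Proof.
apply/matrixP => i j; rewrite mxE /gcoef left_metricE ipE trmx_mul.
by rewrite !mulmxA -rowE -!row_mul trmx_delta -colE mxE [LHS]mxE.
Qed.

Lemma coframe_unit p : M p \in unitmx.
Proof. by have [] := mulmx1_unit (left_frameK LF p). Qed.

Lemma gram_unit p : gram g p \in unitmx.
Proof. by rewrite gramE 2!unitmx_mul unitmx_tr coframe_unit ip_mx_unit. Qed.

Lemma left_metric_gram p u v : g p u v = (u *m gram g p *m v^T) 0 0.
Proof. by rewrite left_metricE ipE gramE trmx_mul !mulmxA. Qed.

Lemma gram_sym p : (gram g p)^T = gram g p.
Proof.
by apply/matrixP => i j; rewrite !mxE /gcoef !left_metricE ipC.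
Qed.

Lemma christoffel_koszul p k i j : christoffel g p k i j =
  \sum_l invmx (gram g p) k l *
    koszul p (delta_mx 0 i) (delta_mx 0 j) (delta_mx 0 l).
Proof.
have dE a b d : 'D_d (gcoef g a b) p =
    metric_derive p d (delta_mx 0 a) (delta_mx 0 b).
  by have [_ ->] := is_derive_gcoef p d a b.
rewrite /christoffel mulr_sumr; apply: eq_bigr => l _.
rewrite mulrCA; congr (_ * (_ * (_ + _ - _))); exact: dE.
Qed.

(** Lowering the index cancels the inverse Gram matrix contained in [christoffel], so that this
    inverse never has to be computed. *)
Lemma metric_Gamma p u v w : g p (Gamma g p u v) w = koszul p u v w.
Proof.
(* Christoffel symbols of the first kind contracted with [u] and [v]. *)
pose q : V := \row_k \sum_i \sum_j
  koszul p (delta_mx 0 i) (delta_mx 0 j) (delta_mx 0 k) * u 0 i * v 0 j.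
have -> : Gamma g p u v = q *m invmx (gram g p).
  apply/rowP => k; rewrite !mxE.
  under [RHS]eq_bigr => l _.
    rewrite mxE -[invmx _]trmxK trmx_inv gram_sym mxE mulr_suml.
    under eq_bigr do rewrite mulr_suml.
    over.
  rewrite [RHS]exchange_big; apply: eq_bigr => i _.
  rewrite [RHS]exchange_big; apply: eq_bigr => j _.
  rewrite christoffel_koszul !mulr_suml; apply: eq_bigr => l _.
  by rewrite -!mulrA mulrC -!mulrA.
rewrite left_metric_gram mulmxKV ?gram_unit// koszul_expand mxE.
by apply: eq_bigr => k _; rewrite !mxE mulrC.
Qed.

(** Differentiating the constant row [left_field G X q *m M q = X] trades derivatives of [L] for
    derivatives of [M]. *)
Lemma left_field_derive p v X : derivable (left_field G X) p v /\
  'D_v (left_field G X) p *m M p = - (left_field G X p *m dM p v).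
Proof.
have fE : left_field G X = (fun q => X *m L q).
  by apply/funext => q; rewrite (left_field_mx LF).
have dL : is_vderive p v (left_field G X)
    (X *m \matrix_(i, j) 'D_v (fun q => L q i j) p).
  rewrite fE -[X in is_vderive _ _ _ X]add0r -(mul0mx _ (L p)).
  apply: is_vderiveM; first exact: is_vderive_cst.
  move=> i j; rewrite mxE; apply: DeriveDef => //.
  by apply: diff_derivable; exact: (left_frame_diff LF).
have [dX DX] := derive_row dL; split=> //; rewrite DX.
have := is_vderiveM dL (is_derive_coframe p v).
have -> : (fun q => left_field G X q *m M q) = (fun=> X).
  by apply/funext => q; rewrite fE -mulmxA (left_frameK LF) mulmx1.
move=> /is_vderive_unique/(_ (is_vderive_cst p v X)) /eqP.
by rewrite addr_eq0 => /eqP.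
Qed.

Lemma coframe_formE p X Y Z :
  ip (left_field G X p *m dM p (left_field G Y p)) Z = om p X Y Z.
Proof. by rewrite coframe_form.unlock. Qed.

Lemma left_field_coframe p X : left_field G X p *m M p = X.
Proof. by rewrite -(maurer_cartan_mx LF) left_fieldK. Qed.

Lemma left_field_derive_ip p v X Z :
  ip ('D_v (left_field G X) p *m M p) Z = - ip (left_field G X p *m dM p v) Z.
Proof. by have [_ ->] := left_field_derive p v X; rewrite ipNl. Qed.

Lemma bracket_coframe p X Y Z : ip (br X Y) Z = om p X Y Z - om p Y X Z.
Proof.
rewrite -[br X Y](left_field_coframe p) -(bracket_left_field LF) /field_bracket.
rewrite mulmxBl ipBl -!coframe_formE [RHS]addrC -[X in _ = _ + X]opprK.
by congr (_ - _); exact: left_field_derive_ip.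
Qed.

Lemma koszul_left_field p X Y Z :
  koszul p (left_field G X p) (left_field G Y p) (left_field G Z p) =
  2^-1 * (om p Y X Z + om p Z X Y + (om p X Y Z + om p Z Y X)
          - (om p X Z Y + om p Y Z X)).
Proof.
have md X' Y' Z' :
    metric_derive p (left_field G X' p) (left_field G Y' p) (left_field G Z' p) =
    om p Y' X' Z' + om p Z' X' Y'.
  rewrite metric_deriveE -!coframe_formE; congr (ip _ _ + _).
    exact: left_field_coframe.
  by rewrite ipC; congr (ip _ _); exact: left_field_coframe.
by congr (_ * (_ + _ - _)); exact: md.
Qed.

(** Koszul's formula for left-invariant fields: the terms [om] occur in antisymmetric pairs, each of
    which is a bracket. *)
Lemma nabla_left_field p X U Y :
  ip (maurer_cartan G p (nabla g (left_field G X p) (left_field G U) p)) Y =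
  2^-1 * (ip (br X U) Y - ip (br U Y) X + ip (br Y X) U).
Proof.
rewrite (maurer_cartan_mx LF) /nabla mulmxDl ipDl left_field_derive_ip.
have := metric_Gamma p (left_field G X p) (left_field G U p) (left_field G Y p).
rewrite left_metricE left_field_coframe koszul_left_field => ->.
by rewrite coframe_formE !(bracket_coframe p); field.
Qed.

(** The derivative of u has two parts: the moving coframe gives om(u, u, Y), and the geodesic
    equation gives minus the Koszul term, - om(u, u, Y) - om(Y, u, u) + om(u, Y, u). Their sum is
    <[u, Y], u>. *)
Lemma euler_arnold (c : R -> V) (t : R) (Y : V) : geodesic g c ->
  is_derive t (1 : R) (fun s => ip (maurer_cartan G (c s) (derive1 c s)) Y)
    (ip (br (maurer_cartan G (c t) (derive1 c t)) Y)
        (maurer_cartan G (c t) (derive1 c t))).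
Proof.
move=> [dc ddc gc].
have dMc i j : is_derive t (1 : R) (fun s => M (c s) i j) (dM (c t) (derive1 c t) i j).
  have dMt := coframe_diff LF i j (c t).
  have dct : differentiable c t by apply/derivable1_diffP.
  have dcomp : differentiable ((fun q => M q i j) \o c) t.
    exact: differentiable_comp.
  apply: DeriveDef; first exact: diff_derivable.
  rewrite mxE derive1E -[LHS]/('D_1 ((fun q => M q i j) \o c) t).
  by rewrite !deriveE// diff_comp.
have dc' : is_vderive t (1 : R) (derive1 c) (derive1 (derive1 c) t).
  by rewrite [derive1 (derive1 c) t]derive1E; exact: is_vderiveP.
have dU := is_vderiveM dc' dMc.
have -> : (fun s => ip (maurer_cartan G (c s) (derive1 c s)) Y) =
    (fun s => ip (derive1 c s *m M (c s)) Y).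
  by apply/funext => s; congr (ip _ _); exact: (maurer_cartan_mx LF).
apply: is_derive_eq (is_derive_ip E dU (is_vderive_cst t 1 Y)) _.
rewrite ip0r addr0 ipDl.
set u := maurer_cartan G (c t) _.
have c'E : derive1 c t = left_field G u (c t) by rewrite maurer_cartanK.
have := gc t => /eqP; rewrite addr_eq0 => /eqP ->; rewrite mulNmx ipNl.
have := metric_Gamma (c t) (derive1 c t) (derive1 c t) (left_field G Y (c t)).
rewrite left_metricE left_field_coframe c'E koszul_left_field => ->.
by rewrite coframe_formE !(bracket_coframe (c t)); field.
Qed.

End LeviCivita.

(** * Orbits of hypersurface subgroups *)

Section GroupFacts.
Variables (R : realType) (G : group4 R).
Local Notation V := 'rV[R]_4.
Implicit Types p q : V.

(** [group4] states only left axioms; the right inverse and the right identity follow from the fact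
    that an idempotent is trivial. *)
Lemma gmul_idem p : gmul G p p = p -> p = 0.
Proof.
by move=> pp; rewrite -[LHS](gmul0 G) -(gmulV G p) -gmulA pp gmulV.
Qed.

Lemma gmulVr p : gmul G p (ginv G p) = 0.
Proof.
apply: gmul_idem; rewrite -gmulA [gmul _ (ginv G p) _]gmulA gmulV.
by rewrite gmul0.
Qed.

Lemma gmulr0 p : gmul G p 0 = p.
Proof. by rewrite -(gmulV G p) gmulA gmulVr gmul0. Qed.

Lemma left_field0 X : left_field G X 0 = X.
Proof.
rewrite /left_field.
have -> : gmul G 0 = id by apply/funext => q; rewrite gmul0.
by rewrite derive_id.
Qed.

End GroupFacts.

Lemma is_derive_linear (R : realType) (ell : 'rV[R]_4 -> R) (W : normedModType R)
    (p v : W) (X : W -> 'rV[R]_4) X' :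
  (forall a x y, ell (a *: x + y) = a * ell x + ell y) ->
  is_vderive p v X X' -> is_derive p v (fun q => ell (X q)) (ell X').
Proof.
move=> ellL dX; rewrite (linear_expand X' ellL).
have -> : (fun q => ell (X q)) = (fun q => \sum_i X q 0 i * ell (delta_mx 0 i)).
  by apply/funext => q; exact: linear_expand.
by apply: is_derive_sum_fun => i; apply: is_deriveMr_fun.
Qed.

Lemma derive_curve (R : realType) (c : R -> 'rV[R]_4) (t : R) :
  derivable c t 1 -> is_vderive t (1 : R) c (derive1 c t).
Proof. by move=> dc; rewrite derive1E; exact: is_vderiveP. Qed.

(** [ell] is a cocycle for the character exp (w x4), so its zero set is a subgroup. That this set is
    reached by products of exponentials, [ell_subgroup], has to be checked group by group. The
    vector of [ell_transversal] changes [ell] at unit rate without affecting exp (w x4); it pushes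
    curves back into an orbit. *)
Record hypersurface_subgroup (R : realType) (G : group4 R)
    (br : 'rV[R]_4 -> 'rV[R]_4 -> 'rV[R]_4) (h : {vspace 'rV[R]_4})
    (ell : 'rV[R]_4 -> R) (w : R) : Prop := HypersurfaceSubgroup {
  ell_lin : forall a x y, ell (a *: x + y) = a * ell x + ell y;
  ell_mul : forall p q, ell (gmul G p q) = ell p + expR (w * x4 p) * ell q;
  x4_mul : forall p q, x4 (gmul G p q) = x4 p + x4 q;
  ell_left : forall X p, ell (left_field G X p) = expR (w * x4 p) * ell X;
  x4_left : forall X p, x4 (left_field G X p) = x4 X;
  ell_bracket : forall X Y, ell (br X Y) = w * (x4 X * ell Y - x4 Y * ell X);
  x4_bracket : forall X Y, x4 (br X Y) = 0;
  ell_subalgebra : forall v, v \in h -> ell v = 0;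
  ell_subgroup : forall p, ell p = 0 -> lie_subgroup G h p;
  ell_transversal : exists n, ell n = 1 /\ w * x4 n = 0 }.

Section Orbits.
Variables (R : realType) (G : group4 R) (br : 'rV[R]_4 -> 'rV[R]_4 -> 'rV[R]_4).
Variables (h : {vspace 'rV[R]_4}) (ell : 'rV[R]_4 -> R) (w : R).
Local Notation V := 'rV[R]_4.
Hypothesis HS : hypersurface_subgroup G br h ell w.

Let ell_lin := ell_lin HS.

Lemma ell0 : ell 0 = 0.
Proof.
by have := ell_lin (-1) 0 0; rewrite scaler0 addr0 mulN1r addNr.
Qed.

Lemma ellD x y : ell (x + y) = ell x + ell y.
Proof. by rewrite -[x in LHS]scale1r ell_lin mul1r. Qed.

Lemma ellZ a x : ell (a *: x) = a * ell x.
Proof. by rewrite -[a *: x]addr0 ell_lin ell0 addr0. Qed.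

(** For a one-parameter subgroup f, the cocycle rule applied to f (t + a) = f t f a gives (ell o
    f)'(t) = exp (w x4 (f t)) ell (f' 0) = 0, so [ell] remains constant along f. *)
Lemma lie_subgroupP p : lie_subgroup G h p <-> ell p = 0.
Proof.
split; last exact: (ell_subgroup HS).
elim=> {p} [|f s q [df fM] hf _ q0]; first exact: ell0.
rewrite (ell_mul HS) q0 mulr0 addr0.
have f0 : f 0 = 0 by apply: (@gmul_idem _ G); rewrite -fM addr0.
have dell t : is_derive t (1 : R) (fun s => ell (f s)) 0.
  have dshift : is_vderive (0 : R) (1 : R) (fun a => f a) (derive1 f 0).
    exact: derive_curve.
  have dt := derive_curve (df t).
  have D := is_derive_linear ell_lin dt.
  suff -> : 0 = ell (derive1 f t) by [].
  apply/esym.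
  have D0 := is_derive_linear ell_lin dshift.
  have E : is_derive (0 : R) (1 : R) (fun a => ell (f (a + t))) (ell (derive1 f t)).
    have D' : is_derive (0 + t : R) (1 : R) (fun s => ell (f s)) (ell (derive1 f t)).
      by rewrite add0r.
    have sh : is_derive (0 : R) (1 : R) (fun a => a + t) (1 : R).
      rewrite -[X in is_derive _ _ _ X]addr0.
      exact: (is_deriveD_fun (is_derive_id _ _) (is_derive_cst _ _ _)).
    by have := @is_derive1_comp R _ (fun a => a + t) 0 _ _ D' sh; rewrite mulr1.
  have E' : is_derive (0 : R) (1 : R) (fun a => ell (f (a + t)))
      (0 + expR (w * x4 (f t)) * ell (derive1 f 0)).
    have -> : (fun a => ell (f (a + t))) =
        (fun a => ell (f t) + expR (w * x4 (f t)) * ell (f a)).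
      by apply/funext => a; rewrite addrC fM (ell_mul HS).
    by apply: is_deriveD_fun; exact: is_deriveMl_fun.
  have [_ <-] := E; have [_ ->] := E'.
  by rewrite (ell_subalgebra HS hf) mulr0 addr0.
by rewrite (is_derive_0_is_cst s 0 dell) f0 ell0.
Qed.

Lemma orbitP p q : Defs.orbit G h p q <-> ell q = expR (w * (x4 q - x4 p)) * ell p.
Proof.
split=> [[r /lie_subgroupP r0 <-]|qE].
  rewrite (ell_mul HS) (x4_mul HS) r0 add0r; congr (expR (w * _) * _); ring.
exists (gmul G q (ginv G p)); last by rewrite -gmulA gmulV gmulr0.
apply/lie_subgroupP.
have := ell_mul HS (gmul G q (ginv G p)) p.
rewrite -gmulA gmulV gmulr0.
have -> : x4 (gmul G q (ginv G p)) = x4 q - x4 p.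
  have := x4_mul HS (gmul G q (ginv G p)) p; rewrite -gmulA gmulV gmulr0 => ->.
  by ring.
by rewrite qE => /eqP; rewrite -subr_eq subrr => /eqP <-.
Qed.

Lemma lie_subgroup_orbit : lie_subgroup G h = Defs.orbit G h 0.
Proof.
apply/funext => q; apply/propext; split.
  by move=> /lie_subgroupP q0; apply/orbitP; rewrite q0 ell0 mulr0.
by move=> /orbitP q0; apply/lie_subgroupP; rewrite q0 ell0 mulr0.
Qed.

Lemma tangent_orbitP p q v : Defs.orbit G h p q ->
  tangent (Defs.orbit G h p) q v <-> ell v = w * x4 v * ell q.
Proof.
move=> /orbitP qE; split=> [[c [dc Sc c0 cv]]|vE].
  have dv : is_vderive (0 : R) (1 : R) c v by rewrite -cv; exact: derive_curve.
  have D1 := is_derive_linear ell_lin dv.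
  have D2 := is_derive_linear (@x4L R) dv.
  have D3 := is_deriveD_fun (is_deriveMl_fun w D2)
    (is_derive_cst (- (w * x4 p)) (0 : R) (1 : R)).
  have {}D3 := is_deriveMr_fun (ell p) (is_derive_expR_comp D3).
  have cE : (fun s => ell (c s)) =
      (fun s => expR (w * x4 (c s) + - (w * x4 p)) * ell p).
    apply/funext => s; have /orbitP -> := Sc s.
    by congr (expR _ * _); ring.
  rewrite cE in D1; have [_ <-] := D1; have [_ ->] := D3.
  by rewrite /= c0 qE addr0 -mulrA; congr (_ * (expR _ * _)); ring.
have [n [n1 wn]] := ell_transversal HS.
(* Moving by [b s] along [n] brings the line q + s v back to the orbit: [b s] is the difference
   between the value exp (w x4 v s) ell q that the orbit requires and the value ell q + s ell v on
   the line ([ell v] has the same value with either sign convention only through the bookkeeping of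
   [b]). The hypothesis on [v] is b'(0) = 0, so the velocity at 0 is still [v]. *)
pose b s := expR (w * x4 v * s) * ell q + (- ell q + - (s * ell v)).
pose b' s := w * x4 v * expR (w * x4 v * s) * ell q + (0 + - ell v).
pose c s : V := (q + s *: v) + b s *: n.
have dZ (k s : R) : is_derive s (1 : R) (fun s => k * s) k.
  rewrite -[X in is_derive _ _ _ X]mulr1.
  exact: (is_deriveMl_fun k (is_derive_id s (1 : R))).
have dZr (k s : R) : is_derive s (1 : R) (fun s => s * k) k.
  rewrite -[X in is_derive _ _ _ X]mul1r.
  exact: (is_deriveMr_fun k (is_derive_id s (1 : R))).
have db s : is_derive s (1 : R) b (b' s).
  exact: (is_deriveD_fun
    (is_deriveMr_fun (ell q) (is_derive_expR_comp (dZ (w * x4 v) s)))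
    (is_deriveD_fun (is_derive_cst (- ell q) s (1 : R)) (is_deriveN_fun (dZr (ell v) s)))).
have dc s : is_vderive s (1 : R) c (v + b' s *: n).
  move=> j; rewrite mxE [(b' s *: n) _ _]mxE.
  have -> : (fun q => c q 0 j) = (fun s => (q 0 j + s * v 0 j) + b s * n 0 j).
    by apply/funext => a; rewrite !mxE.
  apply: is_derive_eq (is_deriveD_fun (is_deriveD_fun
    (is_derive_cst (q 0 j) s (1 : R)) (dZr (v 0 j) s))
    (is_deriveMr_fun (n 0 j) (db s))) _.
  by rewrite add0r.
exists c; split.
- by move=> s; have [] := derive_row (dc s).
- move=> s; apply/orbitP; rewrite /c !ellD !ellZ n1 mulr1.
  have -> : w * (x4 (q + s *: v + b s *: n) - x4 p) =
      w * x4 v * s + w * (x4 q - x4 p).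
    have -> : x4 (q + s *: v + b s *: n) = x4 q + s * x4 v + b s * x4 n.
      by rewrite /x4 !mxE.
    have -> : w * (x4 q + s * x4 v + b s * x4 n - x4 p) =
      w * x4 v * s + w * (x4 q - x4 p) + b s * (w * x4 n) by ring.
    by rewrite wn mulr0 addr0.
  by rewrite expRD -mulrA -qE /b; ring.
- by rewrite /c /b mulr0 expR0 scale0r mul1r mul0r oppr0 !addr0 subrr scale0r addr0.
- rewrite derive1E; have [_ ->] := derive_row (dc 0).
  by rewrite /b' mulr0 expR0 mulr1 vE add0r subrr scale0r addr0.
Qed.

End Orbits.

(** * Orthonormal bases adapted to a hyperplane *)

Section OrthonormalFrame.
Variables (R : realType) (E : 4.-tuple 'rV[R]_4).
Local Notation V := 'rV[R]_4.
Local Notation ip := (ip E).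
Variable y : 'I_4 -> V.
Hypothesis y_on : forall i j, ip (y i) (y j) = (i == j)%:R.

Let O : 'M[R]_4 := \matrix_i y i.

Let O_entry (A : 'M[R]_4) i j : (y i *m A *m (y j)^T) 0 0 = (O *m A *m O^T) i j.
Proof.
rewrite -[y i](rowK y) -[y j](rowK y) -row_mul mxE [RHS]mxE.
by apply: eq_bigr => k _; rewrite [row _ _ _ _]mxE !mxE.
Qed.

Let O_on : ip_mx E *m O^T *m O = 1%:M.
Proof.
apply: mulmx1C; apply/matrixP => i j.
by rewrite mulmxA -O_entry -ipE y_on [RHS]mxE.
Qed.

Lemma orthonormal_expand Z : Z = \sum_i ip Z (y i) *: y i.
Proof.
rewrite -[LHS]mulmx1 -O_on !mulmxA mulmx_sum_row; apply: eq_bigr => i _.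
rewrite rowK ipE mxE [in RHS]mxE; congr (_ *: _).
by apply: eq_bigr => k _; congr (_ * _); rewrite !mxE.
Qed.

Lemma orthonormal_trace (A : 'M[R]_4) : \sum_i ip (y i *m A) (y i) = \tr A.
Proof.
have -> : \tr A = \tr (O *m (A *m (ip_mx E *m O^T))).
  by rewrite mxtrace_mulC -!mulmxA [_ *m (_ *m O)]mulmxA O_on mulmx1.
apply: eq_bigr => i _.
by rewrite ipE -(mulmxA (y i)) O_entry !mulmxA.
Qed.

End OrthonormalFrame.

Lemma orthonormal_cons (R : realType) (E : 4.-tuple 'rV[R]_4) (u : 'rV[R]_4)
    (b : 'I_3 -> 'rV[R]_4)
    (y := fun i : 'I_4 => if unlift ord0 i is Some j then b j else u) :
  ip E u u = 1 -> (forall i, ip E u (b i) = 0) ->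
  (forall i j, ip E (b i) (b j) = (i == j)%:R) ->
  forall i j, ip E (y i) (y j) = (i == j)%:R.
Proof.
move=> u1 ub bb i j; rewrite /y.
case: unliftP => [i' ->|->]; case: unliftP => [j' ->|->].
- by rewrite bb (inj_eq lift_inj).
- by rewrite ipC ub eq_sym (negPf (neq_lift _ _)).
- by rewrite ub (negPf (neq_lift _ _)).
- by rewrite u1 eqxx.
Qed.

Lemma orthonormal_cons_expand (R : realType) (E : 4.-tuple 'rV[R]_4) (u : 'rV[R]_4)
    (b : 'I_3 -> 'rV[R]_4) :
  ip E u u = 1 -> (forall i, ip E u (b i) = 0) ->
  (forall i j, ip E (b i) (b j) = (i == j)%:R) ->
  forall Z, Z = ip E Z u *: u + \sum_i ip E Z (b i) *: b i.
Proof.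
move=> u1 ub bb Z; rewrite [LHS](orthonormal_expand (orthonormal_cons u1 ub bb)).
rewrite big_ord_recl unlift_none; congr (_ + _).
by apply: eq_bigr => i _; rewrite liftK.
Qed.

(** * Trace and bounds of the bracket *)

Section Bracket.
Variables (R : realType) (G : group4 R) (br : 'rV[R]_4 -> 'rV[R]_4 -> 'rV[R]_4).
Variables (L M : 'rV[R]_4 -> 'M[R]_4) (E : 4.-tuple 'rV[R]_4).
Local Notation V := 'rV[R]_4.
Local Notation ip := (ip E).
Hypothesis LF : left_frame G br L M.
Hypothesis E_unit : frame_mx E \in unitmx.

Lemma brD X Y Z : br X (Y + Z) = br X Y + br X Z.
Proof. by rewrite -[Y in LHS]scale1r (bracket_lin LF) scale1r. Qed.

Lemma br0 X : br X 0 = 0.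
Proof.
by have := bracket_lin LF X (-1) 0 0; rewrite scaler0 addr0 scaleN1r addNr.
Qed.

Lemma brZ X a Y : br X (a *: Y) = a *: br X Y.
Proof. by rewrite -[a *: Y]addr0 (bracket_lin LF) br0 addr0. Qed.

Lemma brZl X a Y : br (a *: X) Y = a *: br X Y.
Proof. by rewrite (bracket_anti LF) brZ -scalerN -(bracket_anti LF). Qed.

Lemma br_sum n X (Y : 'I_n -> V) : br X (\sum_i Y i) = \sum_i br X (Y i).
Proof.
elim/big_rec2: _ => [|i a b _ <-]; first exact: br0.
exact: brD.
Qed.

Lemma br_suml n X (Y : 'I_n -> V) : br (\sum_i Y i) X = \sum_i br (Y i) X.
Proof.
rewrite (bracket_anti LF) br_sum -sumrN; apply: eq_bigr => i _.
by rewrite -(bracket_anti LF).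
Qed.

Lemma ip_brxx X Y : ip (br X X) Y = 0.
Proof.
have : br X X = 0.
  have /eqP := bracket_anti LF X X; rewrite -addr_eq0 -mulr2n -scaler_nat.
  by rewrite scaler_eq0 pnatr_eq0 => /eqP.
by move=> ->; rewrite ip0l.
Qed.

Lemma trace_bracket X (y : 'I_4 -> V) :
  (forall i j, ip (y i) (y j) = (i == j)%:R) -> \sum_i ip (br X (y i)) (y i) = 0.
Proof.
move=> y_on; pose A : 'M[R]_4 := \matrix_i br X (delta_mx 0 i).
have AE Y : br X Y = Y *m A.
  rewrite {1}[Y]row_sum_delta br_sum mulmx_sum_row; apply: eq_bigr => i _.
  by rewrite brZ rowK.
under eq_bigr do rewrite AE.
rewrite orthonormal_trace//.
by rewrite -[RHS](bracket_unimodular LF X); apply: eq_bigr => i _; rewrite mxE.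
Qed.

(** The coordinates of a unit vector are at most 1 in absolute value, so the sum of the absolute
    values of all structure constants is a bound. It makes the coefficients of the momentum equation
    bounded uniformly in time. *)
Lemma bracket_bounded : exists C, forall u i k,
  ip u u = 1 -> `|ip (br u (tnth E i)) (tnth E k)| <= C.
Proof.
pose a i j k := `|ip (br (tnth E j) (tnth E i)) (tnth E k)|.
have a0 i j k : 0 <= a i j k by exact: normr_ge0.
exists (\sum_i \sum_k \sum_j a i j k) => u i k u1.
have le1 j : `|ip u (tnth E j)| <= 1.
  have h : ip u (tnth E j) * ip u (tnth E j) <= 1.
    rewrite -[leRHS]u1 {4}[u](frame_expand E_unit) ip_sumr (bigD1 j)//= ipZr lerDl.
    by apply: sumr_ge0 => l _; rewrite ipZr -expr2 sqr_ge0.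
  by rewrite ler_norml; apply/andP; split; nra.
apply: (@le_trans _ _ (\sum_j a i j k)).
  rewrite {1}[u](frame_expand E_unit) br_suml ip_suml.
  apply: le_trans (ler_norm_sum _ _ _) _; apply: ler_sum => j _.
  by rewrite brZl ipZl normrM ler_piMl.
apply: (@le_trans _ _ (\sum_k \sum_j a i j k)); last first.
  rewrite [leRHS](bigD1 i)//= lerDl.
  by apply: sumr_ge0 => l _; apply: sumr_ge0 => l' _; apply: sumr_ge0.
by rewrite [leRHS](bigD1 k)//= lerDl; apply: sumr_ge0 => l _; apply: sumr_ge0.
Qed.

End Bracket.

(** * Normal geodesics and shape operators *)

Section NormalGeodesic.
Variables (R : realType) (G : group4 R) (br : 'rV[R]_4 -> 'rV[R]_4 -> 'rV[R]_4).
Variables (L M : 'rV[R]_4 -> 'M[R]_4) (E : 4.-tuple 'rV[R]_4).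
Variables (h : {vspace 'rV[R]_4}) (ell : 'rV[R]_4 -> R) (w : R).
Variables (xi : 'rV[R]_4) (N : R).
Local Notation V := 'rV[R]_4.
Local Notation ip := (ip E).
Local Notation g := (left_metric G E).
Hypothesis LF : left_frame G br L M.
Hypothesis E_unit : frame_mx E \in unitmx.
Hypothesis HS : hypersurface_subgroup G br h ell w.
Hypothesis xi_unit : ip xi xi = 1.
Hypothesis N0 : N != 0.
Hypothesis ellE : forall Y, ell Y = N * ip xi Y.
Variable c : R -> V.
Hypothesis cG : normal_geodesic G g h c.

Definition body_velocity (t : R) : V := maurer_cartan G (c t) (derive1 c t).
Local Notation u := body_velocity.

Lemma maurer_cartan0 v : maurer_cartan G 0 v = v.
Proof. by rewrite -[v in LHS](left_field0 G) (left_fieldK LF). Qed.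

(** The part [z] of the velocity orthogonal to [xi] lies in the kernel of [ell], which is the
    tangent space of the subgroup. Hence [z] is orthogonal to the velocity as well as to [xi], thus
    to itself. *)
Lemma initial_velocity : exists s, (s = 1 \/ s = -1) /\ derive1 c 0 = s *: xi.
Proof.
case: cG => _ us c0 nor; set v := derive1 c 0.
have g0 x y : g 0 x y = ip x y by rewrite left_metric_maurer_cartan !maurer_cartan0.
have v1 : ip v v = 1 by rewrite -g0 -c0; exact: us.
pose z := v - ip v xi *: xi.
have ell_z : ell z = 0.
  by rewrite ellE /z ipBr ipZr xi_unit mulr1 ipC subrr mulr0.
have vz : ip v z = 0.
  rewrite -g0; apply: nor; rewrite (lie_subgroup_orbit HS).
  apply/(tangent_orbitP HS); last by rewrite ell_z (ell0 HS) mulr0.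
  by apply/(orbitP HS); rewrite (ell0 HS) mulr0.
have xz : ip xi z = 0.
  by apply: (mulfI N0); rewrite -ellE ell_z mulr0.
have vE : v = ip v xi *: xi.
  apply/eqP; rewrite -subr_eq0; apply/eqP/(ip_eq0 E_unit).
  by rewrite -/z {1}/z ipBl ipZl vz xz mulr0 subr0.
exists (ip v xi); split=> //.
have : ip v xi ^+ 2 == 1 ^+ 2.
  have e : ip v v = ip v xi * ip v xi by rewrite {2}vE ipZr.
  by rewrite expr1n expr2 -e v1.
by rewrite eqf_sqr => /orP[] /eqP ->; [left|right].
Qed.

Lemma body_velocity_unit t : ip (u t) (u t) = 1.
Proof.
by case: cG => _ us _ _; rewrite -left_metric_maurer_cartan; exact: us.
Qed.

Lemma geodesic_velocity t : derive1 c t = left_field G (u t) (c t).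
Proof. by rewrite (maurer_cartanK LF). Qed.

Lemma geodesic_derive t : is_vderive t (1 : R) c (left_field G (u t) (c t)).
Proof.
case: cG => -[dc _ _] _ _ _; rewrite -geodesic_velocity.
exact: derive_curve.
Qed.

Lemma geodesic_ell t :
  is_derive t (1 : R) (fun a => ell (c a)) (expR (w * x4 (c t)) * ell (u t)).
Proof.
rewrite -(ell_left HS); apply: is_derive_linear; first exact: (ell_lin HS).
exact: geodesic_derive.
Qed.

Lemma geodesic_x4 t : is_derive t (1 : R) (fun a => x4 (c a)) (x4 (u t)).
Proof.
rewrite -(x4_left HS (u t) (c t)); apply: is_derive_linear; first exact: x4L.
exact: geodesic_derive.
Qed.

(* Both sides, as covectors Y |-> f(t, Y), solve the linear equation
   f'(Y) = f([u, Y]), and they agree at t = 0. *)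
Lemma body_velocity_momentum s t Y : derive1 c 0 = s *: xi ->
  ip (u t) Y = s / N * (expR (w * x4 (c t)) * ell Y - w * ell (c t) * x4 Y).
Proof.
move=> c's.
pose beta t Y := expR (w * x4 (c t)) * ell Y - w * ell (c t) * x4 Y.
pose D t Y := ip (u t) Y - s / N * beta t Y.
have DL t' a x y : D t' (a *: x + y) = a * D t' x + D t' y.
  by rewrite /D /beta ip_linr (ell_lin HS) x4L; ring.
have D_sum t' (a : 'I_4 -> R) (Z : 'I_4 -> V) :
    D t' (\sum_i a i *: Z i) = \sum_i a i * D t' (Z i).
  rewrite !big_ord_recl !big_ord0 !DL.
  suff -> : D t' 0 = 0 by [].
  by rewrite /D /beta ip0r (ell0 HS) x4_0; ring.
have D' t' Z : is_derive t' (1 : R) (fun a => D a Z) (D t' (br (u t') Z)).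
  have de := is_derive_expR_comp (is_deriveMl_fun w (geodesic_x4 t')).
  have dl := is_deriveMl_fun w (geodesic_ell t').
  have db := is_deriveD_fun (is_deriveMr_fun (ell Z) de)
    (is_deriveN_fun (is_deriveMr_fun (x4 Z) dl)).
  have [geo _ _ _] := cG.
  have du := euler_arnold LF E_unit t' Z geo.
  apply: is_derive_eq (is_deriveD_fun du (is_deriveN_fun (is_deriveMl_fun (s / N) db))) _.
  rewrite -/(u t') /D /beta (ell_bracket HS) (x4_bracket HS) (ipC E (br _ _)).
  by ring.
(* With u regarded as known, the values of [D] on the frame solve a linear system with bounded
   coefficients <[u, E_i], E_k>. The factor s / N makes the initial values agree, since <s xi, Y> =
   (s / N) ell Y. *)
have [C uC] := bracket_bounded LF E_unit.
have D0 i a : D a (tnth E i) = 0.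
  apply: (@linear_ode_zero _ _ (fun i a => D a (tnth E i))
     (fun i k a => ip (br (u a) (tnth E i)) (tnth E k)) C) => {i a}.
  - move=> i a; apply: is_derive_eq (D' a (tnth E i)) _.
    by rewrite [br (u a) (tnth E i) in LHS](frame_expand E_unit) D_sum.
  - by move=> i k a; apply: uC; exact: body_velocity_unit.
  - move=> i; have [_ _ c0 _] := cG.
    rewrite /D /beta /body_velocity c0 maurer_cartan0 c's x4_0 (ell0 HS) !mulr0.
    by rewrite expR0 ellE ipZl; field.
apply/eqP; rewrite -subr_eq0 -/(beta t Y) -/(D t Y); apply/eqP.
rewrite (frame_expand E_unit Y) D_sum big1// => i _; by rewrite D0 mulr0.
Qed.

(** By [orbitP] the tangency conditions at all points [q] of the orbit translate to one hyperplane
    of the Lie algebra, the kernel of the momentum covector at time [t]. So the left-invariant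
    extension of u is normal along the whole orbit. *)
Lemma tangent_orbit_normal t q v : Defs.orbit G h (c t) q ->
  tangent (Defs.orbit G h (c t)) q v <-> ip (u t) (maurer_cartan G q v) = 0.
Proof.
move=> qO; have [s [s1 c's]] := initial_velocity.
have s0 : s != 0 by case: s1 => ->; rewrite ?oppr_eq0 oner_eq0.
rewrite (tangent_orbitP HS _ qO) (body_velocity_momentum _ _ c's).
set X := maurer_cartan G q v; have -> : v = left_field G X q.
  by rewrite (maurer_cartanK LF).
rewrite (ell_left HS) (x4_left HS); move/(orbitP HS): qO => ->.
have -> : expR (w * (x4 q - x4 (c t))) = expR (w * x4 q) / expR (w * x4 (c t)).
  by rewrite -expRN -expRD; congr expR; ring.
have e1 := expR_gt0 (w * x4 q); have e2 := expR_gt0 (w * x4 (c t)).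
split=> H.
  apply: (mulfI (lt0r_neq0 e1)); rewrite mulr0 mulrCA.
  rewrite mulrBr [expR (w * x4 q) * (_ * ell X)]mulrCA H.
  by field; rewrite N0 lt0r_neq0.
have {}H : expR (w * x4 (c t)) * ell X = w * ell (c t) * x4 X.
  apply/eqP; rewrite -subr_eq0; apply/eqP.
  by apply: (mulfI (mulf_neq0 s0 (invr_neq0 N0))); rewrite H mulr0.
apply: (mulfI (lt0r_neq0 e2)); rewrite mulrCA H.
by field; rewrite lt0r_neq0.
Qed.

(** Any combination alpha of [ell] and [x4] satisfies alpha [X, Y] = w (x4 X alpha Y - x4 Y alpha
    X), because the contributions of [x4] cancel; so its kernel is a subalgebra. *)
Lemma normal_subalgebra t X Y : ip (u t) X = 0 -> ip (u t) Y = 0 ->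
  ip (br X Y) (u t) = 0.
Proof.
have [s [s1 c's]] := initial_velocity.
have s0 : s != 0 by case: s1 => ->; rewrite ?oppr_eq0 oner_eq0.
rewrite [X in _ -> _ -> X = 0]ipC !(body_velocity_momentum _ _ c's).
have K a : s / N * a = 0 -> a = 0.
  by move=> /eqP; rewrite mulf_eq0 (negPf (mulf_neq0 s0 (invr_neq0 N0))) => /eqP.
move=> /K HX /K HY; rewrite (ell_bracket HS) (x4_bracket HS).
set e := expR _ in HX HY *.
have -> : e * (w * (x4 X * ell Y - x4 Y * ell X)) - w * ell (c t) * 0 =
  w * (x4 X * (e * ell Y - w * ell (c t) * x4 Y)
       - x4 Y * (e * ell X - w * ell (c t) * x4 X)) by ring.
by rewrite HX HY !mulr0 subrr !mulr0.
Qed.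

Local Notation Q t X Y := (ip (br (u t) X) Y + ip (br (u t) Y) X).

(** [Y] is arbitrary in order to cover two uses. For [Y] tangent the last term vanishes by
    [normal_subalgebra]; for [Y] = u the terms cancel, so the image is tangent. *)
Lemma shape_operator_normal t sigma p X Y : ip (u t) X = 0 ->
  ip (maurer_cartan G p
    (shape_operator g (normal_field G c t sigma) p (left_field G X p))) Y =
  sigma / 2 * (ip (br (u t) X) Y + ip (br (u t) Y) X - ip (br Y X) (u t)).
Proof.
move=> uX; rewrite /shape_operator.
have -> : maurer_cartan G p (- nabla g (left_field G X p) (normal_field G c t sigma) p) =
   - maurer_cartan G p (nabla g (left_field G X p) (left_field G (sigma *: u t)) p).
  by rewrite !(maurer_cartan_mx LF) mulNmx.
rewrite ipNl (nabla_left_field LF E_unit) ipZr (bracket_anti LF X).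
by rewrite ipNl !(brZl LF) !ipZl; field.
Qed.

Lemma shape_operator_tangent t sigma p X Y : ip (u t) X = 0 -> ip (u t) Y = 0 ->
  ip (maurer_cartan G p
    (shape_operator g (normal_field G c t sigma) p (left_field G X p))) Y =
  sigma / 2 * Q t X Y.
Proof.
by move=> uX uY; rewrite shape_operator_normal// normal_subalgebra// subr0.
Qed.

Lemma shape_operator_unormal t sigma p X : ip (u t) X = 0 ->
  ip (maurer_cartan G p
    (shape_operator g (normal_field G c t sigma) p (left_field G X p))) (u t) = 0.
Proof.
by move=> uX; rewrite shape_operator_normal// (ip_brxx E LF); ring.
Qed.

Lemma minimal_orbit t : orbit_minimal G g h c t.
Proof.
split.
  move=> p pO.
  have nu : maurer_cartan G p (normal_field G c t 1 p) = u t.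
    by rewrite (left_fieldK LF) scale1r.
  rewrite left_metric_maurer_cartan nu body_velocity_unit; split=> // v.
  by move=> /(tangent_orbit_normal v pO); rewrite left_metric_maurer_cartan nu.
move=> p B pO [BT Bon _].
pose b i := maurer_cartan G p (B i).
have ub i : ip (u t) (b i) = 0 by exact/(tangent_orbit_normal (B i) pO).
have bb i j : ip (b i) (b j) = (i == j)%:R.
  by rewrite -left_metric_maurer_cartan.
(* Since <[u, u], u> = 0, the trace over the tangent space is the full trace of ad u. *)
have := trace_bracket LF (u t) (orthonormal_cons (body_velocity_unit t) ub bb).
rewrite big_ord_recl unlift_none (ip_brxx E LF) add0r => tr.
rewrite -[RHS]tr; apply: eq_bigr => i _; rewrite liftK left_metric_maurer_cartan.
have BE : B i = left_field G (b i) p by rewrite (maurer_cartanK LF).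
rewrite -/(b i) [in LHS]BE shape_operator_tangent//.
by field.
Qed.

Lemma orbit_refl p : Defs.orbit G h p p.
Proof. by apply/(orbitP HS); rewrite subrr mulr0 expR0 mul1r. Qed.

Section ShapeMatrix.
Variables (t sigma : R) (b : 'I_3 -> V) (S : 'M[R]_3).
Hypothesis sigma0 : sigma != 0.
Hypothesis b_on : forall i j, ip (b i) (b j) = (i == j)%:R.
Hypothesis ub : forall i, ip (u t) (b i) = 0.
Hypothesis SE : forall i j, S i j = sigma / 2 * Q t (b j) (b i).

Let expand Z : ip (u t) Z = 0 -> Z = \sum_i ip Z (b i) *: b i.
Proof.
move=> uZ.
by rewrite {1}(orthonormal_cons_expand (body_velocity_unit t) ub b_on Z) ipC uZ scale0r add0r.
Qed.

Lemma left_field_sum p n (a : 'I_n -> R) (Z : 'I_n -> V) :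
  left_field G (\sum_i a i *: Z i) p = \sum_i a i *: left_field G (Z i) p.
Proof.
rewrite (left_field_mx LF) mulmx_suml; apply: eq_bigr => i _.
by rewrite (left_field_mx LF) scalemxAl.
Qed.

Lemma orbit_shape_matrixP : orbit_shape_matrix G g h c t sigma S.
Proof.
have tO := orbit_refl (c t).
have mcb i : maurer_cartan G (c t) (left_field G (b i) (c t)) = b i.
  exact: (left_fieldK LF).
exists (fun i => left_field G (b i) (c t)); split.
  split.
  - by move=> i; apply/(tangent_orbit_normal _ tO); rewrite mcb.
  - move=> i j; rewrite left_metric_maurer_cartan -b_on.
    by congr (ip _ _); exact: mcb.
  - move=> v /(tangent_orbit_normal v tO) uv.
    exists (fun i => ip (maurer_cartan G (c t) v) (b i)).
    by rewrite -left_field_sum -(expand uv) (maurer_cartanK LF).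
move=> j; set X := shape_operator _ _ _ _.
have XE : maurer_cartan G (c t) X = \sum_i S i j *: b i.
  rewrite {1}(@expand (maurer_cartan G (c t) X)).
    apply: eq_bigr => i _; congr (_ *: _).
    by rewrite SE; exact: shape_operator_tangent.
  by rewrite ipC; exact: shape_operator_unormal.
transitivity (left_field G (\sum_i S i j *: b i) (c t)); last exact: left_field_sum.
by rewrite -XE (maurer_cartanK LF).
Qed.

(** Translated back to the Lie algebra, the operator is the same at all points of the orbit, so its
    matrix at [c t] decides. Passing from the normal with sign 1 to the one with sign [sigma] only
    rescales it. *)
Lemma totally_geodesicP :
  orbit_totally_geodesic G g h c t <-> S = 0.
Proof.
split=> [tg|S0].
  apply/matrixP => i j; rewrite SE mxE.
  have tO := orbit_refl (c t).
  have bT : tangent (Defs.orbit G h (c t)) (c t) (left_field G (b j) (c t)).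
    by apply/(tangent_orbit_normal _ tO); rewrite (left_fieldK LF).
  have := shape_operator_tangent 1 (c t) (ub j) (ub i).
  rewrite (tg _ _ tO bT) (maurer_cartan_mx LF) mul0mx ip0l => /esym/eqP.
  rewrite mulf_eq0 mulf_eq0 oner_eq0 invr_eq0 pnatr_eq0/= => /eqP ->.
  by rewrite mulr0.
move=> p v pO /(tangent_orbit_normal v pO) uv.
rewrite -[v](maurer_cartanK LF p) -[LHS](maurer_cartanK LF p).
set X := maurer_cartan G p v in uv *.
suff -> : maurer_cartan G p
    (shape_operator g (normal_field G c t 1) p (left_field G X p)) = 0.
  by rewrite (left_field_mx LF) mul0mx.
rewrite (@expand (maurer_cartan G p _)); last by rewrite ipC shape_operator_unormal.
apply: big1 => i _; rewrite shape_operator_tangent//.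
have Qb j : Q t (b j) (b i) = 0.
  have /esym/eqP := SE i j; rewrite S0 mxE mulf_eq0 mulf_eq0 (negPf sigma0).
  by rewrite invr_eq0 pnatr_eq0/= => /eqP.
rewrite (expand uv) (br_sum LF) ip_suml ip_sumr -big_split/=.
rewrite big1 ?mulr0 ?scale0r// => j _.
by rewrite (brZ LF) ipZl ipZr -mulrDr Qb mulr0.
Qed.

End ShapeMatrix.

End NormalGeodesic.

(** * Explicit body velocities *)

Section Hyperbolic.
Variable R : realType.
Implicit Types x t k : R.

Lemma cosh_gt0 x : 0 < cosh x.
Proof. by rewrite /cosh divr_gt0// addr_gt0// expR_gt0. Qed.

Lemma cosh2_sinh2 x : cosh x ^+ 2 - sinh x ^+ 2 = 1.
Proof.
have e : expR x * expR (- x) = 1 by rewrite -expRD subrr expR0.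
by rewrite -e /cosh /sinh; field.
Qed.

Lemma sinh0 : sinh 0 = 0 :> R.
Proof. by rewrite /sinh oppr0 subrr mul0r. Qed.

Lemma cosh0 : cosh 0 = 1 :> R.
Proof. by rewrite /cosh oppr0 expR0; field. Qed.

Lemma coshN x : cosh (- x) = cosh x.
Proof. by rewrite /cosh opprK addrC. Qed.

Lemma sinhN x : sinh (- x) = - sinh x.
Proof. by rewrite /sinh opprK -mulNr opprB. Qed.

Lemma tanhN x : tanh (- x) = - tanh x.
Proof. by rewrite /tanh sinhN coshN mulNr. Qed.

Lemma sechN x : sech (- x) = sech x.
Proof. by rewrite /sech coshN. Qed.

Lemma sech2_tanh2 x : sech x ^+ 2 + tanh x ^+ 2 = 1.
Proof.
have C0 := lt0r_neq0 (cosh_gt0 x).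
have -> : sech x ^+ 2 + tanh x ^+ 2 = (1 + sinh x ^+ 2) / cosh x ^+ 2.
  by rewrite /sech /tanh; field.
have -> : 1 + sinh x ^+ 2 = cosh x ^+ 2.
  by rewrite -[X in X + _](cosh2_sinh2 x); ring.
by rewrite divff// expf_neq0.
Qed.

Lemma tanh_eq0 x : tanh x = 0 -> x = 0.
Proof.
move=> /eqP; rewrite /tanh mulf_eq0 invr_eq0 (negPf (lt0r_neq0 (cosh_gt0 x))) orbF.
rewrite /sinh mulf_eq0 invr_eq0 pnatr_eq0 orbF subr_eq0 => /eqP /expR_inj e.
by apply/eqP; rewrite -[x == 0](mulrn_eq0 x 2) mulr2n {2}e subrr.
Qed.

Lemma tanh0 : tanh 0 = 0 :> R.
Proof. by rewrite /tanh sinh0 mul0r. Qed.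

Lemma is_derive_expRZ k t :
  is_derive t (1 : R) (fun a => expR (k * a)) (k * expR (k * t)).
Proof.
apply: is_derive_expR_comp; rewrite -[X in is_derive _ _ _ X]mulr1.
exact: (is_deriveMl_fun k (is_derive_id t (1 : R))).
Qed.

Lemma is_derive_coshZ k t :
  is_derive t (1 : R) (fun a => cosh (k * a)) (k * sinh (k * t)).
Proof.
have -> : (fun a => cosh (k * a)) = (fun a => (expR (k * a) + expR (- k * a)) * 2^-1).
  by apply/funext => a; rewrite /cosh mulNr.
apply: is_derive_eq (is_deriveMr_fun 2^-1
  (is_deriveD_fun (is_derive_expRZ k t) (is_derive_expRZ (- k) t))) _.
by rewrite /sinh -(mulNr k t); field.
Qed.

Lemma is_derive_sinhZ k t :
  is_derive t (1 : R) (fun a => sinh (k * a)) (k * cosh (k * t)).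
Proof.
have -> : (fun a => sinh (k * a)) =
    (fun a => (expR (k * a) + - expR (- k * a)) * 2^-1).
  by apply/funext => a; rewrite /sinh mulNr.
apply: is_derive_eq (is_deriveMr_fun 2^-1
  (is_deriveD_fun (is_derive_expRZ k t) (is_deriveN_fun (is_derive_expRZ (- k) t)))) _.
by rewrite /cosh -(mulNr k t); field.
Qed.

End Hyperbolic.

Section BodyVelocity.
Variables (R : realType) (G : group4 R) (br : 'rV[R]_4 -> 'rV[R]_4 -> 'rV[R]_4).
Variables (L M : 'rV[R]_4 -> 'M[R]_4) (E : 4.-tuple 'rV[R]_4).
Variables (h : {vspace 'rV[R]_4}) (ell : 'rV[R]_4 -> R) (w : R).
Variables (xi : 'rV[R]_4) (N : R).
Local Notation V := 'rV[R]_4.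
Local Notation ip := (ip E).
Local Notation g := (left_metric G E).
Hypothesis LF : left_frame G br L M.
Hypothesis E_unit : frame_mx E \in unitmx.
Hypothesis HS : hypersurface_subgroup G br h ell w.
Hypothesis xi_unit : ip xi xi = 1.
Hypothesis N0 : N != 0.
Hypothesis ellE : forall Y, ell Y = N * ip xi Y.
Variable c : R -> V.
Hypothesis cG : normal_geodesic G g h c.
Variable s : R.
Hypothesis s1 : s = 1 \/ s = -1.
Hypothesis c's : derive1 c 0 = s *: xi.
Local Notation u := (body_velocity G c).

Let momentum t Y := body_velocity_momentum LF E_unit HS N0 ellE cG t Y c's.

(** If w = 0 then [ell] vanishes on brackets, so its kernel is an ideal, and the momentum covector
    is constantly (s / N) [ell]. *)
Lemma body_velocity_ideal t : w = 0 -> u t = s *: xi.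
Proof.
move=> w0; apply: (ip_ext E_unit) => Y.
by rewrite momentum w0 (ellE Y) ipZl !mul0r expR0; field.
Qed.

Variables (eta : V) (d : R).
Hypothesis eta_unit : ip eta eta = 1.
Hypothesis xi_eta : ip xi eta = 0.
Hypothesis x4E : forall Y, x4 Y = d * ip eta Y.

Lemma body_velocity_hyperbolic t :
  u t = s *: (sech (- w * d * (s * t)) *: xi + tanh (- w * d * (s * t)) *: eta).
Proof.
pose k := - w * d.
(* Coefficients of the momentum covector on [xi] and [eta]; unit speed puts them on the unit
   circle. *)
pose sig a := s * expR (w * x4 (c a)).
pose tau a := - (s / N * w * d) * ell (c a).
have uE a : u a = sig a *: xi + tau a *: eta.
  apply: (ip_ext E_unit) => Y.
  by rewrite momentum (ellE Y) (x4E Y) ipDl !ipZl /sig /tau; field.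
have unit a : sig a ^+ 2 + tau a ^+ 2 = 1.
  have := body_velocity_unit cG a; rewrite uE ipDl !ipDr !ipZl !ipZr.
  rewrite (ipC E eta xi) xi_unit eta_unit xi_eta => <-; ring.
have dtau a : is_derive a (1 : R) tau (k * sig a ^+ 2).
  apply: is_derive_eq (is_deriveMl_fun (- (s / N * w * d)) (geodesic_ell LF HS cG a)) _.
  rewrite ellE uE ipDr !ipZr xi_unit xi_eta /k /sig; field; exact: N0.
have dx4 a : is_derive a (1 : R) (fun a => expR (- w * x4 (c a)))
    (- w * (d * tau a) * expR (- w * x4 (c a))).
  apply: is_derive_expR_comp; apply: is_derive_eq
    (is_deriveMl_fun (- w) (geodesic_x4 LF HS cG a)) _.
  by rewrite x4E uE ipDr !ipZr (ipC E eta xi) xi_eta eta_unit; ring.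
(* As tau' = k (1 - tau^2), the derivative of tau cosh - sinh is - k tau times itself, while
   [expR (- w * x4 (c a))] has logarithmic derivative k tau. Their product is therefore a first
   integral of the Riccati equation. *)
pose f a := (tau a * cosh (k * a) + - sinh (k * a)) * expR (- w * x4 (c a)).
have df a : is_derive a (1 : R) f 0.
  apply: is_derive_eq (is_deriveM_fun (is_deriveD_fun
    (is_deriveM_fun (dtau a) (is_derive_coshZ k a))
    (is_deriveN_fun (is_derive_sinhZ k a))) (dx4 a)) _.
  have sig2 : sig a ^+ 2 = 1 - tau a ^+ 2 by rewrite -(unit a); ring.
  by rewrite sig2 /k; ring.
have [_ _ c0 _] := cG.
have tauE a : tau a * cosh (k * a) = sinh (k * a).
  have : f a = 0.
    rewrite (is_derive_0_is_cst a 0 df) /f /tau c0 (ell0 HS) !mulr0 sinh0 mul0r.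
    by rewrite oppr0 addr0 mul0r.
  move=> /eqP; rewrite /f mulf_eq0 (negPf (lt0r_neq0 (expR_gt0 _))) orbF.
  by rewrite addr_eq0 opprK => /eqP.
have s2 : s * s = 1 by case: s1 => ->; ring.
have C0 := cosh_gt0 (k * t); have Cn := lt0r_neq0 C0.
(* sech is even and tanh odd, so the velocity becomes s times a function of s t, a form that is
   stable under reversal of the geodesic. *)
have sE : sech (k * (s * t)) = sech (k * t).
  by case: s1 => ->; rewrite ?mul1r// mulN1r mulrN sechN.
have tE : tanh (k * (s * t)) = s * tanh (k * t).
  by case: s1 => ->; rewrite ?mul1r// !mulN1r mulrN tanhN.
rewrite -/k sE tE uE scalerDr !scalerA mulrA s2 mul1r.
have -> : tau t = tanh (k * t) by rewrite /tanh -tauE mulfK.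
suff -> : sig t = s * sech (k * t) by [].
(* The exponential is positive, so the circle equation leaves no choice: the coefficient of [xi]
   keeps the sign [s] for all time. *)
have sig2 : (expR (w * x4 (c t)) * cosh (k * t)) ^+ 2 = 1 ^+ 2.
  rewrite expr1n -[RHS](cosh2_sinh2 (k * t)) -tauE.
  transitivity ((s * s) * (expR (w * x4 (c t)) * cosh (k * t)) ^+ 2).
    by rewrite s2 mul1r.
  transitivity (sig t ^+ 2 * cosh (k * t) ^+ 2); first by rewrite /sig; ring.
  have -> : sig t ^+ 2 = 1 - tau t ^+ 2 by rewrite -(unit t); ring.
  ring.
have e0 := expR_gt0 (w * x4 (c t)).
have {}sig2 : expR (w * x4 (c t)) * cosh (k * t) = 1.
  by apply/eqP; rewrite -(eqrXn2 (n := 2))// ?sig2// ?ler01// ltW// mulr_gt0.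
rewrite /sig /sech; congr (_ * _).
by apply: (mulIf Cn); rewrite sig2 mulVf.
Qed.

End BodyVelocity.

(** * The three groups *)

Section Differentiability.
Variables (R : realType) (p : 'rV[R]_4).
Local Notation V := 'rV[R]_4.
Implicit Types f g : V -> R.

Lemma differentiable_x2 : differentiable (fun q : V => x2 q) p.
Proof. exact: differentiable_coord. Qed.

Lemma differentiable_x4 : differentiable (fun q : V => x4 q) p.
Proof. exact: differentiable_coord. Qed.

Lemma differentiableD_fun f g : differentiable f p -> differentiable g p ->
  differentiable (fun q => f q + g q) p.
Proof. by move=> df dg; exact: differentiableD. Qed.

Lemma differentiableM_fun f g : differentiable f p -> differentiable g p ->
  differentiable (fun q => f q * g q) p.
Proof. by move=> df dg; exact: differentiableM. Qed.

Lemma differentiableN_fun f : differentiable f p ->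
  differentiable (fun q => - f q) p.
Proof. by move=> df; exact: differentiableN. Qed.

Lemma differentiable_cst_fun (k : R) : differentiable (fun _ : V => k) p.
Proof. exact: differentiable_cst. Qed.

Lemma differentiable_expR_comp f : differentiable f p ->
  differentiable (fun q => expR (f q)) p.
Proof.
move=> df; apply: (@differentiable_comp _ _ _ _ f expR) => //.
by apply/derivable1_diffP; exact: derivable_expR.
Qed.

Lemma differentiable_vec4 (a b c d : V -> R) :
  differentiable a p -> differentiable b p -> differentiable c p ->
  differentiable d p ->
  forall j, differentiable (fun q => vec4 (a q) (b q) (c q) (d q) 0 j) p.
Proof.
move=> da db dc dd j.
have -> : (fun q => vec4 (a q) (b q) (c q) (d q) 0 j) =
    (fun q => nth 0 [:: a q; b q; c q; d q] j) by apply/funext => q; rewrite mxE.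
by case: j => -[|[|[|[|k]]]] hj //; exfalso; exact: (notF hj).
Qed.

End Differentiability.

Ltac differentiable_expr :=
  repeat first [exact: differentiable_cst_fun | exact: differentiable_x2
    | exact: differentiable_x4 | apply: differentiableD_fun
    | apply: differentiableN_fun | apply: differentiableM_fun
    | apply: differentiable_expR_comp].

(** Lets each group supply coordinate formulas; the matrices are assembled from their values on the
    standard basis. *)
Lemma left_frame_of_linear (R : realType) (G : group4 R)
    (br lf mc : 'rV[R]_4 -> 'rV[R]_4 -> 'rV[R]_4) :
  (forall X p, left_field G X p = lf p X) ->
  (forall v p, maurer_cartan G p v = mc p v) ->
  (forall p a X Y, lf p (a *: X + Y) = a *: lf p X + lf p Y) ->
  (forall p a X Y, mc p (a *: X + Y) = a *: mc p X + mc p Y) ->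
  (forall p X, mc p (lf p X) = X) ->
  (forall X p j, differentiable (fun q => lf q X 0 j) p) ->
  (forall X p j, differentiable (fun q => mc q X 0 j) p) ->
  (forall X Y p, field_bracket (left_field G X) (left_field G Y) p =
     left_field G (br X Y) p) ->
  (forall X a Y Z, br X (a *: Y + Z) = a *: br X Y + br X Z) ->
  (forall X Y, br X Y = - br Y X) ->
  (forall X, \sum_i br X (delta_mx 0 i) 0 i = 0) ->
  left_frame G br (fun p => \matrix_i lf p (delta_mx 0 i))
    (fun p => \matrix_i mc p (delta_mx 0 i)).
Proof.
move=> lfE mcE lfL mcL mclf dlf dmc brE brL brA brT.
have mxl (f : 'rV[R]_4 -> 'rV[R]_4) X :
    (forall a X Y, f (a *: X + Y) = a *: f X + f Y) ->
    f X = X *m \matrix_i f (delta_mx 0 i).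
  move=> fL; apply/rowP => j; rewrite mxE.
  rewrite (@linear_expand _ (fun X => f X 0 j)); last first.
    by move=> a x y; rewrite fL !mxE.
  by apply: eq_bigr => i _; rewrite mxE.
split=> //.
- by move=> X p; rewrite lfE; exact: mxl.
- by move=> v p; rewrite mcE; exact: mxl.
- move=> p; apply/row_matrixP => i; rewrite row_mul rowK -mxl// mclf.
  by rewrite row1.
- move=> i j p; have -> : (fun q => (\matrix_i lf q (delta_mx 0 i)) i j) =
    (fun q => lf q (delta_mx 0 i) 0 j) by apply/funext => q; rewrite mxE.
  exact: dlf.
- move=> i j p; have -> : (fun q => (\matrix_i mc q (delta_mx 0 i)) i j) =
    (fun q => mc q (delta_mx 0 i) 0 j) by apply/funext => q; rewrite mxE.
  exact: dmc.
Qed.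

(** * Brackets and Maurer-Cartan forms in coordinates *)

Section ThreeGroups.
Variable R : realType.
Local Notation V := 'rV[R]_4.
Implicit Types p q v X Y : V.

Lemma vec4_eta X : X = vec4 (x1 X) (x2 X) (x3 X) (x4 X).
Proof. by apply: vec4P; rewrite !xE. Qed.

Lemma trace4 (f : V -> V) : \sum_i f (delta_mx 0 i) 0 i =
  x1 (f (e1 R)) + x2 (f (e2 R)) + x3 (f (e3 R)) + x4 (f (e4 R)).
Proof.
have d i : delta_mx 0 i = vec4 (i == 0 :> nat)%:R (i == 1 :> nat)%:R
    (i == 2 :> nat)%:R (i == 3 :> nat)%:R :> V.
  by apply: vec4P; rewrite !xE /x1 /x2 /x3 /x4 mxE eqxx /= -val_eqE /= eq_sym.
rewrite !big_ord_recl big_ord0 addr0 !addrA !d.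
by congr (_ + _ + _ + _); rewrite /x1 /x2 /x3 /x4 /e1 /e2 /e3 /e4 /=;
  congr (f _ _ _); apply: val_inj.
Qed.

Definition nil4_br X Y : V :=
  (x2 X * x4 Y - x4 X * x2 Y) *: e1 R + (x3 X * x4 Y - x4 X * x3 Y) *: e2 R.

Definition nil4_left p X : V :=
  vec4 (x1 X - x4 p * x2 X + x4 p ^+ 2 / 2 * x3 X) (x2 X - x4 p * x3 X)
       (x3 X) (x4 X).

Definition nil4_mc p X : V :=
  vec4 (x1 X + x4 p * x2 X + x4 p ^+ 2 / 2 * x3 X) (x2 X + x4 p * x3 X)
       (x3 X) (x4 X).

Lemma nil4_mcE v p : maurer_cartan (Nil4 R) p v = nil4_mc p v.
Proof.
apply: derive_vec4 => [h||||]; first exact: erefl.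
- by apply: (@deriv0_affine _ _ _ 0) => h; rewrite /nil4_inv !xLE; field.
- by apply: (@deriv0_affine _ _ _ 0) => h; rewrite /nil4_inv !xLE; ring.
- by apply: (@deriv0_affine _ _ _ 0) => h; rewrite /nil4_inv !xLE; ring.
- by apply: (@deriv0_affine _ _ _ 0) => h; rewrite /nil4_inv !xLE; ring.
Qed.

Lemma nil4_left_frame : exists L M, left_frame (Nil4 R) nil4_br L M.
Proof.
do 2 eexists; apply: left_frame_of_linear.
- exact: nil4_fieldE.
- exact: nil4_mcE.
- by move=> p a X Y; apply: vec4P; rewrite /nil4_left !xLE; ring.
- by move=> p a X Y; apply: vec4P; rewrite /nil4_mc !xLE; ring.
- by move=> p X; apply: vec4P; rewrite /nil4_mc /nil4_left !xLE; field.
- by move=> X p; apply: differentiable_vec4; rewrite /=; differentiable_expr.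
- by move=> X p; apply: differentiable_vec4; rewrite /=; differentiable_expr.
- by move=> X Y p; rewrite nil4_bracket.
- by move=> X a Y Z; apply: vec4P; rewrite /nil4_br /e1 /e2 !(xZE, xLE); ring.
- move=> X Y; apply: vec4P; rewrite -scaleN1r /nil4_br /e1 /e2 !(xZE, xLE); ring.
- by move=> X; rewrite trace4 /nil4_br /e1 /e2 /e3 /e4 !(xZE, xLE); ring.
Qed.


Definition sol1_br X Y : V :=
  (x2 X * x3 Y - x3 X * x2 Y) *: e1 R
  + (- (x2 X * x4 Y - x4 X * x2 Y) *: e2 R + (x3 X * x4 Y - x4 X * x3 Y) *: e3 R).

Definition sol1_left p X : V :=
  vec4 (x1 X + x2 p * expR (- x4 p) * x3 X) (expR (x4 p) * x2 X)
       (expR (- x4 p) * x3 X) (x4 X).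

Definition sol1_mc p X : V :=
  vec4 (x1 X - x2 p * x3 X) (expR (- x4 p) * x2 X) (expR (x4 p) * x3 X) (x4 X).

Lemma expRK (x : R) : expR x * expR (- x) = 1.
Proof. by rewrite -expRD subrr expR0. Qed.

Lemma sol1_mcE v p : maurer_cartan (Sol1 R) p v = sol1_mc p v.
Proof.
apply: derive_vec4 => [h||||]; first exact: erefl.
- apply: (@deriv0_affine _ _ _ 0) => h; rewrite /sol1_inv !xLE opprK.
  transitivity (x2 p * x3 p - x1 p + (h * x1 v + x1 p)
    + - (expR (x4 p) * expR (- x4 p)) * x2 p * (h * x3 v + x3 p)); first by ring.
  by rewrite expRK; ring.
- by apply: (@deriv0_affine _ _ _ 0) => h; rewrite /sol1_inv !xLE; ring.
- by apply: (@deriv0_affine _ _ _ 0) => h; rewrite /sol1_inv !xLE opprK; ring.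
- by apply: (@deriv0_affine _ _ _ 0) => h; rewrite /sol1_inv !xLE; ring.
Qed.

Lemma sol1_left_frame : exists L M, left_frame (Sol1 R) sol1_br L M.
Proof.
do 2 eexists; apply: left_frame_of_linear.
- exact: sol1_fieldE.
- exact: sol1_mcE.
- by move=> p a X Y; apply: vec4P; rewrite /sol1_left !xLE; ring.
- by move=> p a X Y; apply: vec4P; rewrite /sol1_mc !xLE; ring.
- move=> p X; apply: vec4P; rewrite /sol1_mc /sol1_left !xLE ?mulrA; first by ring.
  + by rewrite [expR (- _) * _]mulrC expRK mul1r.
  + by rewrite expRK mul1r.
  + by [].
- by move=> X p; apply: differentiable_vec4; rewrite /=; differentiable_expr.
- by move=> X p; apply: differentiable_vec4; rewrite /=; differentiable_expr.
- by move=> X Y p; rewrite sol1_bracket.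
- by move=> X a Y Z; apply: vec4P; rewrite /sol1_br /e1 /e2 /e3 !(xZE, xLE); ring.
- move=> X Y; apply: vec4P; rewrite -scaleN1r /sol1_br /e1 /e2 /e3 !(xZE, xLE); ring.
- by move=> X; rewrite trace4 /sol1_br /e1 /e2 /e3 /e4 !(xZE, xLE); ring.
Qed.

Definition sol_br l X Y : V :=
  - l * (x1 X * x4 Y - x4 X * x1 Y) *: e1 R
  + (- (x2 X * x4 Y - x4 X * x2 Y) *: e2 R
  + (l + 1) * (x3 X * x4 Y - x4 X * x3 Y) *: e3 R).

Definition sol_left l p X : V :=
  vec4 (expR (l * x4 p) * x1 X) (expR (x4 p) * x2 X)
       (expR (- (l + 1) * x4 p) * x3 X) (x4 X).

Definition sol_mc l p X : V :=
  vec4 (expR (- (l * x4 p)) * x1 X) (expR (- x4 p) * x2 X)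
       (expR ((l + 1) * x4 p) * x3 X) (x4 X).

Lemma sol_mcE l v p : maurer_cartan (Sol l) p v = sol_mc l p v.
Proof.
apply: derive_vec4 => [h||||]; first exact: erefl.
- apply: (@deriv0_affine _ _ _ 0) => h; rewrite /sol_inv !xLE mulrN; ring.
- by apply: (@deriv0_affine _ _ _ 0) => h; rewrite /sol_inv !xLE; ring.
- by apply: (@deriv0_affine _ _ _ 0) => h; rewrite /sol_inv !xLE mulrNN; ring.
- by apply: (@deriv0_affine _ _ _ 0) => h; rewrite /sol_inv !xLE; ring.
Qed.

Lemma sol_left_frame l : exists L M, left_frame (Sol l) (sol_br l) L M.
Proof.
do 2 eexists; apply: left_frame_of_linear.
- exact: sol_fieldE.
- exact: sol_mcE.
- by move=> p a X Y; apply: vec4P; rewrite /sol_left !xLE; ring.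
- by move=> p a X Y; apply: vec4P; rewrite /sol_mc !xLE; ring.
- move=> p X; apply: vec4P; rewrite /sol_mc /sol_left !xLE ?mulrA.
  + by rewrite [expR (- _) * _]mulrC expRK mul1r.
  + by rewrite [expR (- _) * _]mulrC expRK mul1r.
  + by rewrite mulNr expRK mul1r.
  + by [].
- by move=> X p; apply: differentiable_vec4; rewrite /=; differentiable_expr.
- by move=> X p; apply: differentiable_vec4; rewrite /=; differentiable_expr.
- by move=> X Y p; rewrite sol_bracket.
- by move=> X a Y Z; apply: vec4P; rewrite /sol_br /e1 /e2 /e3 !(xZE, xLE); ring.
- move=> X Y; apply: vec4P; rewrite -scaleN1r /sol_br /e1 /e2 /e3 !(xZE, xLE); ring.
- by move=> X; rewrite trace4 /sol_br /e1 /e2 /e3 /e4 !(xZE, xLE); ring.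
Qed.

End ThreeGroups.

(** * Coordinates in an orthonormal frame *)

Section Coordinates.
Variable R : realType.
Local Notation V := 'rV[R]_4.
Implicit Types (X Y : V).

Lemma x1D X Y : x1 (X + Y) = x1 X + x1 Y. Proof. by rewrite /x1 mxE. Qed.
Lemma x2D X Y : x2 (X + Y) = x2 X + x2 Y. Proof. by rewrite /x2 mxE. Qed.
Lemma x3D X Y : x3 (X + Y) = x3 X + x3 Y. Proof. by rewrite /x3 mxE. Qed.
Lemma x4D X Y : x4 (X + Y) = x4 X + x4 Y. Proof. by rewrite /x4 mxE. Qed.
Definition xDE := (x1D, x2D, x3D, x4D).
Lemma x1N X : x1 (- X) = - x1 X. Proof. by rewrite /x1 mxE. Qed.
Lemma x2N X : x2 (- X) = - x2 X. Proof. by rewrite /x2 mxE. Qed.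
Lemma x3N X : x3 (- X) = - x3 X. Proof. by rewrite /x3 mxE. Qed.
Lemma x4N X : x4 (- X) = - x4 X. Proof. by rewrite /x4 mxE. Qed.
Definition xNE := (x1N, x2N, x3N, x4N).

Lemma span3P (a b c v : V) :
  v \in span [:: a; b; c] <-> exists x y z, v = x *: a + y *: b + z *: c.
Proof.
split=> [|[x [y [z ->]]]]; last first.
  by rewrite !rpredD// rpredZ// memv_span// !inE eqxx ?orbT.
rewrite !span_cons span_nil addv0.
move=> /memv_addP[_ /vlineP[x ->] [_ /memv_addP[_ /vlineP[y ->] [_ /vlineP[z ->] ->]] ->]].
by exists x, y, z; rewrite addrA.
Qed.

(** In these coordinates inner products are dot products and brackets are polynomial, so that matrix
    entries can be left to [ring] and [field]. *)
Definition frame_comb (E : 4.-tuple V) (y1 y2 y3 y4 : R) : V :=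
  vec4 y1 y2 y3 y4 *m frame_mx E.

Lemma frame_combE (E1 E2 E3 E4 : V) y1 y2 y3 y4 :
  frame_comb [tuple E1; E2; E3; E4] y1 y2 y3 y4 =
  y1 *: E1 + y2 *: E2 + y3 *: E3 + y4 *: E4.
Proof.
rewrite /frame_comb mulmx_sum_row !big_ord_recl big_ord0 addr0 !addrA.
by rewrite !rowK !mxE.
Qed.

Lemma frame_mx_unit (E : 4.-tuple V) (co : V -> V) :
  (forall X, co X *m frame_mx E = X) -> frame_mx E \in unitmx.
Proof.
move=> coE; apply: (@mulmx1_unit _ _ (\matrix_i co (delta_mx 0 i)) _ _).2.
by apply/row_matrixP => i; rewrite row_mul rowK coE row1.
Qed.

Lemma ip_comb (E : 4.-tuple V) y1 y2 y3 y4 z1 z2 z3 z4 :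
  frame_mx E \in unitmx ->
  ip E (frame_comb E y1 y2 y3 y4) (frame_comb E z1 z2 z3 z4) =
  y1 * z1 + y2 * z2 + y3 * z3 + y4 * z4.
Proof.
move=> uE; rewrite ip_coord /frame_comb !mulmxK//.
by rewrite !big_ord_recl big_ord0 addr0 !addrA !mxE.
Qed.

Lemma scale_mx3 (k a11 a12 a13 a21 a22 a23 a31 a32 a33 : R) :
  k *: mx3 [:: [:: a11; a12; a13]; [:: a21; a22; a23]; [:: a31; a32; a33]] =
  mx3 [:: [:: k * a11; k * a12; k * a13]; [:: k * a21; k * a22; k * a23];
          [:: k * a31; k * a32; k * a33]].
Proof.
by apply/matrixP => -[[|[|[|i]]] hi] [[|[|[|j]]] hj] //; rewrite !mxE.
Qed.

End Coordinates.

(** * Generation by one-parameter subgroups *)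

Section Subgroups.
Variable R : realType.
Local Notation V := 'rV[R]_4.
Variable h : {vspace V}.

Lemma one_parameter_line (G : group4 R) (X : V) :
  (forall s t, gmul G (s *: X) (t *: X) = (s + t) *: X) ->
  one_parameter_subgroup G (fun s => s *: X) /\ derive1 (fun s : R => s *: X) 0 = X.
Proof.
move=> XM; have dX (s : R) : is_vderive s (1 : R) (fun s => s *: X) X.
  move=> j; have -> : (fun q => (q *: X) 0 j) = (fun q : R => q * X 0 j).
    by apply/funext => q; rewrite mxE.
  apply: is_derive_eq (is_deriveMr_fun (X 0 j) (is_derive_id s (1 : R))) _.
  by rewrite mul1r.
split; last by rewrite derive1E; have [] := derive_row (dX 0).
by split=> [s|s t]; [have [] := derive_row (dX s) | rewrite XM].
Qed.

Lemma lie_subgroup_line (G : group4 R) (X : V) (s : R) q :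
  (forall s t, gmul G (s *: X) (t *: X) = (s + t) *: X) ->
  s = 0 \/ X \in h -> lie_subgroup G h q -> lie_subgroup G h (gmul G (s *: X) q).
Proof.
move=> XM [->|Xh] hq; first by rewrite scale0r gmul0.
have [oX dX] := one_parameter_line XM.
by apply: (@lie_subgroup_exp _ G h (fun s => s *: X)) => //; rewrite dX.
Qed.

Let simp := (@xZE R, @xLE R, @xDE R, mulr0, mul0r, oppr0, expR0, addr0, mul1r, add0r).

Lemma sol1_generated p : x1 p = 0 \/ e1 R \in h -> x2 p = 0 \/ e2 R \in h ->
  x3 p = 0 \/ e3 R \in h -> x4 p = 0 \/ e4 R \in h -> lie_subgroup (Sol1 R) h p.
Proof.
move=> h1 h2 h3 h4.
(* With e3 to the left of e2 the Heisenberg cross term does not arise, and with e4 last all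
   exponentials are 1. *)
have -> : p = gmul (Sol1 R) (x1 p *: e1 R) (gmul (Sol1 R) (x3 p *: e3 R)
    (gmul (Sol1 R) (x2 p *: e2 R) (gmul (Sol1 R) (x4 p *: e4 R) 0))).
  by apply: vec4P; rewrite /= /sol1_mul /e1 /e2 /e3 /e4 !simp; ring.
do 4 (apply: lie_subgroup_line => // [s t|];
  first by apply: vec4P; rewrite /= /sol1_mul /e1 /e2 /e3 /e4 !simp; ring).
exact: lie_subgroup_id.
Qed.

Lemma sol_generated l p : x1 p = 0 \/ e1 R \in h -> x2 p = 0 \/ e2 R \in h ->
  x3 p = 0 \/ e3 R \in h -> x4 p = 0 \/ e4 R \in h -> lie_subgroup (Sol l) h p.
Proof.
move=> h1 h2 h3 h4.
have -> : p = gmul (Sol l) (x1 p *: e1 R) (gmul (Sol l) (x3 p *: e3 R)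
    (gmul (Sol l) (x2 p *: e2 R) (gmul (Sol l) (x4 p *: e4 R) 0))).
  by apply: vec4P; rewrite /= /sol_mul /e1 /e2 /e3 /e4 !simp; ring.
do 4 (apply: lie_subgroup_line => // [s t|];
  first by apply: vec4P; rewrite /= /sol_mul /e1 /e2 /e3 /e4 !simp; ring).
exact: lie_subgroup_id.
Qed.

(** The exponential of s (a e3 + b e4). As x4 grows linearly, the e3 direction feeds x2 and x1,
    whence the quadratic and cubic terms. *)
Definition nil4_exp (a b s : R) : V :=
  vec4 (a * b ^+ 2 * s ^+ 3 / 6) (- (a * b * s ^+ 2 / 2)) (a * s) (b * s).

Lemma nil4_exp_subgroup a b : one_parameter_subgroup (Nil4 R) (nil4_exp a b) /\
  derive1 (nil4_exp a b) 0 = a *: e3 R + b *: e4 R.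
Proof.
have dE s : is_vderive s (1 : R) (nil4_exp a b)
    (vec4 (a * b ^+ 2 * s ^+ 2 / 2) (- (a * b * s)) a b).
  have dX n k : is_derive s (1 : R) (fun s => k * s ^+ n.+1) (k * (n.+1%:R * s ^+ n)).
    have D := is_deriveMl_fun k (is_deriveX n.+1 (is_derive_id s (1 : R))).
    have -> : (fun s => k * s ^+ n.+1) = (fun s => k * (id ^+ n.+1) s).
      by apply/funext => q; rewrite exprfctE.
    by apply: is_derive_eq D _; rewrite /= [_ *: _]mulr1.
  move=> [[|[|[|[|k]]]] hj]; rewrite ?mxE/=; last by exfalso; exact: (notF hj).
  - have -> : (fun q => nil4_exp a b q 0 (Ordinal hj)) =
      (fun s => (a * b ^+ 2 / 6) * s ^+ 3) by apply/funext => q; rewrite mxE /=; ring.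
    by apply: is_derive_eq (dX 2 _) _; field.
  - have -> : (fun q => nil4_exp a b q 0 (Ordinal hj)) =
      (fun s => (- (a * b / 2)) * s ^+ 2) by apply/funext => q; rewrite mxE /=; ring.
    by apply: is_derive_eq (dX 1 _) _; field.
  - have -> : (fun q => nil4_exp a b q 0 (Ordinal hj)) =
      (fun s => a * s ^+ 1) by apply/funext => q; rewrite mxE /= expr1.
    by apply: is_derive_eq (dX 0 _) _; rewrite expr0; ring.
  - have -> : (fun q => nil4_exp a b q 0 (Ordinal hj)) =
      (fun s => b * s ^+ 1) by apply/funext => q; rewrite mxE /= expr1.
    by apply: is_derive_eq (dX 0 _) _; rewrite expr0; ring.
split; last first.
  rewrite derive1E; have [_ ->] := derive_row (dE 0).
  by apply: vec4P; rewrite /e3 /e4 !simp; ring.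
split=> [s|s t]; first by have [] := derive_row (dE s).
by apply: vec4P; rewrite /= /nil4_mul /nil4_exp !xE; field.
Qed.

Lemma nil4_generated a b p : ~ (a = 0 /\ b = 0) -> a * x4 p = b * x3 p ->
  e1 R \in h -> e2 R \in h -> a *: e3 R + b *: e4 R \in h -> lie_subgroup (Nil4 R) h p.
Proof.
move=> ab pE h1 h2 h34.
have n0 : a ^+ 2 + b ^+ 2 != 0.
  apply/eqP => /eqP; rewrite paddr_eq0 ?sqr_ge0// !sqrf_eq0 => /andP[/eqP a0 /eqP b0].
  exact: ab.
(* The pair (x3 p, x4 p) is proportional to (a, b), and [s] is the factor. The factors along e1 and
   e2 below then absorb the nonlinear terms of [nil4_exp]. *)
pose s := (a * x3 p + b * x4 p) / (a ^+ 2 + b ^+ 2).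
have sE : (a ^+ 2 + b ^+ 2) * s = a * x3 p + b * x4 p by rewrite /s mulrC divfK.
have x3E : x3 p = a * s.
  apply: (mulfI n0); rewrite mulrCA sE.
  transitivity (a * (a * x3 p) + b * (b * x3 p)); first by ring.
  by rewrite -pE; ring.
have x4E : x4 p = b * s.
  apply: (mulfI n0); rewrite mulrCA sE.
  transitivity (a * (a * x4 p) + b * (b * x4 p)); first by ring.
  by rewrite pE; ring.
have -> : p = gmul (Nil4 R) ((x1 p - a * b ^+ 2 * s ^+ 3 / 6) *: e1 R)
    (gmul (Nil4 R) ((x2 p + a * b * s ^+ 2 / 2) *: e2 R)
    (gmul (Nil4 R) (nil4_exp a b s) 0)).
  by apply: vec4P; rewrite /= /nil4_mul /nil4_exp /e1 /e2 ?x3E ?x4E !simp; field.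
do 2 (apply: lie_subgroup_line => // [s' t||]; [
  by apply: vec4P; rewrite /= /nil4_mul /e1 /e2 !simp; ring | by right | ]).
have [sub der] := nil4_exp_subgroup a b.
by apply: (lie_subgroup_exp s sub); [rewrite der | exact: lie_subgroup_id].
Qed.

End Subgroups.

(** * The subgroups as zero sets of linear forms *)

Section HypersurfaceSubgroups.
Variable R : realType.
Local Notation V := 'rV[R]_4.
Variable h : {vspace V}.

Let simp := (@xZE R, @xLE R, @xDE R, mulr0, mul0r, mulr1, oppr0, expR0, addr0, mul1r, add0r).

Lemma nil4_hypersurface (a b : R) : ~ (a = 0 /\ b = 0) ->
  (forall v, v \in h -> a * x4 v - b * x3 v = 0) ->
  e1 R \in h -> e2 R \in h -> a *: e3 R + b *: e4 R \in h ->
  hypersurface_subgroup (Nil4 R) (@nil4_br R) h (fun v => a * x4 v - b * x3 v) 0.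
Proof.
move=> ab hell h1 h2 h34; split=> //.
- by move=> k X Y; rewrite !simp; ring.
- by move=> p q; rewrite /= /nil4_mul !simp; ring.
- by move=> p q; rewrite /= /nil4_mul !simp.
- by move=> X p; rewrite nil4_fieldE !simp.
- by move=> X p; rewrite nil4_fieldE !simp.
- by move=> X Y; rewrite /nil4_br /e1 /e2 !simp; ring.
- by move=> X Y; rewrite /nil4_br /e1 /e2 !simp.
- move=> p /eqP; rewrite subr_eq0 => /eqP pE.
  exact: (nil4_generated ab pE h1 h2 h34).
- have [a0|a0] := eqVneq a 0.
    have b0 : b != 0 by apply/eqP => b0; exact: ab.
    by exists (- b^-1 *: e3 R); rewrite a0 /e3 !simp; split=> //; field.
  by exists (a^-1 *: e4 R); rewrite /e4 !simp; split=> //; field.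
Qed.

(** [w] is the weight of the coordinate under the action of x4: 1, -1, 0 for x2, x3, x4 in [Sol1],
    and l, 1, -(l + 1), 0 for x1, x2, x3, x4 in [Sol l]. *)
Lemma sol1_hypersurface2 : (forall v, v \in h -> x2 v = 0) ->
  e1 R \in h -> e3 R \in h -> e4 R \in h ->
  hypersurface_subgroup (Sol1 R) (@sol1_br R) h (@x2 R) 1.
Proof.
move=> hell h1 h3 h4; split=> //.
- by move=> k X Y; rewrite !simp.
- by move=> p q; rewrite /= /sol1_mul !simp.
- by move=> p q; rewrite /= /sol1_mul !simp.
- by move=> X p; rewrite sol1_fieldE !simp.
- by move=> X p; rewrite sol1_fieldE !simp.
- by move=> X Y; rewrite /sol1_br /e1 /e2 /e3 !simp; ring.
- by move=> X Y; rewrite /sol1_br /e1 /e2 /e3 !simp.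
- by move=> p p0; apply: sol1_generated; [right|left|right|right].
- by exists (e2 R); rewrite /e2 !simp.
Qed.

Lemma sol1_hypersurface3 : (forall v, v \in h -> x3 v = 0) ->
  e1 R \in h -> e2 R \in h -> e4 R \in h ->
  hypersurface_subgroup (Sol1 R) (@sol1_br R) h (@x3 R) (- 1).
Proof.
move=> hell h1 h2 h4; split=> //.
- by move=> k X Y; rewrite !simp.
- by move=> p q; rewrite /= /sol1_mul !simp mulN1r.
- by move=> p q; rewrite /= /sol1_mul !simp.
- by move=> X p; rewrite sol1_fieldE !simp mulN1r.
- by move=> X p; rewrite sol1_fieldE !simp.
- by move=> X Y; rewrite /sol1_br /e1 /e2 /e3 !simp; ring.
- by move=> X Y; rewrite /sol1_br /e1 /e2 /e3 !simp.
- by move=> p p0; apply: sol1_generated; [right|right|left|right].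
- by exists (e3 R); rewrite /e3 !simp.
Qed.

Lemma sol1_hypersurface4 : (forall v, v \in h -> x4 v = 0) ->
  e1 R \in h -> e2 R \in h -> e3 R \in h ->
  hypersurface_subgroup (Sol1 R) (@sol1_br R) h (@x4 R) 0.
Proof.
move=> hell h1 h2 h3; split=> //.
- by move=> k X Y; rewrite !simp.
- by move=> p q; rewrite /= /sol1_mul !simp.
- by move=> p q; rewrite /= /sol1_mul !simp.
- by move=> X p; rewrite sol1_fieldE !simp.
- by move=> X p; rewrite sol1_fieldE !simp.
- by move=> X Y; rewrite /sol1_br /e1 /e2 /e3 !simp.
- by move=> X Y; rewrite /sol1_br /e1 /e2 /e3 !simp.
- by move=> p p0; apply: sol1_generated; [right|right|right|left].
- by exists (e4 R); rewrite /e4 !simp.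
Qed.

Variable l : R.

Lemma sol_hypersurface1 : (forall v, v \in h -> x1 v = 0) ->
  e2 R \in h -> e3 R \in h -> e4 R \in h ->
  hypersurface_subgroup (Sol l) (sol_br l) h (@x1 R) l.
Proof.
move=> hell h2 h3 h4; split=> //.
- by move=> k X Y; rewrite !simp.
- by move=> p q; rewrite /= /sol_mul !simp.
- by move=> p q; rewrite /= /sol_mul !simp.
- by move=> X p; rewrite sol_fieldE !simp.
- by move=> X p; rewrite sol_fieldE !simp.
- by move=> X Y; rewrite /sol_br /e1 /e2 /e3 !simp; ring.
- by move=> X Y; rewrite /sol_br /e1 /e2 /e3 !simp.
- by move=> p p0; apply: sol_generated; [left|right|right|right].
- by exists (e1 R); rewrite /e1 !simp.
Qed.

Lemma sol_hypersurface2 : (forall v, v \in h -> x2 v = 0) ->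
  e1 R \in h -> e3 R \in h -> e4 R \in h ->
  hypersurface_subgroup (Sol l) (sol_br l) h (@x2 R) 1.
Proof.
move=> hell h1 h3 h4; split=> //.
- by move=> k X Y; rewrite !simp.
- by move=> p q; rewrite /= /sol_mul !simp.
- by move=> p q; rewrite /= /sol_mul !simp.
- by move=> X p; rewrite sol_fieldE !simp.
- by move=> X p; rewrite sol_fieldE !simp.
- by move=> X Y; rewrite /sol_br /e1 /e2 /e3 !simp; ring.
- by move=> X Y; rewrite /sol_br /e1 /e2 /e3 !simp.
- by move=> p p0; apply: sol_generated; [right|left|right|right].
- by exists (e2 R); rewrite /e2 !simp.
Qed.

Lemma sol_hypersurface3 : (forall v, v \in h -> x3 v = 0) ->
  e1 R \in h -> e2 R \in h -> e4 R \in h ->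
  hypersurface_subgroup (Sol l) (sol_br l) h (@x3 R) (- (l + 1)).
Proof.
move=> hell h1 h2 h4; split=> //.
- by move=> k X Y; rewrite !simp.
- by move=> p q; rewrite /= /sol_mul !simp.
- by move=> p q; rewrite /= /sol_mul !simp.
- by move=> X p; rewrite sol_fieldE !simp.
- by move=> X p; rewrite sol_fieldE !simp.
- by move=> X Y; rewrite /sol_br /e1 /e2 /e3 !simp; ring.
- by move=> X Y; rewrite /sol_br /e1 /e2 /e3 !simp.
- by move=> p p0; apply: sol_generated; [right|right|left|right].
- by exists (e3 R); rewrite /e3 !simp.
Qed.

Lemma sol_hypersurface4 : (forall v, v \in h -> x4 v = 0) ->
  e1 R \in h -> e2 R \in h -> e3 R \in h ->
  hypersurface_subgroup (Sol l) (sol_br l) h (@x4 R) 0.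
Proof.
move=> hell h1 h2 h3; split=> //.
- by move=> k X Y; rewrite !simp.
- by move=> p q; rewrite /= /sol_mul !simp.
- by move=> p q; rewrite /= /sol_mul !simp.
- by move=> X p; rewrite sol_fieldE !simp.
- by move=> X p; rewrite sol_fieldE !simp.
- by move=> X Y; rewrite /sol_br /e1 /e2 /e3 !simp.
- by move=> X Y; rewrite /sol_br /e1 /e2 /e3 !simp.
- by move=> p p0; apply: sol_generated; [right|right|right|left].
- by exists (e4 R); rewrite /e4 !simp.
Qed.

End HypersurfaceSubgroups.

(** * Structure constants in the orthonormal frames *)

Section Frames.
Variable R : realType.
Local Notation V := 'rV[R]_4.
Let simp := (@xZE R, @xLE R, @xDE R, mulr0, mul0r, mulr1, oppr0, expR0, addr0, mul1r, add0r).

Definition nil4_frame (d1 d2 d3 : R) : 4.-tuple V :=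
  [tuple d1 *: e1 R; d2 *: e1 R + d3 *: e2 R; e3 R; e4 R].

Lemma nil4_frame_unit d1 d2 d3 : 0 < d1 -> 0 < d3 ->
  frame_mx (nil4_frame d1 d2 d3) \in unitmx.
Proof.
move=> d1_gt0 d3_gt0; have d1n := lt0r_neq0 d1_gt0; have d3n := lt0r_neq0 d3_gt0.
apply: (@frame_mx_unit _ _ (fun X => vec4 ((x1 X - d2 * (x2 X / d3)) / d1)
  (x2 X / d3) (x3 X) (x4 X))) => X.
by rewrite [LHS]frame_combE; apply: vec4P; rewrite /e1 /e2 /e3 /e4 !simp; field; rewrite ?d1n ?d3n.
Qed.

Lemma nil4_br_comb d1 d2 d3 y1 y2 y3 y4 z1 z2 z3 z4 : 0 < d1 -> 0 < d3 ->
  nil4_br (frame_comb (nil4_frame d1 d2 d3) y1 y2 y3 y4)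
    (frame_comb (nil4_frame d1 d2 d3) z1 z2 z3 z4) =
  frame_comb (nil4_frame d1 d2 d3)
    (d3 / d1 * (y2 * z4 - y4 * z2) - d2 / (d1 * d3) * (y3 * z4 - y4 * z3))
    ((y3 * z4 - y4 * z3) / d3) 0 0.
Proof.
move=> d1_gt0 d3_gt0; have d1n := lt0r_neq0 d1_gt0; have d3n := lt0r_neq0 d3_gt0.
rewrite !frame_combE /nil4_br.
by apply: vec4P; rewrite /e1 /e2 /e3 /e4 !simp; field; rewrite ?d1n ?d3n.
Qed.

Definition sol1_frame (d1 d2 d3 d4 d5 : R) : 4.-tuple V :=
  [tuple d1 *: e1 R; d2 *: e1 R + e2 R; d3 *: e1 R + d4 *: e2 R + e3 R; d5 *: e4 R].

Lemma sol1_frame_unit d1 d2 d3 d4 d5 : 0 < d1 -> 0 < d5 ->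
  frame_mx (sol1_frame d1 d2 d3 d4 d5) \in unitmx.
Proof.
move=> d1_gt0 d5_gt0; have d1n := lt0r_neq0 d1_gt0; have d5n := lt0r_neq0 d5_gt0.
apply: (@frame_mx_unit _ _ (fun X => vec4
  ((x1 X - d2 * (x2 X - d4 * x3 X) - d3 * x3 X) / d1)
  (x2 X - d4 * x3 X) (x3 X) (x4 X / d5))) => X.
by rewrite [LHS]frame_combE; apply: vec4P; rewrite /e1 /e2 /e3 /e4 !simp; field; rewrite ?d1n ?d5n.
Qed.

Lemma sol1_br_comb d1 d2 d3 d4 d5 y1 y2 y3 y4 z1 z2 z3 z4 : 0 < d1 ->
  sol1_br (frame_comb (sol1_frame d1 d2 d3 d4 d5) y1 y2 y3 y4)
    (frame_comb (sol1_frame d1 d2 d3 d4 d5) z1 z2 z3 z4) =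
  frame_comb (sol1_frame d1 d2 d3 d4 d5)
    (((y2 * z3 - y3 * z2) + d5 * d2 * (y2 * z4 - y4 * z2)
      + d5 * (2 * d4 * d2 - d3) * (y3 * z4 - y4 * z3)) / d1)
    (- d5 * (y2 * z4 - y4 * z2) - 2 * d4 * d5 * (y3 * z4 - y4 * z3))
    (d5 * (y3 * z4 - y4 * z3)) 0.
Proof.
move=> d1_gt0; have d1n := lt0r_neq0 d1_gt0.
rewrite !frame_combE /sol1_br.
by apply: vec4P; rewrite /e1 /e2 /e3 /e4 !simp; field; rewrite ?d1n.
Qed.

Definition sol_frame (d1 d2 d3 d4 : R) : 4.-tuple V :=
  [tuple e1 R; d1 *: e1 R + e2 R; d2 *: e1 R + d3 *: e2 R + e3 R; d4 *: e4 R].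

Lemma sol_frame_unit d1 d2 d3 d4 : 0 < d4 ->
  frame_mx (sol_frame d1 d2 d3 d4) \in unitmx.
Proof.
move=> d4_gt0; have d4n := lt0r_neq0 d4_gt0.
apply: (@frame_mx_unit _ _ (fun X => vec4
  (x1 X - d1 * (x2 X - d3 * x3 X) - d2 * x3 X)
  (x2 X - d3 * x3 X) (x3 X) (x4 X / d4))) => X.
by rewrite [LHS]frame_combE; apply: vec4P; rewrite /e1 /e2 /e3 /e4 !simp; field; rewrite ?d4n.
Qed.

Lemma sol_br_comb l d1 d2 d3 d4 y1 y2 y3 y4 z1 z2 z3 z4 :
  sol_br l (frame_comb (sol_frame d1 d2 d3 d4) y1 y2 y3 y4)
    (frame_comb (sol_frame d1 d2 d3 d4) z1 z2 z3 z4) =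
  frame_comb (sol_frame d1 d2 d3 d4)
    (d4 * (- l * (y1 * z4 - y4 * z1) + d1 * (1 - l) * (y2 * z4 - y4 * z2)
      + (d1 * d3 * (l + 2) - d2 * (2 * l + 1)) * (y3 * z4 - y4 * z3)))
    (d4 * (- (y2 * z4 - y4 * z2) - d3 * (l + 2) * (y3 * z4 - y4 * z3)))
    (d4 * (l + 1) * (y3 * z4 - y4 * z3)) 0.
Proof.
rewrite !frame_combE /sol_br.
by apply: vec4P; rewrite /e1 /e2 /e3 /e4 !simp; ring.
Qed.

End Frames.

(** * Reduction of a case to orthonormal coordinates *)

Section Cases.
Variables (R : realType) (G : group4 R) (br : 'rV[R]_4 -> 'rV[R]_4 -> 'rV[R]_4).
Variables (L M : 'rV[R]_4 -> 'M[R]_4) (E : 4.-tuple 'rV[R]_4).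
Variables (h : {vspace 'rV[R]_4}) (ell : 'rV[R]_4 -> R) (w : R).
Variables (xi : 'rV[R]_4) (N : R).
Local Notation V := 'rV[R]_4.
Local Notation ip := (ip E).
Local Notation g := (left_metric G E).
Hypothesis LF : left_frame G br L M.
Hypothesis E_unit : frame_mx E \in unitmx.
Hypothesis HS : hypersurface_subgroup G br h ell w.
Hypothesis xi_unit : ip xi xi = 1.
Hypothesis N0 : N != 0.
Hypothesis ellE : forall Y, ell Y = N * ip xi Y.
Variable c : R -> V.
Hypothesis cG : normal_geodesic G g h c.

Lemma normal_geodesic_ideal : w = 0 -> exists s, orientation c xi s /\
  forall t, body_velocity G c t = s *: xi.
Proof.
move=> w0; have [s [s1 c's]] := initial_velocity LF E_unit HS xi_unit N0 ellE cG.
by exists s; split=> // t; exact: (body_velocity_ideal LF E_unit HS N0 ellE cG c's).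
Qed.

Lemma normal_geodesic_hyperbolic (eta : V) (d k : R) :
  ip eta eta = 1 -> ip xi eta = 0 -> (forall Y, x4 Y = d * ip eta Y) ->
  k = - w * d -> exists s, orientation c xi s /\ forall t,
    body_velocity G c t = s *: (sech (k * (s * t)) *: xi + tanh (k * (s * t)) *: eta).
Proof.
move=> eta1 xe x4E ->; have [s [s1 c's]] := initial_velocity LF E_unit HS xi_unit N0 ellE cG.
exists s; split=> // t.
exact: (body_velocity_hyperbolic LF E_unit HS xi_unit N0 ellE cG s1 c's eta1 xe x4E).
Qed.

(** As s^2 = 1, the chosen normal eps s u is eps U, so the entries depend on [U] alone. In each use
    [eps] is the sign, 1 or -1, that matches the stated matrix. *)
Lemma orbit_shape3 (t s eps : R) (U b1 b2 b3 : V) (s11 s12 s13 s22 s23 s33 : R) :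
  s = 1 \/ s = -1 -> eps != 0 -> body_velocity G c t = s *: U ->
  [/\ ip b1 b1 = 1, ip b1 b2 = 0, ip b1 b3 = 0 &
      [/\ ip b2 b2 = 1, ip b2 b3 = 0 & ip b3 b3 = 1]] ->
  [/\ ip U b1 = 0, ip U b2 = 0 & ip U b3 = 0] ->
  [/\ s11 = eps * ip (br U b1) b1,
      s12 = eps / 2 * (ip (br U b1) b2 + ip (br U b2) b1),
      s13 = eps / 2 * (ip (br U b1) b3 + ip (br U b3) b1) &
   [/\ s22 = eps * ip (br U b2) b2,
      s23 = eps / 2 * (ip (br U b2) b3 + ip (br U b3) b2) &
      s33 = eps * ip (br U b3) b3]] ->
  let S := mx3 [:: [:: s11; s12; s13]; [:: s12; s22; s23]; [:: s13; s23; s33]] in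
  orbit_shape_matrix G g h c t (eps * s) S /\
  (orbit_totally_geodesic G g h c t <-> S = 0).
Proof.
move=> s1 eps0 uU [b11 b12 b13 [b22 b23 b33]] [U1 U2 U3] [e11 e12 e13 [e22 e23 e33]] S.
pose b (i : 'I_3) := nth 0 [:: b1; b2; b3] i.
have s2 : s * s = 1 by case: s1 => ->; ring.
have s0 : s != 0 by case: s1 => ->; rewrite ?oppr_eq0 oner_eq0.
have b_on i j : ip (b i) (b j) = (i == j)%:R.
  by case: i j => -[|[|[|i]]] hi [[|[|[|j]]] hj] //; rewrite /b /= // ipC.
have ub i : ip (body_velocity G c t) (b i) = 0.
  by rewrite uU ipZl; case: i => -[|[|[|i]]] hi //; rewrite /b /= ?U1 ?U2 ?U3 mulr0.
have sE X Y : eps * s / 2 * (ip (br (body_velocity G c t) X) Y +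
    ip (br (body_velocity G c t) Y) X) = eps / 2 * (ip (br U X) Y + ip (br U Y) X).
  rewrite uU !(brZl LF) !ipZl -mulrDr.
  transitivity ((s * s) * (eps / 2 * (ip (br U X) Y + ip (br U Y) X))).
    by field.
  by rewrite s2 mul1r.
have SE i j : S i j = eps * s / 2 * (ip (br (body_velocity G c t) (b j)) (b i) +
    ip (br (body_velocity G c t) (b i)) (b j)).
  rewrite sE mxE.
  by case: i j => -[|[|[|i]]] hi [[|[|[|j]]] hj] //; rewrite /b /= ?e11 ?e12 ?e13
    ?e22 ?e23 ?e33; field.
have es0 : eps * s != 0 by rewrite mulf_neq0.
split; first exact: (orbit_shape_matrixP LF E_unit HS xi_unit N0 ellE cG b_on ub SE).
exact: (totally_geodesicP LF E_unit HS xi_unit N0 ellE cG es0 b_on ub SE).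
Qed.

Lemma minimal_normal_orbit t : orbit_minimal G g h c t.
Proof. exact: (minimal_orbit LF E_unit HS xi_unit N0 ellE cG). Qed.

End Cases.

Lemma mx3_eq0 (R : realType) (a11 a12 a13 a21 a22 a23 a31 a32 a33 : R) :
  mx3 [:: [:: a11; a12; a13]; [:: a21; a22; a23]; [:: a31; a32; a33]] = 0 <->
  [/\ a11 = 0, a12 = 0 & a13 = 0] /\ [/\ a21 = 0, a22 = 0 & a23 = 0] /\
  [/\ a31 = 0, a32 = 0 & a33 = 0].
Proof.
split=> [A0|[[-> -> ->] [[-> -> ->] [-> -> ->]]]]; last first.
  by apply/matrixP => -[[|[|[|i]]] hi] [[|[|[|j]]] hj] //; rewrite !mxE.
have e i j (hi : (i < 3)%N) (hj : (j < 3)%N) :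
    nth 0 (nth [::] [:: [:: a11; a12; a13]; [:: a21; a22; a23];
      [:: a31; a32; a33]] i) j = 0.
  by have := congr1 (fun A : 'M[R]_3 => A (Ordinal hi) (Ordinal hj)) A0; rewrite !mxE.
by split; [|split]; split; [exact: (e 0%N 0%N)|exact: (e 0%N 1%N)|exact: (e 0%N 2%N)
  |exact: (e 1%N 0%N)|exact: (e 1%N 1%N)|exact: (e 1%N 2%N)
  |exact: (e 2%N 0%N)|exact: (e 2%N 1%N)|exact: (e 2%N 2%N)].
Qed.

Lemma frame_combP (R : realType) (E : 4.-tuple 'rV[R]_4) (Y : 'rV[R]_4) :
  frame_mx E \in unitmx -> exists y1 y2 y3 y4, Y = frame_comb E y1 y2 y3 y4.
Proof.
move=> uE; set Z := Y *m invmx (frame_mx E).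
exists (x1 Z), (x2 Z), (x3 Z), (x4 Z).
by rewrite /frame_comb -vec4_eta mulmxKV.
Qed.

(** * The geometry of the orbits *)

Section Nil4Case.
Variable R : realType.
Let simp := (@xZE R, @xNE R, @xLE R, @xDE R, mulr0, mul0r, mulr1, addr0, mul1r, add0r, subr0).

Lemma nil4_orbits (d1 d2 d3 a b : R) : 0 < d1 -> 0 < d3 -> ~ (a = 0 /\ b = 0) ->
   let G := Nil4 R in
   let E1 : 'rV[R]_4 := d1 *: e1 R in
   let E2 : 'rV[R]_4 := d2 *: e1 R + d3 *: e2 R in
   let E3 : 'rV[R]_4 := e3 R in
   let E4 : 'rV[R]_4 := e4 R in
   let g := left_metric G [tuple E1; E2; E3; E4] in
   let h := span [:: E1; E2; a *: E3 + b *: E4] in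
   let xi : 'rV[R]_4 := (Num.sqrt (a ^+ 2 + b ^+ 2))^-1 *: (a *: E4 - b *: E3) in
   let w := a * d3 ^+ 2 / Num.sqrt (a ^+ 2 + b ^+ 2) in
   forall c : R -> 'rV[R]_4, normal_geodesic G g h c ->
   [/\ exists s, orientation c xi s /\ forall t,
         orbit_shape_matrix G g h c t (- s)
           ((2 * d3 * d1)^-1 *: mx3 [:: [:: 0;  w;    d1];
                                        [:: w;  0;    - d2];
                                        [:: d1; - d2; 0]]),
       forall t, orbit_minimal G g h c t &
       forall t, ~ orbit_totally_geodesic G g h c t].
Proof.
move=> d1_gt0 d3_gt0 ab G E1 E2 E3 E4 g h xi w c cG.
have d1n := lt0r_neq0 d1_gt0; have d3n := lt0r_neq0 d3_gt0.
have uE := nil4_frame_unit d2 d1_gt0 d3_gt0.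
have [L [M LF]] := nil4_left_frame R.
have ab0 : 0 < a ^+ 2 + b ^+ 2.
  rewrite lt0r addr_ge0 ?sqr_ge0// andbT; apply/eqP => /eqP.
  by rewrite paddr_eq0 ?sqr_ge0// !sqrf_eq0 => /andP[/eqP a0 /eqP b0]; exact: ab.
pose n := Num.sqrt (a ^+ 2 + b ^+ 2).
have n2 : n ^+ 2 = a ^+ 2 + b ^+ 2 by rewrite sqr_sqrtr// ltW.
have nn : n != 0 by rewrite sqrtr_eq0 -ltNge.
have unit_ab : (a ^+ 2 + b ^+ 2) / n ^+ 2 = 1 by rewrite -n2 divff// expf_neq0.
pose f := frame_comb (nil4_frame d1 d2 d3).
have HS : hypersurface_subgroup G (@nil4_br R) h (fun v => a * x4 v - b * x3 v) 0.
  apply: nil4_hypersurface => //.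
  - by move=> v /span3P[x [y [z ->]]]; rewrite /E1 /E2 /E3 /E4 /e1 /e2 /e3 /e4 !simp; ring.
  - apply/span3P; exists d1^-1, 0, 0.
    by rewrite /E1 !scale0r !addr0 scalerA mulVf// scale1r.
  - apply/span3P; exists (- (d2 / (d1 * d3))), d3^-1, 0.
    by apply: vec4P; rewrite /E1 /E2 /e1 /e2 !simp ?xE; field; rewrite ?d1n ?d3n.
  - by apply/span3P; exists 0, 0, 1; rewrite !scale0r scale1r !add0r.
have xiE : xi = f 0 0 (- b / n) (a / n).
  by rewrite /f frame_combE; apply: vec4P; rewrite /xi /E3 /E4 /e1 /e2 /e3 /e4 !simp -/n; field.
have xi1 : ip (nil4_frame d1 d2 d3) xi xi = 1.
  by rewrite xiE ip_comb// -unit_ab; field.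
have ellE Y : a * x4 Y - b * x3 Y = n * ip (nil4_frame d1 d2 d3) xi Y.
  have [y1 [y2 [y3 [y4 ->]]]] := frame_combP Y uE.
  by rewrite xiE ip_comb// frame_combE /e1 /e2 /e3 /e4 !simp; field.
have [s [so uT]] := normal_geodesic_ideal LF uE HS xi1 nn ellE cG erefl.
pose S := (2 * d3 * d1)^-1 *: mx3 [:: [:: 0;  w;    d1];
  [:: w;  0;    - d2]; [:: d1; - d2; 0]].
have key t : orbit_shape_matrix G g h c t (- s) S /\
    (orbit_totally_geodesic G g h c t <-> S = 0).
  rewrite /S scale_mx3 -(mulN1r s).
  (* E2 comes before E1: this is the order in which the stated matrix appears. *)
  apply: (orbit_shape3 LF uE HS xi1 nn ellE cG (b1 := f 0 1 0 0) (b2 := f 1 0 0 0)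
    (b3 := f 0 0 (a / n) (b / n)) so.1 _ (uT t)).
  - by rewrite oppr_eq0 oner_eq0.
  - rewrite /f !ip_comb//.
    split; [ring|ring|ring|split; [ring|ring|by rewrite -[RHS]unit_ab; field]].
  - by rewrite xiE /f !ip_comb//; split; field.
  - rewrite xiE /f !nil4_br_comb// !ip_comb//.
    have wE : w = a * d3 ^+ 2 / n by [].
    (* The minor y3 z4 - y4 z3 of [xi] and the third basis vector, through which the bracket sees
       this pair. *)
    have uab : - b / n * (b / n) - a / n * (a / n) = - 1.
      by rewrite -unit_ab; field.
    rewrite uab wE.
    by split; [| | |split]; field; rewrite ?nn ?d1n ?d3n.
split.
- by exists s; split=> // t; have [] := key t.
- exact: (minimal_normal_orbit LF uE HS xi1 nn ellE cG).
(* The entry (1, 3) is 1 / (2 d3). *)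
- move=> t; have [_ ->] := key t; rewrite /S scale_mx3 => /mx3_eq0[[_ _ /eqP]].
  by rewrite mulf_eq0 invr_eq0 !mulf_eq0 pnatr_eq0 (negPf d1n) (negPf d3n).
Qed.

End Nil4Case.

(** Proves an identity modulo one algebraic relation: once the cofactor [k] is supplied, the second
    premise is a free identity for [field]. *)
Lemma eq_of_relation (R : realType) (k x y A B : R) :
  x = y -> A - B = k * (x - y) -> A = B.
Proof. by move=> -> /eqP; rewrite subrr mulr0 subr_eq0 => /eqP. Qed.

(** * Orbits in Sol_1^4 *)

Section Sol1Cases.
Variables (R : realType) (d1 d2 d3 d4 d5 : R).
Hypotheses (d1_gt0 : 0 < d1) (d5_gt0 : 0 < d5).
Let simp := (@xZE R, @xNE R, @xLE R, @xDE R, mulr0, mul0r, mulr1, addr0, mul1r, add0r, subr0).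

Let G := Sol1 R.
Let E1 : 'rV[R]_4 := d1 *: e1 R.
Let E2 : 'rV[R]_4 := d2 *: e1 R + e2 R.
Let E3 : 'rV[R]_4 := d3 *: e1 R + d4 *: e2 R + e3 R.
Let E4 : 'rV[R]_4 := d5 *: e4 R.
Let E := sol1_frame d1 d2 d3 d4 d5.
Let g := left_metric G E.
Let f := frame_comb E.

Let d1n := lt0r_neq0 d1_gt0.
Let d5n := lt0r_neq0 d5_gt0.
Let uE : frame_mx E \in unitmx := sol1_frame_unit d2 d3 d4 d1_gt0 d5_gt0.

Let frameP Y : exists y1 y2 y3 y4, [/\ Y = f y1 y2 y3 y4,
  x2 Y = y2 + d4 * y3, x3 Y = y3 & x4 Y = d5 * y4].
Proof.
have [y1 [y2 [y3 [y4 ->]]]] := frame_combP Y uE.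
exists y1, y2, y3, y4; split=> //;
  by rewrite frame_combE /e1 /e2 /e3 /e4 !simp //; ring.
Qed.

Lemma sol1_orbits_a :
   let h := span [:: E1; E2; E3] in
   let w := d2 / (2 * d1) in
   let th := (2 * d4 * d2 - d3) / (2 * d1) in
   forall c : R -> 'rV[R]_4, normal_geodesic G g h c ->
   [/\ exists s, orientation c E4 s /\ forall t,
         orbit_shape_matrix G g h c t (- s)
           (d5 *: mx3 [:: [:: 0;  w;    th];
                          [:: w;  - 1;  - d4];
                          [:: th; - d4; 1]]),
       forall t, orbit_minimal G g h c t &
       forall t, ~ orbit_totally_geodesic G g h c t].
Proof.
move=> h w th c cG; have [L [M LF]] := sol1_left_frame R.
have HS : hypersurface_subgroup G (@sol1_br R) h (@x4 R) 0.
  apply: sol1_hypersurface4.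
  - by move=> v /span3P[x [y [z ->]]]; rewrite /E1 /E2 /E3 /e1 /e2 /e3 !simp.
  - apply/span3P; exists d1^-1, 0, 0.
    by rewrite /E1 !scale0r !addr0 scalerA mulVf// scale1r.
  - apply/span3P; exists (- (d2 / d1)), 1, 0.
    by apply: vec4P; rewrite /E1 /E2 /e1 /e2 !simp ?xE; field; rewrite ?d1n.
  - apply/span3P; exists ((d4 * d2 - d3) / d1), (- d4), 1.
    by apply: vec4P; rewrite /E1 /E2 /E3 /e1 /e2 /e3 !simp ?xE; field; rewrite ?d1n.
have E4E : E4 = f 0 0 0 1 by rewrite /f frame_combE !scale0r !add0r scale1r.
have xi1 : ip E E4 E4 = 1 by rewrite E4E ip_comb//; ring.
have ellE Y : x4 Y = d5 * ip E E4 Y.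
  have [y1 [y2 [y3 [y4 [-> _ _ ->]]]]] := frameP Y.
  by rewrite E4E ip_comb//; ring.
have [s [so uT]] := normal_geodesic_ideal LF uE HS xi1 d5n ellE cG erefl.
pose S := d5 *: mx3 [:: [:: 0;  w; th]; [:: w;  - 1;  - d4]; [:: th; - d4; 1]].
have key t : orbit_shape_matrix G g h c t (- s) S /\
    (orbit_totally_geodesic G g h c t <-> S = 0).
  rewrite /S scale_mx3 -(mulN1r s).
  apply: (orbit_shape3 LF uE HS xi1 d5n ellE cG (b1 := f 1 0 0 0) (b2 := f 0 1 0 0)
    (b3 := f 0 0 1 0) so.1 _ (uT t)).
  - by rewrite oppr_eq0 oner_eq0.
  - by rewrite /f !ip_comb//; split; [| | |split]; ring.
  - by rewrite E4E /f !ip_comb//; split; ring.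
  - rewrite E4E /f !sol1_br_comb// !ip_comb// /w /th.
    by split; [| | |split]; field; rewrite ?d1n.
split.
- by exists s; split=> // t; have [] := key t.
- exact: (minimal_normal_orbit LF uE HS xi1 d5n ellE cG).
- move=> t; have [_ ->] := key t; rewrite /S scale_mx3 => /mx3_eq0[_ [_ [_ _ /eqP]]].
  by rewrite mulr1 (negPf d5n).
Qed.

Lemma sol1_orbits_b :
   let h := span [:: E1; E2; E4] in
   let w t := (1 - d2 * d5 * sinh (- d5 * t)) /
              (2 * d1 * d5 * cosh (- d5 * t)) in
   let th := (2 * d4 * d2 - d3) / (2 * d1) in
   let M t := d5 *: mx3 [:: [:: 0;   w t;             th];
                            [:: w t; tanh (- d5 * t); - d4];
                            [:: th;  - d4;            - tanh (- d5 * t)]] in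
   forall c : R -> 'rV[R]_4, normal_geodesic G g h c ->
   [/\ exists s, orientation c E3 s /\ forall t,
         orbit_shape_matrix G g h c t (- s) (M (s * t)),
       forall t, orbit_minimal G g h c t &
       forall t, ~ orbit_totally_geodesic G g h c t].
Proof.
move=> h w th M' c cG; have [L [M LF]] := sol1_left_frame R.
have HS : hypersurface_subgroup G (@sol1_br R) h (@x3 R) (- 1).
  apply: sol1_hypersurface3.
  - by move=> v /span3P[x [y [z ->]]]; rewrite /E1 /E2 /E4 /e1 /e2 /e4 !simp.
  - apply/span3P; exists d1^-1, 0, 0.
    by rewrite /E1 !scale0r !addr0 scalerA mulVf// scale1r.
  - apply/span3P; exists (- (d2 / d1)), 1, 0.
    by apply: vec4P; rewrite /E1 /E2 /e1 /e2 !simp ?xE; field; rewrite ?d1n.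
  - apply/span3P; exists 0, 0, d5^-1.
    by rewrite /E4 !scale0r !add0r scalerA mulVf// scale1r.
have E3E : E3 = f 0 0 1 0 by rewrite /f frame_combE !scale0r !add0r scale1r addr0.
have xi1 : ip E E3 E3 = 1 by rewrite E3E ip_comb//; ring.
have ellE Y : x3 Y = 1 * ip E E3 Y.
  have [y1 [y2 [y3 [y4 [-> _ -> _]]]]] := frameP Y.
  by rewrite E3E ip_comb//; ring.
have x4E Y : x4 Y = d5 * ip E (f 0 0 0 1) Y.
  have [y1 [y2 [y3 [y4 [-> _ _ ->]]]]] := frameP Y.
  by rewrite ip_comb//; ring.
have eta1 : ip E (f 0 0 0 1) (f 0 0 0 1) = 1 by rewrite ip_comb//; ring.
have xi_eta : ip E E3 (f 0 0 0 1) = 0 by rewrite E3E ip_comb//; ring.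
have kE : d5 = - (- 1) * d5 by ring.
have [s [so uT]] := normal_geodesic_hyperbolic LF uE HS xi1 (oner_neq0 _) ellE cG
  eta1 xi_eta x4E kE.
have key t : orbit_shape_matrix G g h c t (- s) (M' (s * t)) /\
    (orbit_totally_geodesic G g h c t <-> M' (s * t) = 0).
  rewrite /M' scale_mx3 -(mulN1r s).
  (* The stated matrix has the argument - d5 t, while k = d5; parity of sech and tanh reconciles
     them. *)
  pose x := - d5 * (s * t).
  have xE : d5 * (s * t) = - x by rewrite /x; ring.
  have := uT t; rewrite xE tanhN sechN => {}uT.
  have C0 := cosh_gt0 x; have Cn := lt0r_neq0 C0.
  have CT : sech x * - sech x - - tanh x * - tanh x = - 1.
    by rewrite -[in RHS](sech2_tanh2 x); ring.
  have UE : sech x *: E3 + - tanh x *: f 0 0 0 1 = f 0 0 (sech x) (- tanh x).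
    by rewrite E3E /f !frame_combE !scale0r !add0r !scale1r addr0.
  rewrite UE in uT.
  (* The third vector is U turned by a right angle in the plane of E3 and E4; [CT] is the
     corresponding minor. *)
  apply: (orbit_shape3 LF uE HS xi1 (oner_neq0 _) ellE cG
    (b1 := f 1 0 0 0) (b2 := f 0 1 0 0)
    (b3 := f 0 0 (- tanh x) (- sech x)) so.1 _ uT).
  - by rewrite oppr_eq0 oner_eq0.
  - rewrite /f !ip_comb//; split; [ring|ring|ring|split; [ring|ring|]].
    by rewrite -[RHS](sech2_tanh2 x); ring.
  - by rewrite /f !ip_comb//; split; ring.
  - rewrite /f !sol1_br_comb// !ip_comb// CT /w /th -/x.
    rewrite /sech /tanh.
    by split; [| | |split]; field; rewrite ?d1n ?d5n ?Cn.
split.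
- by exists s; split=> // t; have [] := key t.
- exact: (minimal_normal_orbit LF uE HS xi1 (oner_neq0 _) ellE cG).
- move=> t; have [_ ->] := key t; rewrite /M' scale_mx3.
  set x := - d5 * (s * t); have Cn := lt0r_neq0 (cosh_gt0 x).
  (* The diagonal vanishes only at x = 0, where [w] is 1 / (2 d1 d5). *)
  move=> /mx3_eq0[[_ w0 _] [[_ t0 _] _]].
  move/eqP: t0; rewrite mulf_eq0 (negPf d5n)/= => /eqP/tanh_eq0 x0.
  move/eqP: w0; rewrite mulf_eq0 (negPf d5n)/= /w -/x x0 sinh0 mulr0 subr0.
  rewrite mul1r invr_eq0 3!mulf_eq0 pnatr_eq0 (negPf d1n) (negPf d5n)/=.
  by move: Cn; rewrite x0 => /negPf ->.
Qed.

Lemma sol1_orbits_c :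
   let r := Num.sqrt (1 + d4 ^+ 2) in
   let h := span [:: E1; E4; r^-1 *: (d4 *: E2 - E3)] in
   let xi : 'rV[R]_4 := r^-1 *: (E2 + d4 *: E3) in
   let w t := (r + d5 * (d3 - d2 * d4) * sinh (- d5 * t)) /
              (2 * d1 * d5 * r * cosh (- d5 * t)) in
   let th := (d2 * (1 + 2 * d4 ^+ 2) - d3 * d4) / (2 * d1 * r) in
   let M t := d5 *: mx3 [:: [:: 0;   w t;             th];
                            [:: w t; tanh (- d5 * t); - d4];
                            [:: th;  - d4;            - tanh (- d5 * t)]] in
   forall c : R -> 'rV[R]_4, normal_geodesic G g h c ->
   [/\ exists s, orientation c xi s /\ forall t,
         orbit_shape_matrix G g h c t (- s) (M (s * t)),
       forall t, orbit_minimal G g h c t &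
       forall t, ~ orbit_totally_geodesic G g h c t].
Proof.
move=> r h xi w th M' c cG; have [L [M LF]] := sol1_left_frame R.
have d42 : 0 < 1 + d4 ^+ 2 by rewrite ltr_pwDl// sqr_ge0.
have r2 : r ^+ 2 = 1 + d4 ^+ 2 by rewrite sqr_sqrtr// ltW.
have rn : r != 0 by rewrite sqrtr_eq0 -ltNge.
have unit_r : (1 + d4 ^+ 2) / r ^+ 2 = 1 by rewrite -r2 divff// expf_neq0.
have HS : hypersurface_subgroup G (@sol1_br R) h (@x2 R) 1.
  apply: sol1_hypersurface2.
  - by move=> v /span3P[x [y [z ->]]]; rewrite /E1 /E2 /E3 /E4 /e1 /e2 /e3 /e4 !simp; ring.
  - apply/span3P; exists d1^-1, 0, 0.
    by rewrite /E1 !scale0r !addr0 scalerA mulVf// scale1r.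
  - apply/span3P; exists ((d4 * d2 - d3) / d1), 0, (- r).
    by apply: vec4P; rewrite /E1 /E2 /E3 /E4 /e1 /e2 /e3 /e4 !simp ?xE; field; rewrite ?d1n ?rn.
  - apply/span3P; exists 0, d5^-1, 0.
    by rewrite /E4 !scale0r !add0r addr0 scalerA mulVf// scale1r.
have xiE : xi = f 0 r^-1 (d4 / r) 0.
  rewrite /f frame_combE /xi !scale0r add0r addr0 scalerDr scalerA.
  by rewrite [r^-1 * d4]mulrC.
have xi1 : ip E xi xi = 1 by rewrite xiE ip_comb// -[RHS]unit_r; field.
have ellE Y : x2 Y = r * ip E xi Y.
  have [y1 [y2 [y3 [y4 [-> -> _ _]]]]] := frameP Y.
  by rewrite xiE ip_comb//; field.
have x4E Y : x4 Y = d5 * ip E (f 0 0 0 1) Y.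
  have [y1 [y2 [y3 [y4 [-> _ _ ->]]]]] := frameP Y.
  by rewrite ip_comb//; ring.
have eta1 : ip E (f 0 0 0 1) (f 0 0 0 1) = 1 by rewrite ip_comb//; ring.
have xi_eta : ip E xi (f 0 0 0 1) = 0 by rewrite xiE ip_comb//; ring.
have kE : - d5 = - 1 * d5 by ring.
have [s [so uT]] := normal_geodesic_hyperbolic LF uE HS xi1 rn ellE cG
  eta1 xi_eta x4E kE.
have key t : orbit_shape_matrix G g h c t (- s) (M' (s * t)) /\
    (orbit_totally_geodesic G g h c t <-> M' (s * t) = 0).
  rewrite /M' scale_mx3 -(mulN1r s).
  have {}uT := uT t; pose x := - d5 * (s * t); rewrite -/x in uT *.
  have C0 := cosh_gt0 x; have Cn := lt0r_neq0 C0.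
  have UE : sech x *: xi + tanh x *: f 0 0 0 1 =
      f 0 (sech x / r) (sech x * d4 / r) (tanh x).
    rewrite xiE /f !frame_combE !scale0r !add0r !scale1r addr0 scalerDr !scalerA.
    by rewrite mulrA.
  rewrite UE in uT.
  pose C := sech x; pose T := tanh x.
  have CT : C ^+ 2 + T ^+ 2 = 1 := sech2_tanh2 x.
  (* Everything becomes rational in C = sech and T = tanh, subject to C^2 + T^2 = 1. *)
  have cE : cosh x = C^-1 by rewrite /C /sech invrK.
  have sE : sinh x = T / C by rewrite /T /tanh -cE divfK.
  have C1n : C != 0 by rewrite invr_eq0.
  (* The second vector is the unit vector of [h] orthogonal to E1 and E4; the third, T xi - C eta,
     is U = C xi + T eta turned by a right angle. *)
  apply: (orbit_shape3 LF uE HS xi1 rn ellE cG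
    (b1 := f 1 0 0 0) (b2 := f 0 (d4 / r) (- r^-1) 0)
    (b3 := f 0 (T / r) (T * d4 / r) (- C)) so.1 _ uT).
  - by rewrite oppr_eq0 oner_eq0.
  - rewrite /f !ip_comb//; split; [ring|ring|ring|split; [|ring|]].
      by rewrite -[RHS]unit_r; field.
    transitivity (T ^+ 2 * ((1 + d4 ^+ 2) / r ^+ 2) + C ^+ 2); first by field.
    by rewrite unit_r mulr1 addrC CT.
  - rewrite /f !ip_comb// -/C -/T; split; [ring|by field|].
    transitivity (C * T * ((1 + d4 ^+ 2) / r ^+ 2 - 1)); first by field.
    by rewrite unit_r; ring.
  - rewrite /f !sol1_br_comb// !ip_comb// /w /th -/x cE sE -/C -/T.
    have -> : C / r * - r^-1 - C * d4 / r * (d4 / r) = - C.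
      by rewrite -[RHS]mulr1 -unit_r; field.
    have -> : C / r * - C - T * (T / r) = - r^-1.
      by rewrite -[RHS]mulr1 -CT; field.
    have -> : C * d4 / r * - C - T * (T * d4 / r) = - (d4 / r).
      by rewrite -[RHS]mulr1 -CT; field.
    split; [| | |split].
    + by field; rewrite ?d1n ?d5n ?rn ?C1n.
    + by field; rewrite ?d1n ?d5n ?rn ?C1n.
    + by field; rewrite ?d1n ?d5n ?rn ?C1n.
    (* From here on the entries agree only modulo r^2 = 1 + d4^2. *)
    + by apply: (eq_of_relation (k := d5 * T / r ^+ 2) r2); field; rewrite ?d1n ?rn.
    + by apply: (eq_of_relation (k := - d4 * d5 / r ^+ 2) r2); field; rewrite ?d1n ?rn.
    + by apply: (eq_of_relation (k := - d5 * T / r ^+ 2) r2); field; rewrite ?d1n ?rn.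
split.
- by exists s; split=> // t; have [] := key t.
- exact: (minimal_normal_orbit LF uE HS xi1 rn ellE cG).
- move=> t; have [_ ->] := key t; rewrite /M' scale_mx3.
  set x := - d5 * (s * t); have Cn := lt0r_neq0 (cosh_gt0 x).
  (* Again the diagonal forces x = 0, where [w] equals 1 / (2 d1 d5). *)
  move=> /mx3_eq0[[_ w0 _] [[_ t0 _] _]].
  move/eqP: t0; rewrite mulf_eq0 (negPf d5n)/= => /eqP/tanh_eq0 x0.
  move/eqP: w0; rewrite mulf_eq0 (negPf d5n)/= /w -/x x0 sinh0 mulr0 addr0.
  rewrite mulf_eq0 invr_eq0 4!mulf_eq0 pnatr_eq0 (negPf d1n) (negPf d5n) (negPf rn)/=.
  by move: Cn; rewrite x0 => /negPf ->.
Qed.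

End Sol1Cases.

(** * Orbits in Sol_{m,n}^4 *)

Section SolCases.
Variables (R : realType) (l d1 d2 d3 d4 : R).
Hypotheses (l_gt1 : 1 < l) (d4_gt0 : 0 < d4).
Let simp := (@xZE R, @xNE R, @xLE R, @xDE R, mulr0, mul0r, mulr1, addr0, mul1r, add0r, subr0).

Let G := Sol l.
Let E1 : 'rV[R]_4 := e1 R.
Let E2 : 'rV[R]_4 := d1 *: e1 R + e2 R.
Let E3 : 'rV[R]_4 := d2 *: e1 R + d3 *: e2 R + e3 R.
Let E4 : 'rV[R]_4 := d4 *: e4 R.
Let E := sol_frame d1 d2 d3 d4.
Let g := left_metric G E.
Let f := frame_comb E.

Let d4n := lt0r_neq0 d4_gt0.
Let uE : frame_mx E \in unitmx := sol_frame_unit d1 d2 d3 d4_gt0.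

Let l_gt0 : 0 < l. Proof. exact: lt_trans ltr01 l_gt1. Qed.
Let l0 : l != 0. Proof. by rewrite gt_eqF. Qed.
Let lp1 : l + 1 != 0. Proof. by rewrite gt_eqF// addr_gt0. Qed.
Let lp2 : l + 2 != 0. Proof. by rewrite gt_eqF// addr_gt0. Qed.
Let l21 : 2 * l + 1 != 0. Proof. by rewrite gt_eqF// addr_gt0// mulr_gt0. Qed.
Let two0 : 2 != 0 :> R. Proof. by rewrite pnatr_eq0. Qed.
Let half0 : d4 / 2 != 0. Proof. by rewrite mulf_neq0// invr_eq0. Qed.

Let frameP Y : exists y1 y2 y3 y4, [/\ Y = f y1 y2 y3 y4,
  x1 Y = y1 + d1 * y2 + d2 * y3, x2 Y = y2 + d3 * y3, x3 Y = y3 & x4 Y = d4 * y4].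
Proof.
have [y1 [y2 [y3 [y4 ->]]]] := frame_combP Y uE.
exists y1, y2, y3, y4; split=> //;
  by rewrite frame_combE /e1 /e2 /e3 /e4 !simp //; ring.
Qed.

Let f_lin a y1 y2 y3 y4 b z1 z2 z3 z4 : a *: f y1 y2 y3 y4 + b *: f z1 z2 z3 z4 =
  f (a * y1 + b * z1) (a * y2 + b * z2) (a * y3 + b * z3) (a * y4 + b * z4).
Proof.
rewrite /f /frame_comb !scalemxAl -mulmxDl; congr (_ *m _).
by apply: vec4P; rewrite !simp.
Qed.

Let E4f : f 0 0 0 1 = E4.
Proof. by rewrite /f frame_combE !scale0r !add0r scale1r. Qed.

Let eta1 : ip E (f 0 0 0 1) (f 0 0 0 1) = 1.
Proof. by rewrite ip_comb//; ring. Qed.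

Let x4E Y : x4 Y = d4 * ip E (f 0 0 0 1) Y.
Proof.
have [y1 [y2 [y3 [y4 [-> _ _ _ ->]]]]] := frameP Y.
by rewrite ip_comb//; ring.
Qed.

Let sign_neq0 (s : R) : s = 1 \/ s = -1 -> s != 0.
Proof. by case=> ->; rewrite ?oppr_eq0 oner_eq0. Qed.

Lemma sol_orbits_a :
   let h := span [:: E1; E2; E3] in
   let w := d1 * d3 * (l + 2) - d2 * (2 * l + 1) in
   forall c : R -> 'rV[R]_4, normal_geodesic G g h c ->
   [/\ exists s, orientation c E4 s /\ forall t,
         orbit_shape_matrix G g h c t s
           (- (d4 / 2) *:
            mx3 [:: [:: - 2 * l;          - d1 * (l - 1);   w];
                    [:: - d1 * (l - 1);   - 2;              - d3 * (l + 2)];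
                    [:: w;                - d3 * (l + 2);   2 * (l + 1)]]),
       forall t, orbit_minimal G g h c t &
       forall t, ~ orbit_totally_geodesic G g h c t].
Proof.
move=> h w c cG; have [L [M LF]] := sol_left_frame l.
have HS : hypersurface_subgroup G (sol_br l) h (@x4 R) 0.
  apply: sol_hypersurface4.
  - by move=> v /span3P[x [y [z ->]]]; rewrite /E1 /E2 /E3 /e1 /e2 /e3 !simp.
  - by apply/span3P; exists 1, 0, 0; rewrite !scale0r !addr0 scale1r.
  - apply/span3P; exists (- d1), 1, 0.
    by apply: vec4P; rewrite /E1 /E2 /e1 /e2 !simp ?xE; ring.
  - apply/span3P; exists (d1 * d3 - d2), (- d3), 1.
    by apply: vec4P; rewrite /E1 /E2 /E3 /e1 /e2 /e3 !simp ?xE; ring.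
have xi1 : ip E E4 E4 = 1 by rewrite -E4f.
have ellE Y : x4 Y = d4 * ip E E4 Y by rewrite -E4f.
have [s [so uT]] := normal_geodesic_ideal LF uE HS xi1 d4n ellE cG erefl.
pose S := - (d4 / 2) *: mx3 [:: [:: - 2 * l;          - d1 * (l - 1);   w];
  [:: - d1 * (l - 1);   - 2;              - d3 * (l + 2)];
  [:: w;                - d3 * (l + 2);   2 * (l + 1)]].
have key t : orbit_shape_matrix G g h c t s S /\
    (orbit_totally_geodesic G g h c t <-> S = 0).
  rewrite /S scale_mx3 -[s]mul1r.
  apply: (orbit_shape3 LF uE HS xi1 d4n ellE cG (b1 := f 1 0 0 0) (b2 := f 0 1 0 0)
    (b3 := f 0 0 1 0) so.1 (oner_neq0 _) (uT t)).
  - by rewrite /f !ip_comb//; split; [| | |split]; ring.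
  - by rewrite -E4f /f !ip_comb//; split; ring.
  - rewrite -E4f /f !sol_br_comb !ip_comb// /w.
    by split; [| | |split]; field.
split.
- by exists s; split=> // t; have [] := key t.
- exact: (minimal_normal_orbit LF uE HS xi1 d4n ellE cG).
- move=> t; have [_ ->] := key t; rewrite /S scale_mx3 => /mx3_eq0[_ [[_ /eqP]]].
  by rewrite mulrNN mulf_eq0 (negPf half0) (negPf two0).
Qed.

Lemma sol_orbits_b :
   let h := span [:: E1; E2; E4] in
   let w := d1 * d3 * (l + 2) - d2 * (2 * l + 1) in
   let u := d4 * (l + 1) in
   let M t := - (d4 / 2) *:
     mx3 [:: [:: 2 * l * tanh (u * t);          d1 * (l - 1) * tanh (u * t); w];
             [:: d1 * (l - 1) * tanh (u * t);   2 * tanh (u * t);            - d3 * (l + 2)];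
             [:: w;                             - d3 * (l + 2);              - 2 * (l + 1) * tanh (u * t)]] in
   forall c : R -> 'rV[R]_4, normal_geodesic G g h c ->
   [/\ exists s, orientation c E3 s /\ forall t,
         orbit_shape_matrix G g h c t (- s) (M (s * t)),
       forall t, orbit_minimal G g h c t &
       forall t, orbit_totally_geodesic G g h c t <->
         [/\ t = 0, d2 = 0 & d3 = 0]].
Proof.
move=> h w u M' c cG; have [L [M LF]] := sol_left_frame l.
have HS : hypersurface_subgroup G (sol_br l) h (@x3 R) (- (l + 1)).
  apply: sol_hypersurface3.
  - by move=> v /span3P[x [y [z ->]]]; rewrite /E1 /E2 /E4 /e1 /e2 /e4 !simp.
  - by apply/span3P; exists 1, 0, 0; rewrite !scale0r !addr0 scale1r.
  - apply/span3P; exists (- d1), 1, 0.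
    by apply: vec4P; rewrite /E1 /E2 /e1 /e2 !simp ?xE; ring.
  - apply/span3P; exists 0, 0, d4^-1.
    by rewrite /E4 !scale0r !add0r scalerA mulVf// scale1r.
have E3E : E3 = f 0 0 1 0 by rewrite /f frame_combE !scale0r !add0r scale1r addr0.
have xi1 : ip E E3 E3 = 1 by rewrite E3E ip_comb//; ring.
have ellE Y : x3 Y = 1 * ip E E3 Y.
  have [y1 [y2 [y3 [y4 [-> _ _ -> _]]]]] := frameP Y.
  by rewrite E3E ip_comb//; ring.
have xi_eta : ip E E3 (f 0 0 0 1) = 0 by rewrite E3E ip_comb//; ring.
have kE : u = - - (l + 1) * d4 by rewrite /u; ring.
have [s [so uT]] := normal_geodesic_hyperbolic LF uE HS xi1 (oner_neq0 _) ellE cG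
  eta1 xi_eta x4E kE.
have s0 := sign_neq0 so.1.
have key t : orbit_shape_matrix G g h c t (- s) (M' (s * t)) /\
    (orbit_totally_geodesic G g h c t <-> M' (s * t) = 0).
  rewrite /M' scale_mx3 -(mulN1r s).
  have := uT t; set x := u * (s * t) => {}uT.
  have CT : sech x * sech x - tanh x * - tanh x = 1.
    by rewrite -[in RHS](sech2_tanh2 x); ring.
  have UE : sech x *: E3 + tanh x *: f 0 0 0 1 = f 0 0 (sech x) (tanh x).
    by rewrite E3E f_lin; congr f; ring.
  rewrite UE in uT.
  apply: (orbit_shape3 LF uE HS xi1 (oner_neq0 _) ellE cG
    (b1 := f 1 0 0 0) (b2 := f 0 1 0 0)
    (b3 := f 0 0 (- tanh x) (sech x)) so.1 _ uT).
  - by rewrite oppr_eq0 oner_eq0.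
  - rewrite /f !ip_comb//; split; [ring|ring|ring|split; [ring|ring|]].
    by rewrite -[RHS](sech2_tanh2 x); ring.
  - by rewrite /f !ip_comb//; split; ring.
  - rewrite /f !sol_br_comb !ip_comb// CT /w.
    by split; [| | |split]; field.
split.
- by exists s; split=> // t; have [] := key t.
- exact: (minimal_normal_orbit LF uE HS xi1 (oner_neq0 _) ellE cG).
- move=> t; have [_ ->] := key t; rewrite /M' scale_mx3; split.
    (* The entry (2, 3) gives d3 = 0, after which [w] is a nonzero multiple of d2; the entry (1, 1)
       then gives t = 0. *)
    move=> /mx3_eq0[[e1 _ e2] [[_ _ e3] _]].
    have K a : - (d4 / 2) * a = 0 -> a = 0.
      by move=> /eqP; rewrite mulf_eq0 oppr_eq0 (negPf half0) => /eqP.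
    have d30 : d3 = 0.
      by move/K/eqP: e3; rewrite mulNr oppr_eq0 mulf_eq0 (negPf lp2) orbF => /eqP.
    have d20 : d2 = 0.
      move/K/eqP: e2; rewrite /w d30 mulr0 mul0r sub0r oppr_eq0 mulf_eq0 (negPf l21).
      by rewrite orbF => /eqP.
    split=> //; move/K/eqP: e1; rewrite 2!mulf_eq0 (negPf two0) (negPf l0)/=.
    move=> /eqP/tanh_eq0/eqP; rewrite /u !mulf_eq0 (negPf d4n) (negPf lp1) (negPf s0).
    by move=> /eqP.
  move=> [-> d20 d30]; apply/mx3_eq0.
  by rewrite !mulr0 tanh0 /w d20 d30; split; [|split]; split; ring.
Qed.

Lemma sol_orbits_c :
   let r := Num.sqrt (1 + d3 ^+ 2) in
   let h := span [:: E1; d3 *: E2 - E3; E4] in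
   let xi : 'rV[R]_4 := r^-1 *: (E2 + d3 *: E3) in
   let w t := (1 + 2 * l) * (d2 - d3 * d1) * tanh (d4 * t) / r in
   let th := (d1 * (1 - l) + d1 * d3 ^+ 2 * (2 + l)
              - d2 * d3 * (1 + 2 * l)) / r in
   let M t := (d4 / 2) *:
     mx3 [:: [:: 2 * l * tanh (d4 * t); w t;                            th];
             [:: w t;                   - 2 * (l + 1) * tanh (d4 * t);  d3 * (l + 2)];
             [:: th;                    d3 * (l + 2);                   2 * tanh (d4 * t)]] in
   forall c : R -> 'rV[R]_4, normal_geodesic G g h c ->
   [/\ exists s, orientation c xi s /\ forall t,
         orbit_shape_matrix G g h c t (- s) (M (s * t)),
       forall t, orbit_minimal G g h c t &
       forall t, orbit_totally_geodesic G g h c t <->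
         [/\ t = 0, d1 = 0 & d3 = 0]].
Proof.
move=> r h xi w th M' c cG; have [L [M LF]] := sol_left_frame l.
have d32 : 0 < 1 + d3 ^+ 2 by rewrite ltr_pwDl// sqr_ge0.
have r2 : r ^+ 2 = 1 + d3 ^+ 2 by rewrite sqr_sqrtr// ltW.
have rn : r != 0 by rewrite sqrtr_eq0 -ltNge.
have unit_r : (1 + d3 ^+ 2) / r ^+ 2 = 1 by rewrite -r2 divff// expf_neq0.
have HS : hypersurface_subgroup G (sol_br l) h (@x2 R) 1.
  apply: sol_hypersurface2.
  - by move=> v /span3P[x [y [z ->]]]; rewrite /E1 /E2 /E3 /E4 /e1 /e2 /e3 /e4 !simp; ring.
  - by apply/span3P; exists 1, 0, 0; rewrite !scale0r !addr0 scale1r.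
  - apply/span3P; exists (d1 * d3 - d2), (- 1), 0.
    by apply: vec4P; rewrite /E1 /E2 /E3 /E4 /e1 /e2 /e3 /e4 !simp ?xE; ring.
  - apply/span3P; exists 0, 0, d4^-1.
    by rewrite /E4 !scale0r !add0r scalerA mulVf// scale1r.
have xiE : xi = f 0 r^-1 (d3 / r) 0.
  rewrite /f frame_combE /xi !scale0r add0r addr0 scalerDr scalerA.
  by rewrite [r^-1 * d3]mulrC.
have xi1 : ip E xi xi = 1 by rewrite xiE ip_comb// -[RHS]unit_r; field.
have ellE Y : x2 Y = r * ip E xi Y.
  have [y1 [y2 [y3 [y4 [-> _ -> _ _]]]]] := frameP Y.
  by rewrite xiE ip_comb//; field.
have xi_eta : ip E xi (f 0 0 0 1) = 0 by rewrite xiE ip_comb//; ring.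
have kE : - d4 = - 1 * d4 by ring.
have [s [so uT]] := normal_geodesic_hyperbolic LF uE HS xi1 rn ellE cG
  eta1 xi_eta x4E kE.
have s0 := sign_neq0 so.1.
have key t : orbit_shape_matrix G g h c t (- s) (M' (s * t)) /\
    (orbit_totally_geodesic G g h c t <-> M' (s * t) = 0).
  rewrite /M' scale_mx3 -(mulN1r s).
  have := uT t; rewrite (mulNr d4) tanhN sechN; set x := d4 * (s * t) => {}uT.
  rewrite /w -/x.
  set C := sech x in uT *; set T := tanh x in uT *.
  have CT : C ^+ 2 + T ^+ 2 = 1 := sech2_tanh2 x.
  have UE : C *: xi + - T *: f 0 0 0 1 = f 0 (C / r) (C * d3 / r) (- T).
    by rewrite xiE f_lin; congr f; ring.
  rewrite UE in uT.
  apply: (orbit_shape3 LF uE HS xi1 rn ellE cG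
    (b1 := f 1 0 0 0) (b2 := f 0 (- (d3 / r)) r^-1 0)
    (b3 := f 0 (- (T / r)) (- (T * d3 / r)) (- C)) so.1 _ uT).
  - by rewrite oppr_eq0 oner_eq0.
  - rewrite /f !ip_comb//; split; [ring|ring|ring|split; [|ring|]].
      by rewrite -[RHS]unit_r; field.
    transitivity (T ^+ 2 * ((1 + d3 ^+ 2) / r ^+ 2) + C ^+ 2); first by field.
    by rewrite unit_r mulr1 addrC CT.
  - rewrite /f !ip_comb//; split; [ring|by field|].
    transitivity (C * T * (1 - (1 + d3 ^+ 2) / r ^+ 2)); first by field.
    by rewrite unit_r; ring.
  - rewrite /f !sol_br_comb !ip_comb// /th.
    have -> : C / r * - C - - T * - (T / r) = - r^-1.
      by rewrite -[RHS]mulr1 -CT; field.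
    have -> : C * d3 / r * - C - - T * - (T * d3 / r) = - (d3 / r).
      by rewrite -[RHS]mulr1 -CT; field.
    split; [| | |split].
    + by field; rewrite ?rn.
    + by field; rewrite ?rn.
    + by field; rewrite ?rn.
    + by apply: (eq_of_relation (k := - d4 * (l + 1) * T / r ^+ 2) r2); field; rewrite ?rn.
    + by apply: (eq_of_relation (k := d4 * d3 * (l + 2) / (2 * r ^+ 2)) r2); field; rewrite ?rn.
    + by apply: (eq_of_relation (k := d4 * T / r ^+ 2) r2); field; rewrite ?rn.
split.
- by exists s; split=> // t; have [] := key t.
- exact: (minimal_normal_orbit LF uE HS xi1 rn ellE cG).
- move=> t; have [_ ->] := key t; rewrite /M' scale_mx3; split.
    (* The entry (2, 3) gives d3 = 0, which reduces [th] to d1 (1 - l) / r with l > 1; the entry (1,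
       1) gives t = 0. *)
    move=> /mx3_eq0[[e1 _ e2] [[_ _ e3] _]].
    have K a : d4 / 2 * a = 0 -> a = 0.
      by move=> /eqP; rewrite mulf_eq0 (negPf half0) => /eqP.
    have d30 : d3 = 0.
      by move/K/eqP: e3; rewrite mulf_eq0 (negPf lp2) orbF => /eqP.
    have d10 : d1 = 0.
      move/K/eqP: e2; rewrite /th d30 expr0n /= !mulr0 !mul0r addr0 subr0.
      have l1' : 1 - l != 0 by rewrite subr_eq0 lt_eqF.
      by rewrite mulf_eq0 invr_eq0 (negPf rn) orbF mulf_eq0 (negPf l1') orbF => /eqP.
    split=> //; move/K/eqP: e1; rewrite 2!mulf_eq0 (negPf two0) (negPf l0)/=.
    move=> /eqP/tanh_eq0/eqP; rewrite !mulf_eq0 (negPf d4n) (negPf s0).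
    by move=> /eqP.
  move=> [-> d10 d30]; apply/mx3_eq0.
  by rewrite /w /th !mulr0 tanh0 d10 d30; split; [|split]; split; ring.
Qed.


(** The form x1 has weight l and x4 is d4 times the form dual to [eta], whence P = - l d4. The basis
    giving the stated matrix degenerates at t = d2 = 0, so that orbit gets a basis of its own. *)
Lemma sol_orbits_d :
   let h := span [:: d1 *: E1 - E2; d2 *: E1 - E3; E4] in
   let A := 1 + d1 ^+ 2 in
   let B := 1 + d1 ^+ 2 + d2 ^+ 2 in
   let xi : 'rV[R]_4 := (Num.sqrt B)^-1 *: (E1 + d1 *: E2 + d2 *: E3) in
   let P := - (l * d4) in
   let Q t := Num.sqrt (A * B * (d2 ^+ 2 + A * tanh (P * t) ^+ 2)) in
   let w t := 2^-1 *
     (B * (d3 * (2 + l) * A - d1 * d2 * (1 + 2 * l)) / Q t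
      - A * (d3 * A - d1 * d2) * (2 + l) * sech (P * t) ^+ 2 / Q t) in
   let th t := d1 * (l - 1) * Num.sqrt B * tanh (P * t) /
               (2 * Num.sqrt (d2 ^+ 2 + A * tanh (P * t) ^+ 2)) in
   let rho := - (d2 * (1 + 2 * l)) / (2 * Num.sqrt A) in
   let M t := d4 *:
     mx3 [:: [:: tanh (P * t); w t;                        th t];
             [:: w t;          - (l + 1) * tanh (P * t);   rho];
             [:: th t;         rho;                        l * tanh (P * t)]] in
   forall c : R -> 'rV[R]_4, normal_geodesic G g h c ->
   [/\ exists s, orientation c xi s /\ forall t, t <> 0 \/ d2 <> 0 ->
         orbit_shape_matrix G g h c t s (M (s * t)),
       forall t, orbit_minimal G g h c t &
       forall t, orbit_totally_geodesic G g h c t <->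
         [/\ t = 0, d1 = 0 & d2 = 0]].
Proof.
move=> h A B xi P Q w th rho M' c cG; have [L [M LF]] := sol_left_frame l.
have A_gt0 : 0 < A by rewrite ltr_pwDl// sqr_ge0.
have B_gt0 : 0 < B by rewrite ltr_pwDl// sqr_ge0.
pose a := Num.sqrt A; pose n := Num.sqrt B.
have a2 : a ^+ 2 = A by rewrite sqr_sqrtr// ltW.
have n2 : n ^+ 2 = B by rewrite sqr_sqrtr// ltW.
have an : a != 0 by rewrite sqrtr_eq0 -ltNge.
have nn : n != 0 by rewrite sqrtr_eq0 -ltNge.
have unit_a : (1 + d1 ^+ 2) / a ^+ 2 = 1 by rewrite a2 divff// gt_eqF.
have unit_n : (1 + d1 ^+ 2 + d2 ^+ 2) / n ^+ 2 = 1 by rewrite n2 divff// gt_eqF.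
have HS : hypersurface_subgroup G (sol_br l) h (@x1 R) l.
  apply: sol_hypersurface1.
  - by move=> v /span3P[x [y [z ->]]]; rewrite /E1 /E2 /E3 /E4 /e1 /e2 /e3 /e4 !simp; ring.
  - apply/span3P; exists (- 1), 0, 0.
    by apply: vec4P; rewrite /E1 /E2 /E3 /E4 /e1 /e2 /e3 /e4 !simp ?xE; ring.
  - apply/span3P; exists d3, (- 1), 0.
    by apply: vec4P; rewrite /E1 /E2 /E3 /E4 /e1 /e2 /e3 /e4 !simp ?xE; ring.
  - apply/span3P; exists 0, 0, d4^-1.
    by rewrite /E4 !scale0r !add0r scalerA mulVf// scale1r.
have xiE : xi = f n^-1 (d1 / n) (d2 / n) 0.
  rewrite /f frame_combE; apply: vec4P;
    by rewrite /xi /E1 /E2 /E3 /e1 /e2 /e3 /e4 !simp -/n; field.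
have xi1 : ip E xi xi = 1 by rewrite xiE ip_comb// -[RHS]unit_n; field.
have ellE Y : x1 Y = n * ip E xi Y.
  have [y1 [y2 [y3 [y4 [-> -> _ _ _]]]]] := frameP Y.
  by rewrite xiE ip_comb//; field.
have xi_eta : ip E xi (f 0 0 0 1) = 0 by rewrite xiE ip_comb//; ring.
have kE : P = - l * d4 by rewrite /P; ring.
have [s [so uT]] := normal_geodesic_hyperbolic LF uE HS xi1 nn ellE cG
  eta1 xi_eta x4E kE.
have s0 := sign_neq0 so.1.
have Pn : P != 0 by rewrite oppr_eq0 mulf_neq0.
have UE C T : C *: xi + T *: f 0 0 0 1 = f (C / n) (C * d1 / n) (C * d2 / n) T.
  by rewrite xiE f_lin; congr f; ring.
have tanhP t : tanh (P * (s * t)) = 0 -> t = 0.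
  by move=> /tanh_eq0/eqP; rewrite !mulf_eq0 (negPf Pn) (negPf s0) => /eqP.
have key t : t <> 0 \/ d2 <> 0 -> orbit_shape_matrix G g h c t s (M' (s * t)) /\
    (orbit_totally_geodesic G g h c t <-> M' (s * t) = 0).
  move=> t_d2; rewrite /M' scale_mx3 -[X in orbit_shape_matrix _ _ _ _ _ X]mul1r.
  have := uT t; rewrite UE.
  have TP := tanhP t; rewrite /w /th /Q.
  set x := P * (s * t) in TP *.
  set C := sech x; set T := tanh x in TP * => {}uT.
  have CT : C ^+ 2 + T ^+ 2 = 1 := sech2_tanh2 x.
  (* [D] vanishes exactly when t = d2 = 0, and the second and third basis vectors are divided by
     it. *)
  pose D := Num.sqrt (d2 ^+ 2 + A * T ^+ 2).
  have DD : 0 < d2 ^+ 2 + A * T ^+ 2.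
    have AT : 0 <= A * T ^+ 2 by rewrite mulr_ge0 ?sqr_ge0// ltW.
    rewrite lt0r addr_ge0 ?sqr_ge0// andbT.
    apply/eqP => /eqP; rewrite paddr_eq0 ?sqr_ge0// => /andP[].
    rewrite sqrf_eq0 mulf_eq0 (gt_eqF A_gt0) sqrf_eq0 => /eqP d20 /eqP T0.
    by case: t_d2 => //; apply; exact: TP.
  have D2 : D ^+ 2 = d2 ^+ 2 + A * T ^+ 2 by rewrite sqr_sqrtr// ltW.
  have Dn : D != 0 by rewrite sqrtr_eq0 -ltNge.
  have QE : Num.sqrt (A * B * (d2 ^+ 2 + A * T ^+ 2)) = a * n * D.
    by rewrite sqrtrM ?sqrtrM// ?mulr_ge0// ltW.
  rewrite QE -/D -/n /rho -/a.
  (* The minors y1 z4 - y4 z1 of U with the second and with the third basis vector. *)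
  pose q := d2 * C ^+ 2 / (n * D); pose m := - (T * n) / (a * D).
  have b1E : sol_br l (f (C / n) (C * d1 / n) (C * d2 / n) T) (f (d1 / a) (- a^-1) 0 0) =
      f (d4 * T * (d1 / a)) (d4 * T * - a^-1) 0 0.
    by rewrite /f sol_br_comb; congr frame_comb; field; rewrite ?an ?nn ?Dn.
  have b2E : sol_br l (f (C / n) (C * d1 / n) (C * d2 / n) T)
      (f 0 0 (- (n * T) / D) (d2 * C / D)) =
      f (d4 * (- l * q + d1 ^+ 2 * (1 - l) * q
               + (d1 * d3 * (l + 2) - d2 * (2 * l + 1)) * (D / n)))
        (d4 * (- (d1 * q) - d3 * (l + 2) * (D / n)))
        (d4 * (l + 1) * (D / n)) 0.
    rewrite /f sol_br_comb.
    (* Since n^2 = A + d2^2 and C^2 + T^2 = 1, D^2 is also d2^2 C^2 + n^2 T^2. *)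
    have -> : C * d2 / n * (d2 * C / D) - T * (- (n * T) / D) = D / n.
      transitivity ((d2 ^+ 2 * C ^+ 2 + n ^+ 2 * T ^+ 2) / (n * D)).
        by field; rewrite ?an ?nn ?Dn.
      have -> : d2 ^+ 2 * C ^+ 2 + n ^+ 2 * T ^+ 2 = D ^+ 2.
        rewrite n2 D2; transitivity (d2 ^+ 2 * (C ^+ 2 + T ^+ 2) + A * T ^+ 2).
          by rewrite /A /B; ring.
        by rewrite CT mulr1.
      by field; rewrite ?an ?nn ?Dn.
    by congr frame_comb; rewrite /q; field; rewrite ?an ?nn ?Dn.
  have b3E : sol_br l (f (C / n) (C * d1 / n) (C * d2 / n) T)
      (f (D / (a * n)) (d1 * D / (a * n)) (- (a * d2 * C ^+ 2) / (n * D))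
         (- (a * T * C) / D)) =
      f (d4 * m * (- l + d1 ^+ 2 * (1 - l))) (- d4 * m * d1) 0 0.
    rewrite /f sol_br_comb.
    have p1 : C / n * (- (a * T * C) / D) - T * (D / (a * n)) = m.
      transitivity (- (T * (a ^+ 2 * C ^+ 2 + D ^+ 2)) / (a * n * D)).
        by field; rewrite ?an ?nn ?Dn.
      have -> : a ^+ 2 * C ^+ 2 + D ^+ 2 = n ^+ 2.
        rewrite a2 D2 n2; transitivity (A * (C ^+ 2 + T ^+ 2) + d2 ^+ 2); first by ring.
        by rewrite CT mulr1.
      by rewrite /m; field; rewrite ?an ?nn ?Dn.
    have p2 : C * d1 / n * (- (a * T * C) / D) - T * (d1 * D / (a * n)) = d1 * m.
      by rewrite -p1; field; rewrite ?an ?nn ?Dn.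
    (* This minor vanishes, so the bracket of U with the third vector has no E3 component. *)
    have p3 : C * d2 / n * (- (a * T * C) / D) - T * (- (a * d2 * C ^+ 2) / (n * D)) = 0.
      by field; rewrite ?an ?nn ?Dn.
    by rewrite p1 p2 p3; congr frame_comb; ring.
  (* [b2] and [b3] arise from the horizontal vector (d2, d1 d2, - A, 0) / (a n) and
     from - T xi + C eta by the rotation with cosine a T / D and sine d2 / D; this is
     what makes the entry [rho] independent of t. *)
  apply: (orbit_shape3 LF uE HS xi1 nn ellE cG
    (b1 := f (d1 / a) (- a^-1) 0 0) (b2 := f 0 0 (- (n * T) / D) (d2 * C / D))
    (b3 := f (D / (a * n)) (d1 * D / (a * n)) (- (a * d2 * C ^+ 2) / (n * D))
         (- (a * T * C) / D)) so.1 (oner_neq0 _) uT).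
  - have p1 : (T * n / D) ^+ 2 + (d2 * C / D) ^+ 2 = 1.
      transitivity ((d2 ^+ 2 * C ^+ 2 + n ^+ 2 * T ^+ 2) / D ^+ 2).
        by field; rewrite ?Dn.
      have -> : d2 ^+ 2 * C ^+ 2 + n ^+ 2 * T ^+ 2 = D ^+ 2.
        rewrite n2 D2; transitivity (d2 ^+ 2 * (C ^+ 2 + T ^+ 2) + A * T ^+ 2).
          by rewrite /A /B; ring.
        by rewrite CT mulr1.
      by rewrite divff// expf_neq0.
    rewrite /f !ip_comb//; split; [|ring|by field; rewrite ?an ?nn ?Dn|split].
    + by rewrite -[RHS]unit_a; field.
    + by rewrite -[RHS]p1; ring.
    + by field; rewrite ?an ?nn ?Dn.
    + have AE : 1 + d1 ^+ 2 = a ^+ 2 by rewrite a2.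
      have d2E : d2 ^+ 2 = n ^+ 2 - a ^+ 2 by rewrite n2 a2 /A /B; ring.
      have DE : D ^+ 2 = n ^+ 2 - a ^+ 2 * C ^+ 2.
        by rewrite D2 n2 a2 -[B](_ : A * (C ^+ 2 + T ^+ 2) + d2 ^+ 2 = _);
          [ring|rewrite CT mulr1].
      have TE : T ^+ 2 = 1 - C ^+ 2 by rewrite -CT; ring.
      transitivity ((D ^+ 4 * (1 + d1 ^+ 2) + a ^+ 4 * d2 ^+ 2 * C ^+ 4
        + a ^+ 4 * n ^+ 2 * C ^+ 2 * T ^+ 2) / (a ^+ 2 * n ^+ 2 * D ^+ 2)).
        by field; rewrite ?an ?nn ?Dn.
      rewrite AE d2E TE (_ : D ^+ 4 = D ^+ 2 * D ^+ 2); last by ring.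
      have num : D ^+ 2 * D ^+ 2 * a ^+ 2 + a ^+ 4 * (n ^+ 2 - a ^+ 2) * C ^+ 4 +
          a ^+ 4 * n ^+ 2 * C ^+ 2 * (1 - C ^+ 2) = a ^+ 2 * n ^+ 2 * D ^+ 2.
        by rewrite DE; ring.
      by rewrite num divff// !mulf_neq0// expf_neq0.
  - rewrite /f !ip_comb//; split; [by field; rewrite ?an ?nn ?Dn|by field; rewrite ?an ?nn ?Dn|].
    have DE : D ^+ 2 = d2 ^+ 2 * C ^+ 2 + n ^+ 2 * T ^+ 2.
      rewrite n2 D2; transitivity (d2 ^+ 2 * (C ^+ 2 + T ^+ 2) + A * T ^+ 2).
        by rewrite CT mulr1.
      by rewrite /A /B; ring.
    transitivity (C * (D ^+ 2 * (1 + d1 ^+ 2) - a ^+ 2 * (d2 ^+ 2 * C ^+ 2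
      + n ^+ 2 * T ^+ 2)) / (a * n ^+ 2 * D)).
      by field; rewrite ?an ?nn ?Dn.
    by rewrite DE -/A -a2 [X in X - _]mulrC subrr mulr0 mul0r.
  - rewrite b1E b2E b3E /f !ip_comb//.
    have AE : 1 + d1 ^+ 2 = a ^+ 2 by rewrite a2.
    have DE : D ^+ 2 = B - A * C ^+ 2.
      rewrite D2 -[B](_ : A * (C ^+ 2 + T ^+ 2) + d2 ^+ 2 = _); first by ring.
      by rewrite CT mulr1.
    split; [| | |split].
    + transitivity (d4 * T * ((1 + d1 ^+ 2) / a ^+ 2)); first by rewrite unit_a mulr1.
      by field; rewrite ?an.
    + transitivity (d4 / (2 * a * n * D) * (d1 * d2 * (1 - l) * (1 + d1 ^+ 2) * C ^+ 2
        + D ^+ 2 * (d3 * (l + 2) * (1 + d1 ^+ 2) - d1 * d2 * (2 * l + 1)))); last first.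
        by rewrite /q; field; rewrite ?an ?nn ?Dn.
      by rewrite DE /A; field; rewrite ?an ?nn ?Dn.
    + apply: (eq_of_relation (k := d4 * d1 * (1 - l) * T * n / (2 * a ^+ 2 * D)) AE).
      by rewrite /m; field; rewrite ?an ?nn ?Dn.
    + by field; rewrite ?an ?nn ?Dn.
    (* The identity a^2 C^2 + D^2 = n^2 removes the dependence on t. *)
    + transitivity (- (d4 * d2 * (2 * l + 1) * (a ^+ 2 * C ^+ 2 + D ^+ 2))
        / (2 * a * n ^+ 2)).
        have -> : a ^+ 2 * C ^+ 2 + D ^+ 2 = n ^+ 2 by rewrite a2 DE n2; ring.
        by field; rewrite ?an ?nn ?Dn.
      apply: (eq_of_relation (k := d4 * l * d2 * C ^+ 2 / (2 * a * n ^+ 2)) AE).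
      by rewrite /q; field; rewrite ?an ?nn ?Dn.
    + transitivity (d4 * (l * T) * ((1 + d1 ^+ 2) / a ^+ 2)).
        by rewrite unit_a mulr1.
      by rewrite /m; field; rewrite ?an ?nn ?Dn.
split.
- by exists s; split=> // t td; have [] := key t td.
- exact: (minimal_normal_orbit LF uE HS xi1 nn ellE cG).
- move=> t.
  (* Away from t = d2 = 0 no orbit is totally geodesic: the entry (1, 1) would give t = 0 and [rho]
     would give d2 = 0. *)
  have [t_d2|t_d2] := EM (t <> 0 \/ d2 <> 0).
    have [_ ->] := key t t_d2; rewrite /M' scale_mx3; split.
      move=> /mx3_eq0[[e1 _ _] [[_ _ e2] _]]; exfalso.
      move/eqP: e1; rewrite mulf_eq0 (negPf d4n)/= => /eqP/tanhP t0.
      move/eqP: e2; rewrite mulf_eq0 (negPf d4n)/= /rho -/a mulf_eq0 oppr_eq0.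
      rewrite mulf_eq0 invr_eq0 mulf_eq0 (negPf two0) (negPf an) orbF.
      rewrite [1 + _]addrC (negPf l21) !orbF => /eqP d20.
      by case: t_d2 => H; apply: H.
    by move=> [t0 _ d20]; exfalso; case: t_d2 => H; apply: H.
  have t0 : t = 0 by apply: contrapT => t0; apply: t_d2; left.
  have d20 : d2 = 0 by apply: contrapT => d20; apply: t_d2; right.
  have := uT t; rewrite t0 !mulr0 tanh0 /sech cosh0 invr1 UE d20 mulr0 => {}uT.
  have na : n = a by rewrite /n /B d20 expr0n addr0.
  rewrite na in uT.
  (* In the degenerate case U is horizontal and E3, E4 complete the basis. The only nonzero entry is
     a multiple of d1 (1 - l), so total geodesy amounts to d1 = 0. *)
  have [_ ->] : orbit_shape_matrix G g h c 0 (1 * s)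
      (mx3 [:: [:: 0; 0; d4 / 2 * (d1 * (1 - l))]; [:: 0; 0; 0];
               [:: d4 / 2 * (d1 * (1 - l)); 0; 0]]) /\
      (orbit_totally_geodesic G g h c 0 <->
       mx3 [:: [:: 0; 0; d4 / 2 * (d1 * (1 - l))]; [:: 0; 0; 0];
               [:: d4 / 2 * (d1 * (1 - l)); 0; 0]] = 0).
    apply: (orbit_shape3 LF uE HS xi1 nn ellE cG
      (b1 := f (d1 / a) (- a^-1) 0 0) (b2 := f 0 0 1 0) (b3 := f 0 0 0 1)
      so.1 (oner_neq0 _) uT).
    + rewrite /f !ip_comb//; split; [|ring|ring|split; ring].
      by rewrite -[RHS]unit_a; field.
    + by rewrite /f !ip_comb//; split; [field|ring|ring].
    + rewrite /f !sol_br_comb !ip_comb//.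
      split; [by field|by field| |split; by field].
      by apply: (eq_of_relation (k := d4 * d1 * (1 - l) / (2 * a ^+ 2)) a2); rewrite /A; field.
  split=> [/mx3_eq0[[_ _ /eqP]]|[_ d10 _]].
    have l1' : 1 - l != 0 by rewrite subr_eq0 lt_eqF.
    by rewrite mulf_eq0 (negPf half0) mulf_eq0 (negPf l1') orbF => /eqP.
  by apply/mx3_eq0; rewrite d10 mul0r mulr0.
Qed.

End SolCases.

(** A normal geodesic may start in either direction; evaluating the matrices at s t and tying the
    sign of the normal to [s] makes the formulas valid for both. The matrix in the last case is
    asserted where its denominators do not vanish. *)
Theorem theorem3p1 (R : realType) :
  (* Nil^4 *)
  (forall (d1 d2 d3 a b : R), 0 < d1 -> 0 < d3 -> 0 <= d2 ->
   ~ (a = 0 /\ b = 0) ->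
   let G := Nil4 R in
   let E1 : 'rV[R]_4 := d1 *: e1 R in
   let E2 : 'rV[R]_4 := d2 *: e1 R + d3 *: e2 R in
   let E3 : 'rV[R]_4 := e3 R in
   let E4 : 'rV[R]_4 := e4 R in
   let g := left_metric G [tuple E1; E2; E3; E4] in
   let h := span [:: E1; E2; a *: E3 + b *: E4] in
   let xi : 'rV[R]_4 := (Num.sqrt (a ^+ 2 + b ^+ 2))^-1 *: (a *: E4 - b *: E3) in
   let w := a * d3 ^+ 2 / Num.sqrt (a ^+ 2 + b ^+ 2) in
   forall c : R -> 'rV[R]_4, normal_geodesic G g h c ->
   [/\ exists s, orientation c xi s /\ forall t,
         orbit_shape_matrix G g h c t (- s)
           ((2 * d3 * d1)^-1 *: mx3 [:: [:: 0;  w;    d1];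
                                        [:: w;  0;    - d2];
                                        [:: d1; - d2; 0]]),
       forall t, orbit_minimal G g h c t &
       forall t, ~ orbit_totally_geodesic G g h c t])
  /\
  (* Sol_1^4 *)
  (forall (d1 d2 d3 d4 d5 : R), 0 < d1 -> 0 < d5 -> 0 <= d2 -> 0 <= d4 ->
   let G := Sol1 R in
   let E1 : 'rV[R]_4 := d1 *: e1 R in
   let E2 : 'rV[R]_4 := d2 *: e1 R + e2 R in
   let E3 : 'rV[R]_4 := d3 *: e1 R + d4 *: e2 R + e3 R in
   let E4 : 'rV[R]_4 := d5 *: e4 R in
   let g := left_metric G [tuple E1; E2; E3; E4] in
   [/\ (* (a) *)
       let h := span [:: E1; E2; E3] in
       let w := d2 / (2 * d1) in
       let th := (2 * d4 * d2 - d3) / (2 * d1) in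
       forall c : R -> 'rV[R]_4, normal_geodesic G g h c ->
       [/\ exists s, orientation c E4 s /\ forall t,
             orbit_shape_matrix G g h c t (- s)
               (d5 *: mx3 [:: [:: 0;  w;    th];
                              [:: w;  - 1;  - d4];
                              [:: th; - d4; 1]]),
           forall t, orbit_minimal G g h c t &
           forall t, ~ orbit_totally_geodesic G g h c t],
       (* (b) *)
       let h := span [:: E1; E2; E4] in
       let w t := (1 - d2 * d5 * sinh (- d5 * t)) /
                  (2 * d1 * d5 * cosh (- d5 * t)) in
       let th := (2 * d4 * d2 - d3) / (2 * d1) in
       let M t := d5 *: mx3 [:: [:: 0;   w t;             th];
                                [:: w t; tanh (- d5 * t); - d4];
                                [:: th;  - d4;            - tanh (- d5 * t)]] in
       forall c : R -> 'rV[R]_4, normal_geodesic G g h c ->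
       [/\ exists s, orientation c E3 s /\ forall t,
             orbit_shape_matrix G g h c t (- s) (M (s * t)),
           forall t, orbit_minimal G g h c t &
           forall t, ~ orbit_totally_geodesic G g h c t] &
       (* (c) *)
       let r := Num.sqrt (1 + d4 ^+ 2) in
       let h := span [:: E1; E4; r^-1 *: (d4 *: E2 - E3)] in
       let xi : 'rV[R]_4 := r^-1 *: (E2 + d4 *: E3) in
       let w t := (r + d5 * (d3 - d2 * d4) * sinh (- d5 * t)) /
                  (2 * d1 * d5 * r * cosh (- d5 * t)) in
       let th := (d2 * (1 + 2 * d4 ^+ 2) - d3 * d4) / (2 * d1 * r) in
       let M t := d5 *: mx3 [:: [:: 0;   w t;             th];
                                [:: w t; tanh (- d5 * t); - d4];
                                [:: th;  - d4;            - tanh (- d5 * t)]] in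
       forall c : R -> 'rV[R]_4, normal_geodesic G g h c ->
       [/\ exists s, orientation c xi s /\ forall t,
             orbit_shape_matrix G g h c t (- s) (M (s * t)),
           forall t, orbit_minimal G g h c t &
           forall t, ~ orbit_totally_geodesic G g h c t]])
  /\
  (* Sol_{m,n}^4 *)
  (forall (m n : int) (l d1 d2 d3 d4 : R), sol_parameter m n l -> 1 < l ->
   0 < d4 -> 0 <= d1 -> 0 <= d3 ->
   let G := Sol l in
   let E1 : 'rV[R]_4 := e1 R in
   let E2 : 'rV[R]_4 := d1 *: e1 R + e2 R in
   let E3 : 'rV[R]_4 := d2 *: e1 R + d3 *: e2 R + e3 R in
   let E4 : 'rV[R]_4 := d4 *: e4 R in
   let g := left_metric G [tuple E1; E2; E3; E4] in
   [/\ (* (a) *)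
       let h := span [:: E1; E2; E3] in
       let w := d1 * d3 * (l + 2) - d2 * (2 * l + 1) in
       forall c : R -> 'rV[R]_4, normal_geodesic G g h c ->
       [/\ exists s, orientation c E4 s /\ forall t,
             orbit_shape_matrix G g h c t s
               (- (d4 / 2) *:
                mx3 [:: [:: - 2 * l;          - d1 * (l - 1);   w];
                        [:: - d1 * (l - 1);   - 2;              - d3 * (l + 2)];
                        [:: w;                - d3 * (l + 2);   2 * (l + 1)]]),
           forall t, orbit_minimal G g h c t &
           forall t, ~ orbit_totally_geodesic G g h c t],
       (* (b) *)
       let h := span [:: E1; E2; E4] in
       let w := d1 * d3 * (l + 2) - d2 * (2 * l + 1) in
       let u := d4 * (l + 1) in
       let M t := - (d4 / 2) *:
         mx3 [:: [:: 2 * l * tanh (u * t);          d1 * (l - 1) * tanh (u * t); w];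
                 [:: d1 * (l - 1) * tanh (u * t);   2 * tanh (u * t);            - d3 * (l + 2)];
                 [:: w;                             - d3 * (l + 2);              - 2 * (l + 1) * tanh (u * t)]] in
       forall c : R -> 'rV[R]_4, normal_geodesic G g h c ->
       [/\ exists s, orientation c E3 s /\ forall t,
             orbit_shape_matrix G g h c t (- s) (M (s * t)),
           forall t, orbit_minimal G g h c t &
           forall t, orbit_totally_geodesic G g h c t <->
             [/\ t = 0, d2 = 0 & d3 = 0]],
       (* (c) *)
       let r := Num.sqrt (1 + d3 ^+ 2) in
       let h := span [:: E1; d3 *: E2 - E3; E4] in
       let xi : 'rV[R]_4 := r^-1 *: (E2 + d3 *: E3) in
       let w t := (1 + 2 * l) * (d2 - d3 * d1) * tanh (d4 * t) / r in
       let th := (d1 * (1 - l) + d1 * d3 ^+ 2 * (2 + l)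
                  - d2 * d3 * (1 + 2 * l)) / r in
       let M t := (d4 / 2) *:
         mx3 [:: [:: 2 * l * tanh (d4 * t); w t;                            th];
                 [:: w t;                   - 2 * (l + 1) * tanh (d4 * t);  d3 * (l + 2)];
                 [:: th;                    d3 * (l + 2);                   2 * tanh (d4 * t)]] in
       forall c : R -> 'rV[R]_4, normal_geodesic G g h c ->
       [/\ exists s, orientation c xi s /\ forall t,
             orbit_shape_matrix G g h c t (- s) (M (s * t)),
           forall t, orbit_minimal G g h c t &
           forall t, orbit_totally_geodesic G g h c t <->
             [/\ t = 0, d1 = 0 & d3 = 0]] &
       (* (d) *)
       let h := span [:: d1 *: E1 - E2; d2 *: E1 - E3; E4] in
       let A := 1 + d1 ^+ 2 in
       let B := 1 + d1 ^+ 2 + d2 ^+ 2 in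
       let xi : 'rV[R]_4 := (Num.sqrt B)^-1 *: (E1 + d1 *: E2 + d2 *: E3) in
       let P := - (l * d4) in
       let Q t := Num.sqrt (A * B * (d2 ^+ 2 + A * tanh (P * t) ^+ 2)) in
       let w t := 2^-1 *
         (B * (d3 * (2 + l) * A - d1 * d2 * (1 + 2 * l)) / Q t
          - A * (d3 * A - d1 * d2) * (2 + l) * sech (P * t) ^+ 2 / Q t) in
       let th t := d1 * (l - 1) * Num.sqrt B * tanh (P * t) /
                   (2 * Num.sqrt (d2 ^+ 2 + A * tanh (P * t) ^+ 2)) in
       let rho := - (d2 * (1 + 2 * l)) / (2 * Num.sqrt A) in
       let M t := d4 *:
         mx3 [:: [:: tanh (P * t); w t;                        th t];
                 [:: w t;          - (l + 1) * tanh (P * t);   rho];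
                 [:: th t;         rho;                        l * tanh (P * t)]] in
       forall c : R -> 'rV[R]_4, normal_geodesic G g h c ->
       [/\ exists s, orientation c xi s /\ forall t, t <> 0 \/ d2 <> 0 ->
             orbit_shape_matrix G g h c t s (M (s * t)),
           forall t, orbit_minimal G g h c t &
           forall t, orbit_totally_geodesic G g h c t <->
             [/\ t = 0, d1 = 0 & d2 = 0]]]).
Proof.
split; [|split].
- by move=> d1 d2 d3 a b d1_gt0 d3_gt0 _ ab; exact: nil4_orbits.
- move=> d1 d2 d3 d4 d5 d1_gt0 d5_gt0 _ _; split.
  + exact: sol1_orbits_a.
  + exact: sol1_orbits_b.
  + exact: sol1_orbits_c.
- move=> m n l d1 d2 d3 d4 _ l_gt1 d4_gt0 _ _; split.
  + exact: sol_orbits_a.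
  + exact: sol_orbits_b.
  + exact: sol_orbits_c.
  + exact: sol_orbits_d.
Qed.
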